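(* Let $(H,X,V,\mathcal L,A,B,P,Q)$ be a weakly admissible tuple (defined in the context) and suppose $\nu=\dim H^0>0$. Assume that there are $\kappa>1$ and $r_1>0$ such that $$\|(I-P^0)A(z+x_1)-B(\theta)x_1-(I-P^0)A(z+x_2)+B(\theta)x_2\|_{X}\le\frac1{\kappa C_1}\|x_1-x_2\|_X\qquad(1)$$ for all $z\in B_{H^0}(\theta,r_1)$ and $x_1,x_2\in B_X(\theta,r_1)\cap X^\pm$, where $C_1=\|(B(\theta)|_{X^\pm})^{-1}\|_{L(X^\pm,X^\pm)}$. Then there exist $\epsilon>0$, a (unique) continuous map $h:B_{H^0}(\theta,\epsilon)=B_H(\theta,\epsilon)\cap H^0\to X^\pm$ satisfying $h(\theta)=\theta$ and $(I-P^0)A(z+h(z))=\theta$ for all $z\in B_{H^0}(\theta,\epsilon)$, an open neighborhood $W$ of $\theta$ in $H$, and an origin-preserving homeomorphism $$\Phi:B_{H^0}(\theta,\epsilon)\times\bigl(B_{H^+}(\theta,\epsilon)+B_{H^-}(\theta,\epsilon)\bigr)\to W$$ of the form $\Phi(z,u^++u^-)=z+h(z)+\phi_z(u^++u^-)$ with $\phi_z(u^++u^-)\in H^\pm$, such that $$\mathcal L\circ\Phi(z,u^++u^-)=\|u^+\|^2-\|u^-\|^2+\mathcal L(z+h(z))$$ for all $(z,u^++u^-)$ in the domain, and $\Phi\bigl(B_{H^0}(\theta,\epsilon)\times(B_{H^+}(\theta,\epsilon)\cap X+B_{H^-}(\theta,\epsilon))\bigr)\subset X$. Moreover: (a) for each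 $z\in B_{H^0}(\theta,\epsilon)$, $\Phi(z,\theta)=z+h(z)$, and $\phi_z(u^++u^-)\in H^-$ if and only if $u^+=\theta$; (b) the restriction of $\Phi$ to $B_{H^0}(\theta,\epsilon)\times B_{H^-}(\theta,\epsilon)$ is a homeomorphism onto its image (which lies in $X$) even if both sets are given the topologies induced by $X$. Furthermore, if (1) is replaced by the slightly stronger condition that for some $\kappa>1$, $r_1>0$ $$\|(I-P^0)A(z_1+x_1)-B(\theta)x_1-(I-P^0)A(z_2+x_2)+B(\theta)x_2\|_{X}\le\frac1{\kappa C_1}\|z_1+x_1-z_2-x_2\|_X$$ for all $z_i\in B_{H^0}(\theta,r_1)$, $x_i\in B_X(\theta,r_1)\cap X^\pm$, $i=1,2$, then $h$ is Lipschitz continuous, the function $\mathcal L^\circ(z):=\mathcal L(z+h(z))$ on $B_{H^0}(\theta,\epsilon)$ is $C^{2-0}$, and $$d\mathcal L^\circ(z_0)(z)=(A(z_0+h(z_0)),z)_H\qquad\forall z_0\in B_{H^0}(\theta,\epsilon),\ z\in H^0.$$ Consequently, $\theta$ is an isolated critical point of $\mathcal L^\circ$ provided that $\theta$ is an isolated critical point of $\mathcal L|_{V^X}$.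
   Context: Conventions. All vector spaces are real; $\theta$ denotes the origin of any of them. $B_E(\theta,r)$ is the open ball of a normed space $E$; subspaces of $H$ carry the norm of $H$ unless stated otherwise. $L_s(H)\subset L(H)$ is the space of bounded self-adjoint operators. A map $T:U\to E_2$ on an open subset $U$ of a normed space $E_1$ is continuously directional differentiable on $U$ if $DT(x,u)=\lim_{t\to0}(T(x+tu)-T(x))/t$ exists for all $x\in U$, $u\in E_1$ and $(x,u)\mapsto DT(x,u)$ is continuous on $U\times E_1$ (then $DT(x):=DT(x,\cdot)$ is bounded linear). $C^{2-0}$ means $C^1$ with locally Lipschitz derivative. A critical point is a point where the (Gâteaux) derivative vanishes. Weakly admissible tuple. $(H,X,V,\mathcal L,A,B,P,Q)$ is weakly admissible if: (S) $H$ is a Hilbert space with inner product $(\cdot,\cdot)_H$ and norm $\|\cdot\|$; $X$ is a Banach space with norm $\|\cdot\|_X$; $X\subset H$ is a dense linear subspace and $\|x\|\le\|x\|_X$ for $x\in X$. $V$ is an open neighborhood of $\theta$ in $H$; $V^X:=V\cap X$ regarded as an open subset of $X$. (F1) $\mathcal L:V\to\mathbb R$ is continuously directional differentiable on $V$. (F2w) $A:V^X\to X$ is continuously directional differentiable and $D\mathcal L(x)(u)=(A(x),u)_H$ for all $x\in V^X$, $u\in X$. (F3) $B:V^X\to L_s(H)$ is a map with $(DA(x)(u),v)_H=(B(x)u,v)_H$ for all $x\in V^X$, $u,v\in X$. (C1) $\theta$ is a critical point of $\mathcal L|_{V^X}$ (and thus of $\mathcal L$), and $0$ is either not in the spectrum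 $\sigma(B(\theta))$ or is an isolated point of it. (C2) If $u\in H$ and $B(\theta)u\in X$, then $u\in X$. (D) $B(x)=P(x)+Q(x)$ for all $x\in V^X$, where $P(x):H\to H$ is a positive definite linear operator and $Q(x):H\to H$ is a compact linear operator, with: (D1) all eigenvectors of $B(\theta)$ belonging to negative eigenvalues lie in $X$; (D2) for any sequence $\{x_k\}\subset V\cap X$ with $\|x_k\|\to0$, $\|P(x_k)u-P(\theta)u\|\to0$ for every $u\in H$; (D3) $Q:V\cap X\to L(H)$ is continuous at $\theta$ with respect to the topology on $V\cap X$ induced from $H$; (D4) for any sequence $\{x_n\}\subset V\cap X$ with $\|x_n\|\to0$ there exist $C_0>0$ and $n_0\in\mathbb N$ with $(P(x_n)u,u)_H\ge C_0\|u\|^2$ for all $u\in H$, $n\ge n_0$. Notation. $H^0=\mathrm{Ker}(B(\theta))$, $H^\pm=(H^0)^\perp$, and $H=H^0\oplus H^+\oplus H^-$ orthogonally, with $H^+$, $H^-$ invariant under $B(\theta)$ and $B(\theta)$ positive definite on $H^+$, negative definite on $H^-$. $H^0$ and $H^-$ are finite dimensional and contained in $X$. $P^0$ is the orthogonal projection onto $H^0$; $X^\pm=X\cap H^\pm$ with the norm of $X$; $B(\theta)$ restricts to an isomorphism $X^\pm\to X^\pm$. *)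

(* Defs.v *)
From HB Require Import structures.
From mathcomp Require Import all_boot all_order all_algebra.
From mathcomp Require Import all_classical all_reals all_analysis.

Set Implicit Arguments.
Unset Strict Implicit.
Unset Printing Implicit Defensive.

Import Order.TTheory GRing.Theory Num.Theory.
Import numFieldNormedType.Exports.

Local Open Scope classical_set_scope.
Local Open Scope ring_scope.

(** The inclusion of the Banach space X in the Hilbert space H is an injective
    linear map [i : {linear X -> H}]; a point of X is regarded as a point of H
    only through [i].  A map on a subset (V, V^X, a ball of a subspace) is a
    total function of which only the values on that subset are used. *)

Definition is_subspace (R : realType) (E : normedModType R) (S : set E) : Prop :=
  S 0 /\ forall (a : R) (u v : E), S u -> S v -> S (a *: u + v).

Definition has_dim (R : realType) (E : normedModType R) (S : set E) (n : nat) :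
    Prop :=
  exists e : 'I_n -> E,
    (forall u, S u <-> exists c : 'I_n -> R, u = \sum_(j < n) c j *: e j) /\
    (forall c : 'I_n -> R, \sum_(j < n) c j *: e j = 0 -> forall j, c j = 0).

Definition ball_in (R : realType) (E : normedModType R) (S : set E) (r : R) :
    set E :=
  [set u | S u /\ `|u| < r].

Definition kerop (R : realType) (E : normedModType R) (T : E -> E) : set E :=
  [set u | T u = 0].

Definition orth (R : realType) (H : normedModType R) (ip : {dot H for idfun})
    (S : set H) : set H :=
  [set u | forall v, S v -> ip u v = 0].

Definition is_oproj (R : realType) (H : normedModType R)
    (ip : {dot H for idfun}) (S : set H) (u v : H) : Prop :=
  S v /\ orth ip S (u - v).

(** Orthogonal projection onto S (0 at points which have none). *)
Definition oproj (R : realType) (H : normedModType R)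
    (ip : {dot H for idfun}) (S : set H) (u : H) : H :=
  xget 0 (is_oproj ip S u).

Definition bounded_selfadjoint (R : realType) (H : normedModType R)
    (ip : {dot H for idfun}) (T : {linear H -> H}) : Prop :=
  continuous T /\ forall u v, ip (T u) v = ip u (T v).

Definition positive_definite_on (R : realType) (H : normedModType R)
    (ip : {dot H for idfun}) (S : set H) (T : H -> H) : Prop :=
  forall u, S u -> u != 0 -> 0 < ip (T u) u.

Definition negative_definite_on (R : realType) (H : normedModType R)
    (ip : {dot H for idfun}) (S : set H) (T : H -> H) : Prop :=
  forall u, S u -> u != 0 -> ip (T u) u < 0.

Definition compact_operator (R : realType) (E F : normedModType R)
    (T : {linear E -> F}) : Prop :=
  precompact (T @` [set u | `|u| <= 1]).

(** Real spectrum; it is the whole spectrum for a self-adjoint operator. *)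
Definition spectrum (R : realType) (E : normedModType R) (T : {linear E -> E}) :
    set R :=
  [set l | ~ exists S : {linear E -> E}, continuous S /\
     (forall u, S (T u - l *: u) = u) /\ (forall u, T (S u) - l *: S u = u)].

(** Norm of an operator on the subspace S; meaningful for bounded ones, since
    the supremum of an unbounded set is 0. *)
Definition opnorm (R : realType) (E F : normedModType R) (S : set E)
    (T : E -> F) : R :=
  sup [set `|T u| | u in [set u | S u /\ `|u| <= 1]].

Definition cont_dir_diff (R : realType) (E F : normedModType R) (T : E -> F)
    (U : set E) : Prop :=
  (forall x u, U x -> derivable T x u) /\
  (forall x u, U x -> {for (x, u), continuous (fun p : E * E => 'D_p.2 T p.1)}).

(** Points of U at which the Gateaux derivative of f along the subspace S
    vanishes. *)
Definition critical_points (R : realType) (E : normedModType R) (S U : set E)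
    (f : E -> R) : set E :=
  [set x | U x /\ forall u, S u -> is_derive x u f 0].

(** l is the Frechet derivative at z of the restriction of f to the subspace S
    (near z). *)
Definition is_fderive_in (R : realType) (E : normedModType R) (S : set E)
    (f : E -> R) (z : E) (l : E -> R) : Prop :=
  (forall (a : R) u v, S u -> S v -> l (a *: u + v) = a * l u + l v) /\
  (exists K : R, forall u, S u -> `|l u| <= K * `|u|) /\
  (forall e : R, 0 < e -> exists2 d : R, 0 < d &
     forall v, S v -> `|v| < d -> `|f (z + v) - f z - l v| <= e * `|v|).

(** f is C^{2-0} on U, an open subset of the subspace S.  Continuity of the
    derivative follows from the local Lipschitz condition. *)
Definition C2m0_in (R : realType) (E : normedModType R) (S U : set E)
    (f : E -> R) : Prop :=
  exists df : E -> E -> R,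
    (forall z, U z -> is_fderive_in S f z (df z)) /\
    (forall z0, U z0 -> exists K r : R, 0 < r /\
       forall z1 z2, U z1 -> U z2 -> `|z1 - z0| < r -> `|z2 - z0| < r ->
         opnorm S (fun u => df z1 u - df z2 u) <= K * `|z1 - z2|).

Definition homeo_on (T U : topologicalType) (D : set T) (E : set U)
    (f : T -> U) : Prop :=
  set_bij D E f /\ {within D, continuous f} /\
  exists g : U -> T, (forall x, D x -> g (f x) = x) /\ {within E, continuous g}.

(** The point of X with image u (0 if there is none), and the X-norm of u. *)
Definition toX (R : realType) (H X : normedModType R) (i : {linear X -> H})
    (u : H) : X :=
  xget 0 [set x | i x = u].

Definition normX (R : realType) (H X : normedModType R) (i : {linear X -> H})
    (u : H) : R := `|toX i u|.

(** X^\pm, as a subspace of X. *)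
Definition Xpm (R : realType) (H X : normedModType R) (ip : {dot H for idfun})
    (i : {linear X -> H}) (B0 : H -> H) : set X :=
  i @^-1` (orth ip (kerop B0)).

(** (B0|_{X^\pm})^{-1} : X^\pm -> X^\pm, and its norm C_1. *)
Definition Xpm_inv (R : realType) (H X : normedModType R)
    (ip : {dot H for idfun}) (i : {linear X -> H}) (B0 : H -> H) (y : X) : X :=
  xget 0 [set x | Xpm ip i B0 x /\ B0 (i x) = i y].

Definition C1const (R : realType) (H X : normedModType R)
    (ip : {dot H for idfun}) (i : {linear X -> H}) (B0 : H -> H) : R :=
  opnorm (Xpm ip i B0) (Xpm_inv ip i B0).

Record weakly_admissible (R : realType) (H X : completeNormedModType R)
    (ip : {dot H for idfun}) (i : {linear X -> H}) (V : set H) (L : H -> R)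
    (A : X -> X) (B P Q : X -> {linear H -> H}) : Prop := {
  wa_hilbert : forall u : H, `|u| ^+ 2 = ip u u ;
  wa_inj : injective i ;
  wa_dense : dense (range i) ;
  wa_norm_le : forall x : X, `|i x| <= `|x| ;
  wa_openV : open V ;
  wa_V0 : V 0 ;
  wa_F1 : cont_dir_diff L V ;
  wa_F2_diff : cont_dir_diff A (i @^-1` V) ;
  wa_F2_grad : forall x u : X, V (i x) -> 'D_(i u) L (i x) = ip (i (A x)) (i u) ;
  wa_F3_sa : forall x : X, V (i x) -> bounded_selfadjoint ip (B x) ;
  wa_F3 : forall x u v : X, V (i x) ->
    ip (i ('D_u A x)) (i v) = ip (B x (i u)) (i v) ;
  wa_C1_crit : critical_points setT (i @^-1` V) (L \o i) 0 ;
  wa_C1_spec : ~ spectrum (B 0) 0 \/ isolated (spectrum (B 0)) 0 ;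
  wa_C2 : forall u : H, range i (B 0 u) -> range i u ;
  wa_D : forall (x : X) (u : H), V (i x) -> B x u = P x u + Q x u ;
  wa_D_pos : forall x : X, V (i x) -> positive_definite_on ip setT (P x) ;
  wa_D_compact : forall x : X, V (i x) -> compact_operator (Q x) ;
  wa_D1 : forall (l : R) (u : H), l < 0 -> u != 0 -> B 0 u = l *: u ->
    range i u ;
  wa_D2 : forall x_ : nat -> X, (forall k, V (i (x_ k))) ->
    `|i (x_ k)| @[k --> \oo] --> (0 : R) ->
    forall u : H, `|P (x_ k) u - P 0 u| @[k --> \oo] --> (0 : R) ;
  wa_D3 : forall e : R, 0 < e -> exists2 d : R, 0 < d &
    forall x : X, V (i x) -> `|i x| < d ->
      opnorm setT (fun u : H => Q x u - Q 0 u) < e ;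
  wa_D4 : forall x_ : nat -> X, (forall k, V (i (x_ k))) ->
    `|i (x_ k)| @[k --> \oo] --> (0 : R) ->
    exists (C0 : R) (n0 : nat), 0 < C0 /\
      forall (n : nat) (u : H), (n0 <= n)%N ->
        C0 * `|u| ^+ 2 <= ip (P (x_ n) u) u
}.

(** H = Ker B0 + H^+ + H^-, orthogonally, with H^+ and H^- invariant, B0 positive
    definite on H^+ and negative definite on H^-.  For a self-adjoint B0 these
    conditions determine H^+ and H^-. *)
Record definite_splitting (R : realType) (H : normedModType R)
    (ip : {dot H for idfun}) (B0 : H -> H) (Hp Hm : set H) : Prop := {
  ds_subp : is_subspace Hp ;
  ds_subm : is_subspace Hm ;
  ds_orth0p : Hp `<=` orth ip (kerop B0) ;
  ds_orth0m : Hm `<=` orth ip (kerop B0) ;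
  ds_orthpm : Hp `<=` orth ip Hm ;
  ds_sum : forall u : H, exists u0 up um : H,
    [/\ kerop B0 u0, Hp up, Hm um & u = u0 + up + um] ;
  ds_invp : forall u, Hp u -> Hp (B0 u) ;
  ds_invm : forall u, Hm u -> Hm (B0 u) ;
  ds_pos : positive_definite_on ip Hp B0 ;
  ds_neg : negative_definite_on ip Hm B0
}.

(** h : B_{H^0}(0, eps) -> X^\pm is continuous, h(0) = 0, and
    (I - P^0) A(z + h(z)) = 0 on B_{H^0}(0, eps).  Since H^0 lies in X, the
    points of that ball are the [i z] with z in X. *)
Definition reduction_map (R : realType) (H X : normedModType R)
    (ip : {dot H for idfun}) (i : {linear X -> H}) (V : set H) (A : X -> X)
    (B0 : H -> H) (eps : R) (h : H -> X) : Prop :=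
  let H0 := kerop B0 in
  {within ball_in H0 eps, continuous h} /\
  (forall z, ball_in H0 eps z -> Xpm ip i B0 (h z)) /\
  h 0 = 0 /\
  (forall z : X, ball_in H0 eps (i z) ->
     V (i (z + h (i z))) /\
     i (A (z + h (i z))) - oproj ip H0 (i (A (z + h (i z)))) = 0).

Definition reduced_functional (R : realType) (H X : normedModType R)
    (i : {linear X -> H}) (L : H -> R) (h : H -> X) (z : H) : R :=
  L (z + i (h z)).

Record splitting (R : realType) (H X : normedModType R)
    (ip : {dot H for idfun}) (i : {linear X -> H}) (V : set H) (L : H -> R)
    (A : X -> X) (B0 : H -> H) (Hp Hm : set H) (eps : R) (h : H -> X)
    (W : set H) (Phi : H * H -> H) (phi : H -> H -> H) : Prop := {
  sp_eps : 0 < eps ;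
  sp_h : reduction_map ip i V A B0 eps h ;
  sp_h_uniq : forall h', reduction_map ip i V A B0 eps h' ->
    forall z, ball_in (kerop B0) eps z -> h' z = h z ;
  sp_openW : open W ;
  sp_W0 : W 0 ;
  sp_WV : W `<=` V ;
  sp_homeo : homeo_on
    (ball_in (kerop B0) eps `*`
       [set up + um | up in ball_in Hp eps & um in ball_in Hm eps]) W Phi ;
  sp_Phi0 : Phi (0, 0) = 0 ;
  sp_form : forall z up um, ball_in (kerop B0) eps z ->
    ball_in Hp eps up -> ball_in Hm eps um ->
    Phi (z, up + um) = z + i (h z) + phi z (up + um) /\
    orth ip (kerop B0) (phi z (up + um)) ;
  sp_L : forall z up um, ball_in (kerop B0) eps z ->
    ball_in Hp eps up -> ball_in Hm eps um ->
    L (Phi (z, up + um)) =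
      `|up| ^+ 2 - `|um| ^+ 2 + reduced_functional i L h z ;
  sp_X : Phi @` (ball_in (kerop B0) eps `*`
       [set up + um | up in ball_in Hp eps `&` range i & um in ball_in Hm eps])
     `<=` range i ;
  sp_a_0 : forall z, ball_in (kerop B0) eps z -> Phi (z, 0) = z + i (h z) ;
  sp_a_neg : forall z up um, ball_in (kerop B0) eps z ->
    ball_in Hp eps up -> ball_in Hm eps um ->
    (Hm (phi z (up + um)) <-> up = 0) ;
  sp_b_H : homeo_on (ball_in (kerop B0) eps `*` ball_in Hm eps)
    (Phi @` (ball_in (kerop B0) eps `*` ball_in Hm eps)) Phi ;
  sp_b_img : Phi @` (ball_in (kerop B0) eps `*` ball_in Hm eps) `<=` range i ;
  (* the same restriction, its source and image being viewed in X * X and X *)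
  sp_b_X :
    let D := [set p : X * X |
                ball_in (kerop B0) eps (i p.1) /\ ball_in Hm eps (i p.2)] in
    let PhiX := fun p : X * X => toX i (Phi (i p.1, i p.2)) in
    homeo_on D (PhiX @` D) PhiX
}.

(* Main.v *)
(** Since B(0) is invertible on X^\pm, (1) makes x |-> x - B(0)^-1 (I - P^0) A(z + x)
    a contraction of a small ball of X^\pm; its fixed point is h(z), and h is
    Lipschitz under (1).  By (D) and density of X, near the origin L is strongly
    concave along H^- and convex along H^+, with quadratic growth at z + h(z), where
    the derivative vanishes on H^+ + H^-.  Hence, for
    q = z + h(z) and x in H^+, y |-> L(q + x + y) has a unique maximum point m(x) on a
    ball of H^-, and j(x) = L(q + x + m(x)) - L(q) and
    g(v) = L(q + x + m(x)) - L(q + x + m(x) + v) grow strictly and at least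
    quadratically along rays.  So x |-> sqrt(j(x)) x/|x| and v |-> sqrt(g(v)) v/|v|
    are injective with continuous inverse, also in the parameters q and x, and these
    inverses make up phi_z. *)

(* A Morse lemma by differentiation is out of reach: L has only first directional derivatives on H,
   A is differentiable only on X, and P(x) is only strongly continuous at the origin. All
   second-order information is therefore turned into inequalities for the derivative of L along H^+
   and H^-, proved at points of X that are small in the norm of H and then carried to H by density;
   this works because the norm of X does not enter these inequalities. The normal form needs no more
   than growth along rays, and no differentiability of phi_z is sought. Because rays are kept, the
   H^+ component of phi_z(u^+ + u^-) is a multiple of u^+: it lies in X when u^+ does, and it
   vanishes exactly when u^+ does. Since H^- is finite-dimensional and contained in X, maxima over
   its balls exist and projecting onto it is continuous from H to X. The point z + h(z) is treated
   as a function of any w in H through P^0 w, so that the inverse of Phi can read z off a point and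
   then undo a single fibre. *)
Require Import Defs.
From HB Require Import structures.
From mathcomp Require Import all_boot all_order all_algebra.
From mathcomp Require Import all_classical all_reals all_analysis.
From mathcomp Require Import ring lra.

Set Implicit Arguments.
Unset Strict Implicit.

Import Order.TTheory GRing.Theory Num.Theory.
Import numFieldNormedType.Exports.

Local Open Scope classical_set_scope.
Local Open Scope ring_scope.

(* Decides equalities between sums of atoms, up to sign, in an abelian group. *)
Ltac zmod_step :=
  match goal with
  | |- is_true (_ + - ?z == 0) => first [rewrite addrK | rewrite [_ + z + _]addrAC]
  | |- is_true (_ + ?z == 0) => first [rewrite subrK | rewrite [_ - z + _]addrAC]
  end.

Ltac zmod :=
  apply/eqP; rewrite -subr_eq0;
  match goal with |- is_true (?s == 0) => rewrite -[s]add0r end;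
  rewrite ?(opprD, opprB, opprK, addrA, scalerDr, scalerN, scaleNr, scalerDl,
    addr0, subr0, oppr0);
  do ?zmod_step; rewrite ?eqxx //.

(** * Continuity and directional derivatives in epsilon-delta form *)

Lemma continuous_at_distP (R : realType) (E F : normedModType R) (f : E -> F)
    (x : E) :
  {for x, continuous f} <->
  forall e : R, 0 < e -> exists2 d : R, 0 < d &
    forall y, `|y - x| < d -> `|f y - f x| < e.
Proof.
split=> [/cvgrPdist_lt cf e e0|H].
  have /nbhs_normP[d /= d0 hd] := cf e e0.
  exists d => // y yx; rewrite distrC; apply: hd.
  by rewrite /ball_ /= distrC.
apply/cvgrPdist_lt => e e0; have [d d0 hd] := H e e0.
apply/nbhs_normP; exists d => //= y; rewrite /ball_ /= distrC => /hd.
by rewrite distrC.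
Qed.

Lemma within_continuous_distP (R : realType) (E F : normedModType R) (A : set E)
    (f : E -> F) :
  {within A, continuous f} <->
  forall x, A x -> forall e : R, 0 < e -> exists2 d : R, 0 < d &
    forall y, A y -> `|y - x| < d -> `|f y - f x| < e.
Proof.
split=> [/subspace_continuousP cf x Ax e e0|H].
  have /cvgrPdist_lt/(_ e e0) := cf x Ax.
  rewrite near_withinE => /nbhs_normP[d /= d0 hd].
  exists d => // y Ay yx; rewrite distrC; apply: hd => //.
  by rewrite /ball_ /= distrC.
apply/subspace_continuousP => x Ax; apply/cvgrPdist_lt => e e0.
have [d d0 hd] := H x Ax e e0.
rewrite near_withinE; apply/nbhs_normP; exists d => //= y.
rewrite /ball_ /= distrC => yx Ay; rewrite distrC; exact: hd.
Qed.

Lemma is_derive_distP (R : realType) (E F : normedModType R) (f : E -> F)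
    (x v : E) (l : F) :
  is_derive x v f l <->
  forall e : R, 0 < e -> exists2 d : R, 0 < d &
    forall h : R, h != 0 -> `|h| < d -> `|h^-1 *: (f (h *: v + x) - f x) - l| < e.
Proof.
have P : ((fun h : R => h^-1 *: (f (h *: v + x) - f x)) @ 0^' --> l) <->
  (forall e : R, 0 < e -> exists2 d : R, 0 < d &
    forall h : R, h != 0 -> `|h| < d -> `|h^-1 *: (f (h *: v + x) - f x) - l| < e).
  split=> [/cvgrPdist_lt cf e e0|H].
    have := cf e e0; rewrite near_withinE => /(nbhs_norm0P (V := R)) [d /= d0 hd].
    exists d => // h h0 hlt; rewrite distrC; exact: hd.
  apply/cvgrPdist_lt => e e0; have [d d0 hd] := H e e0.
  rewrite near_withinE; apply/(nbhs_norm0P (V := R)); exists d => //= h hlt h0.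
  by rewrite distrC; apply: hd.
split=> [[ex dl]|cl].
  have {}ex : (fun h : R => h^-1 *: (f (h *: v + x) - f x)) @ 0^' --> l.
    by rewrite -dl; exact: ex.
  by case: P => P _; exact: P ex.
case: P => _ P; have {}cl := P cl.
by constructor; [apply/cvg_ex; exists l|apply: cvg_lim].
Qed.

Lemma derive_scale (R : realType) (E F : normedModType R) (f : E -> F)
    (x v : E) (k : R) :
  derivable f x v -> is_derive x (k *: v) f (k *: 'D_v f x).
Proof.
move=> /derivableP /is_derive_distP df.
have [->|k0] := eqVneq k 0.
  by rewrite !scale0r; exact: is_derive0.
have nk0 : 0 < `|k| by rewrite normr_gt0.
apply/is_derive_distP => e e0.
have [d d0 hd] := df (e / `|k|) (divr_gt0 e0 nk0).
exists (d / `|k|); first exact: divr_gt0.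
move=> h h0; rewrite ltr_pdivlMr // -normrM => hk.
have := hd (h * k) (mulf_neq0 h0 k0) hk.
rewrite ltr_pdivlMr // mulrC -normrZ scalerBr !scalerA invfM.
by rewrite [k * _]mulrC mulfVK.
Qed.

Lemma is_derive_line (R : realType) (E F : normedModType R) (f : E -> F)
    (x w : E) (t : R) :
  derivable f (x + t *: w) w ->
  is_derive t 1 (fun s : R => f (x + s *: w)) ('D_w f (x + t *: w)).
Proof.
move=> /derivableP /is_derive_distP df.
apply/is_derive_distP => e /df[d d0 hd]; exists d => // h h0 hlt.
have := hd h h0 hlt; congr (`| _ *: (f _ - _) - _| < e).
by rewrite -[h *: 1]/(h * 1) mulr1 scalerDl addrCA.
Qed.

Lemma is_derive_continuous (R : realType) (F : normedModType R) (f : R -> F)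
    (t : R) (l : F) :
  is_derive t 1 f l -> {for t, continuous f}.
Proof.
by move=> df; apply/differentiable_continuous/derivable1_diffP.
Qed.

(** * Mean value theorems and strong convexity on the unit interval *)

Lemma MVT01 (R : realType) (f df : R -> R) :
  (forall t : R, 0 <= t <= 1 -> is_derive t 1 f (df t)) ->
  exists2 c, 0 <= c <= 1 & f 1 - f 0 = df c.
Proof.
move=> hf; have [||c ci ->] := @MVT_segment R f df 0 1 ler01.
- move=> x; rewrite in_itv /= => /andP[x0 x1].
  by apply: hf; rewrite !ltW.
- apply: continuous_in_subspaceT => x; rewrite inE /= in_itv /= => /hf.
  exact: is_derive_continuous.
by exists c; [move: ci; rewrite in_itv|rewrite subr0 mulr1].
Qed.

Lemma MVT_between (R : realType) (f df : R -> R) (a b : R) :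
  a <= b -> (forall t : R, a <= t <= b -> is_derive t 1 f (df t)) ->
  exists2 c, a <= c <= b & f b - f a = df c * (b - a).
Proof.
move=> ab hf; have [||c ci ->] := @MVT_segment R f df a b ab.
- move=> x; rewrite in_itv /= => /andP[x0 x1].
  by apply: hf; rewrite !ltW.
- apply: continuous_in_subspaceT => x; rewrite inE /= in_itv /= => /hf.
  exact: is_derive_continuous.
by exists c => //; move: ci; rewrite in_itv.
Qed.

Lemma is_derive_sub_quadratic (R : realType) (f : R -> R) (a t l : R) :
  is_derive t 1 f l ->
  is_derive t 1 (fun s : R => f s - a / 2 * s ^+ 2) (l - a * t).
Proof.
move=> df.
have dq : is_derive t 1 (fun s : R => a / 2 * s ^+ 2) (a * t).
  have := @is_deriveZ R R R (fun s : R => s ^+ 2) (a / 2) t 1 _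
    (@is_deriveX R R id 2 t 1 1 (is_derive_id _ _)).
  move=> /is_derive_eq; apply.
  by rewrite /GRing.scale /= expr1; field.
exact: (@is_deriveB R R R f _ t 1 l _ df dq).
Qed.

Section strong_convexity.
Variables (R : realType) (f df : R -> R) (a : R).
Hypothesis hf : forall t : R, 0 <= t <= 1 -> is_derive t 1 f (df t).
Hypothesis mono : forall s t : R, 0 <= s -> s < t -> t <= 1 ->
  a * (t - s) <= df t - df s.

Let monoW (s t : R) : 0 <= s -> s <= t -> t <= 1 -> df s - a * s <= df t - a * t.
Proof.
move=> s0; rewrite le_eqVlt => /predU1P[->//|st] t1.
by have := mono s0 st t1; lra.
Qed.

Let hg (t : R) : 0 <= t <= 1 ->
  is_derive t 1 (fun s : R => f s - a / 2 * s ^+ 2) (df t - a * t).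
Proof. by move=> t01; apply: is_derive_sub_quadratic; exact: hf. Qed.

(** Subtracting a s^2 / 2 makes the derivative nondecreasing. The mean value theorem on [0, t] and
    on [t, 1] then yields two slopes in increasing order, and eliminating them gives the convexity
    inequality. *)
Lemma strong_convex01 (t : R) : 0 <= t <= 1 ->
  f t <= (1 - t) * f 0 + t * f 1 - a / 2 * (t * (1 - t)).
Proof.
move=> /andP[t0 t1].
have [|c /andP[c0 ct] e1] := @MVT_between R (fun s => f s - a / 2 * s ^+ 2) (fun t => df t - a * t) 0 t t0.
  by move=> s /andP[s0 st]; apply: hg; rewrite s0 (le_trans st).
have [|d /andP[td d1] e2] := @MVT_between R (fun s => f s - a / 2 * s ^+ 2) (fun t => df t - a * t) t 1 t1.
  by move=> s /andP[s0 st]; apply: hg; rewrite st andbT (le_trans t0).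
have cd : df c - a * c <= df d - a * d.
  by apply: monoW => //; exact: le_trans td.
move: e1 e2 cd; rewrite expr0n expr1n /=.
set u := df c - _; set v := df d - _ => e1 e2 cd.
have : t * (1 - t) * u <= t * (1 - t) * v.
  by rewrite ler_wpM2l // mulr_ge0 // subr_ge0.
have : (1 - t) * (f t - a / 2 * t ^+ 2 - (f 0 - a / 2 * 0)) = t * (1 - t) * u.
  by rewrite e1; ring.
have : t * (f 1 - a / 2 * 1 - (f t - a / 2 * t ^+ 2)) = t * (1 - t) * v.
  by rewrite e2; ring.
move: (t * (1 - t) * u) (t * (1 - t) * v) => P Q <- <-; nra.
Qed.

Lemma strong_convex_tangent : f 0 + df 0 + a / 2 <= f 1.
Proof.
have [c /andP[c0 c1]] := MVT01 (df := fun t => df t - a * t) hg.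
have := monoW (lexx 0) c0 c1; rewrite expr0n expr1n /=; lra.
Qed.

End strong_convexity.

(* The points t with |f t - f 0| <= K' t form a closed set containing 0, and its
   supremum cannot be less than 1, as the derivative there has norm < K'. *)
Lemma mean_value_ineq (R : realType) (F : normedModType R) (f df : R -> F) (K : R) :
  (forall t : R, 0 <= t <= 1 -> is_derive t 1 f (df t)) ->
  (forall t : R, 0 <= t <= 1 -> `|df t| <= K) ->
  `|f 1 - f 0| <= K.
Proof.
move=> hf hK; apply/ler_addgt0Pr => e e0.
pose S := [set t : R | 0 <= t <= 1 /\ `|f t - f 0| <= (K + e) * t].
have S0 : S 0 by split; rewrite ?lexx ?ler01 // subrr normr0 mulr0.
have uS : ubound S 1 by move=> t [/andP[]].
have hS : has_sup S by split; [exists 0|exists 1].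
pose c := sup S.
have c0 : 0 <= c by apply: sup_upper_bound.
have c1 : c <= 1 by apply: sup_le_ub => //; exists 0.
have c01 : 0 <= c <= 1 by rewrite c0.
have Sc : `|f c - f 0| <= (K + e) * c.
  apply/ler_addgt0Pr => d d0.
  have /continuous_at_distP/(_ (d / 2)) := is_derive_continuous (hf _ c01).
  case=> [|r r0 hr]; first by lra.
  have [t St ct] := sup_adherent r0 hS.
  have tc : t <= c by apply: sup_upper_bound.
  have tcr : `|t - c| < r.
    rewrite distrC ger0_norm ?subr_ge0 //; move: ct; rewrite -/c; lra.
  have := hr _ tcr; rewrite distrC => ft.
  case: St => t01 ht.
  have Ke : 0 <= K + e.
    by apply: addr_ge0; [exact: le_trans (hK _ c01)|exact: ltW].
  rewrite (le_trans (ler_distD (f t) _ _)) //.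
  have : (K + e) * t <= (K + e) * c by rewrite ler_wpM2l.
  lra.
suff c1' : c = 1 by move: Sc; rewrite c1' mulr1.
apply/eqP; rewrite eq_le c1 leNgt; apply/negP => clt1.
have /is_derive_distP/(_ e e0)[r r0 hr] := hf _ c01.
pose h := Num.min (r / 2) (1 - c).
have h0 : 0 < h by rewrite /h lt_min; apply/andP; split; lra.
have hr2 : h <= r / 2 by rewrite /h ge_min lexx.
have hc1 : h <= 1 - c by rewrite /h ge_min lexx orbT.
have nh : `|h| < r by rewrite gtr0_norm //; lra.
have := hr h (lt0r_neq0 h0) nh.
rewrite -[h *: 1]/(h * 1) mulr1 => hlt.
have hd : `|f (h + c) - f c| <= (K + e) * h.
  have -> : f (h + c) - f c = h *: (h^-1 *: (f (h + c) - f c)).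
    by rewrite scalerA mulfV ?scale1r // lt0r_neq0.
  rewrite normrZ gtr0_norm // mulrC; apply: ler_wpM2r; first exact: ltW.
  rewrite -[X in `|X|](subrK (df c)) (le_trans (ler_normD _ _)) //.
  by rewrite addrC lerD ?hK // ltW.
have : S (h + c).
  split; first by apply/andP; split; lra.
  rewrite (le_trans (ler_distD (f c) _ _)) // mulrDr.
  by apply: lerD.
by move/(sup_upper_bound hS); rewrite -/c; lra.
Qed.

(** * Completeness and the bounded inverse theorem *)

Lemma closed_norm_le (R : realType) (E : normedModType R) (r : R) :
  closed [set x : E | `|x| <= r].
Proof.
apply: (@closed_comp _ _ (fun x : E => `|x|) [set t | t <= r]).
  by move=> ? _; exact: norm_continuous.
exact: closed_le.
Qed.

Lemma cauchy_dist_cvg (R : realType) (E : completeNormedModType R) (v : nat -> E) :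
  (forall e : R, 0 < e -> exists N, forall k l, (N <= k)%N -> (N <= l)%N ->
     `|v k - v l| < e) -> cvgn v.
Proof.
move=> hv; apply/cauchy_cvgP/cauchy_ballP => e e0; near_simpl.
have [N hN] := hv e e0.
exists ([set m | (N <= m)%N], [set m | (N <= m)%N]); first by split; exists N.
by move=> [k l] /= [Nk Nl]; rewrite -ball_normE /=; exact: hN.
Qed.

(* Baire: some {y | |S y| <= n} is dense in a ball, hence by linearity every y is
   approximated up to |y|/2 by some y' with |S y'| <= C |y|; sum the
   corrections and use completeness. *)
Lemma bounded_inverse (R : realType) (E F : completeNormedModType R)
    (T : {linear E -> F}) (S : F -> E) :
  continuous T -> cancel T S -> cancel S T ->
  exists2 C : R, 0 < C & forall y, `|S y| <= C * `|y|.
Proof.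
move=> cT TS ST.
have SB u v : S (u - v) = S u - S v.
  by rewrite -[RHS]TS linearB !ST.
have SZ k u : S (k *: u) = k *: S u.
  by rewrite -[RHS]TS linearZ /= !ST.
have SD u v : S (u + v) = S u + S v.
  by rewrite -[RHS]TS linearD !ST.
pose G n : set F := closure [set y | `|S y| <= n%:R].
have [n [y0 [r r0 hG]]] : exists n y0, exists2 r : R, 0 < r &
    forall y, `|y - y0| < r -> G n y.
  apply: contrapT => H.
  have : dense (\bigcap_i ~` G i).
    apply: Baire => i; split; first exact/closed_openC/closed_closure.
    move=> O [y0 Oy0] oO; apply: contrapT => hO; apply: H.
    have /nbhs_normP[r /= r0 hr] : nbhs y0 O by exact: open_nbhs_nbhs.
    exists i, y0, r => // y yy0; apply: contrapT => nG; apply: hO.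
    by exists y; split => //; apply: hr; rewrite /ball_ /= distrC.
  move=> /(_ setT); case; first by exists 0.
    exact: openT.
  move=> y [_ hy].
  have /(_ Logic.I) := hy (Num.bound `|S y|); apply.
  apply: subset_closure; rewrite /= ltW //.
  exact: archi_boundP (normr_ge0 _).
have approx0 y e : `|y| < r -> 0 < e -> exists2 y', `|y - y'| < e & `|S y'| <= 2 * n%:R.
  move=> yr e0.
  have e2 : 0 < e / 2 by lra.
  have near_pt z : G n z -> exists2 z', `|z - z'| < e / 2 & `|S z'| <= n%:R.
    move=> /(_ (ball z (e / 2))) [|z' [hz' bz]]; first exact: nbhsx_ballx.
    by exists z' => //; move: bz; rewrite -ball_normE.
  have [|z1 a1 b1] := near_pt (y0 + y).
    by apply: hG; rewrite addrAC subrr add0r.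
  have [|z2 a2 b2] := near_pt y0.
    by apply: hG; rewrite subrr normr0.
  exists (z1 - z2).
    have -> : y - (z1 - z2) = (y0 + y - z1) - (y0 - z2).
      by zmod.
    by rewrite (le_lt_trans (ler_normB _ _)) //; lra.
  by rewrite SB (le_trans (ler_normB _ _)) //; lra.
(* A vector y is scaled to norm r/2, inside the ball; its approximant has preimage of norm at most
   2n, which is scaled back by 2|y|/r. *)
pose C0 : R := 2 * n%:R * (2 / r).
have C00 : 0 <= C0.
  by rewrite /C0 !mulr_ge0 ?ler0n ?invr_ge0 ?ltW //.
have approx y : exists y', `|y - y'| <= `|y| / 2 /\ `|S y'| <= C0 * `|y|.
  have [->|y_neq0] := eqVneq y 0.
    exists 0; rewrite subr0 normr0 mul0r mulr0; split=> //.
    by have -> : S 0 = 0; [rewrite -[RHS]TS linear0|rewrite normr0].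
  have ny : 0 < `|y| by rewrite normr_gt0.
  pose k := r / 2 / `|y|.
  have k0 : 0 < k by rewrite !divr_gt0.
  have [||y' h1 h2] := approx0 (k *: y) (k * (`|y| / 2)).
  - rewrite normrZ gtr0_norm // /k mulfVK ?gt_eqF //; lra.
  - by rewrite mulr_gt0 // divr_gt0.
  exists (k^-1 *: y'); split.
    have -> : y - k^-1 *: y' = k^-1 *: (k *: y - y').
      by rewrite scalerBr scalerA mulVf ?scale1r // gt_eqF.
    rewrite normrZ gtr0_norm ?invr_gt0 // mulrC ler_pdivrMr //.
    by rewrite mulrC ltW.
  rewrite SZ normrZ gtr0_norm ?invr_gt0 //.
  have -> : C0 * `|y| = k^-1 * (2 * n%:R).
    rewrite /C0 /k !invfM !invrK; ring.
  by rewrite ler_wpM2l // invr_ge0 ltW.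
have /choice[q hq] := approx.
exists (2 * C0 + 1); first by lra.
move=> y.
(* [res k] is what remains of y after k corrections; [xs k] below is the preimage of the part
   already removed. *)
pose res k := iter k (fun z => z - q z) y.
have resn k : `|res k| <= `|y| / 2 ^+ k.
  elim: k => [|k IH]; first by rewrite expr0 divr1.
  rewrite /res iterS -/(res k) (le_trans (hq _).1) //.
  rewrite exprSr invfM mulrA ler_wpM2r //.
pose xs k := S (y - res k).
have xsS k : xs k.+1 = xs k + S (q (res k)).
  by rewrite /xs /res iterS -/(res k) -SD; congr S; zmod.
have xdiff k m : `|xs (m + k)%N - xs k| <= 2 * C0 * `|y| * (2^-1 ^+ k - 2^-1 ^+ (m + k)).
  elim: m => [|m IH]; first by rewrite add0n !subrr normr0 mulr0.
  rewrite addSn xsS addrAC (le_trans (ler_normD _ _)) //.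
  have h1 : `|S (q (res (m + k)%N))| <= C0 * `|y| * 2^-1 ^+ (m + k).
    rewrite (le_trans (hq _).2) // -mulrA ler_wpM2l //.
    by rewrite (le_trans (resn _)) // exprVn.
  apply: le_trans (lerD IH h1) _.
  rewrite exprS le_eqVlt; apply/orP; left; apply/eqP.
  by move: (2^-1 ^+ (m + k)) (2^-1 ^+ k) => P Q; field.
have half_cvg : 2^-1 ^+ k @[k --> \oo] --> (0 : R).
  by apply: cvg_expr; rewrite ger0_norm ?invr_ge0 //; lra.
have dbound k l : (k <= l)%N -> `|xs l - xs k| <= 2 * C0 * `|y| * 2^-1 ^+ k.
  move=> kl; rewrite -(subnK kl) (le_trans (xdiff _ _)) //.
  apply: ler_wpM2l; first by apply: mulr_ge0 => //; apply: mulr_ge0.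
  by rewrite lerBlDr lerDl exprn_ge0 // invr_ge0.
have cxs : cvgn xs.
  apply: cauchy_dist_cvg => e e0.
  have hc : 2 * C0 * `|y| * 2^-1 ^+ k @[k --> \oo] --> 2 * C0 * `|y| * 0.
    by apply: cvgM => //; exact: cvg_cst.
  rewrite mulr0 in hc; have /cvgrPdist_lt/(_ (e / 2))[|N _ hN] := hc; first by lra.
  exists N => k l Nk Nl; have := hN N (leqnn N); rewrite sub0r normrN => /ltr_normlW hNN.
  have a1 := dbound _ _ Nk; have a2 := dbound _ _ Nl.
  rewrite (le_lt_trans (ler_distD (xs N) _ _)) // [`|xs N - _|]distrC; lra.
have res0 : res k @[k --> \oo] --> (0 : F).
  have hc : `|y| * 2^-1 ^+ k @[k --> \oo] --> `|y| * 0.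
    by apply: cvgM => //; exact: cvg_cst.
  move: hc; rewrite mulr0 => hc.
  apply/norm_cvg0P.
  apply: (squeeze_cvgr _ (cvg_cst (0 : R)) hc).
  by apply: nearW => k; rewrite normr_ge0 /= exprVn resn.
have Tlim : T (limn xs) = y.
  have h1 : T (xs k) @[k --> \oo] --> T (limn xs).
    by apply: (cvg_comp xs T cxs); exact: cT.
  have h2 : T (xs k) @[k --> \oo] --> y - 0.
    have -> : (fun k => T (xs k)) = (fun k => y - res k).
      by apply/funext => k; rewrite /xs ST.
    by apply: cvgB => //; exact: cvg_cst.
  by rewrite subr0 in h2; exact: (cvg_unique _ h1 h2).
have -> : S y = limn xs by rewrite -Tlim TS.
have xs0 : xs 0%N = 0.
  by rewrite /xs /res /= subrr -[RHS]TS linear0.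
have hb : forall k, `|xs k| <= (2 * C0 + 1) * `|y|.
  move=> k; have := dbound 0%N k (leq0n k); rewrite xs0 subr0 expr0 mulr1.
  by move=> /le_trans; apply; rewrite ler_wpM2r // lerDl.
apply: (@closed_cvg _ _ _ eventually_filter xs [set x | `|x| <= (2 * C0 + 1) * `|y|]) cxs.
  exact: closed_norm_le.
by apply: nearW => k; exact: hb.
Qed.

(** * Inner products and the Cauchy-Schwarz inequality *)

Section inner_product.
Variables (R : realType) (H : normedModType R) (ip : {dot H for idfun}).

Lemma ipC u v : ip u v = ip v u.
Proof. by rewrite hermC /= expr0 mul1r. Qed.

Lemma ipDl u v w : ip (u + v) w = ip u w + ip v w.
Proof. exact: linearDl. Qed.

Lemma ipDr u v w : ip w (u + v) = ip w u + ip w v.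
Proof. by rewrite ipC ipDl !(ipC w). Qed.

Lemma ipZl (a : R) u w : ip (a *: u) w = a * ip u w.
Proof. exact: linearZl_LR. Qed.

Lemma ipZr (a : R) u w : ip w (a *: u) = a * ip w u.
Proof. by rewrite ipC ipZl ipC. Qed.

Lemma ipNl u w : ip (- u) w = - ip u w.
Proof. by rewrite -scaleN1r ipZl mulN1r. Qed.

Lemma ipNr u w : ip w (- u) = - ip w u.
Proof. by rewrite ipC ipNl ipC. Qed.

Lemma ipBl u v w : ip (u - v) w = ip u w - ip v w.
Proof. by rewrite ipDl ipNl. Qed.

Lemma ipBr u v w : ip w (u - v) = ip w u - ip w v.
Proof. by rewrite ipDr ipNr. Qed.

Lemma ip0l w : ip 0 w = 0.
Proof. by rewrite -(scale0r 0) ipZl mul0r. Qed.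

Lemma ip0r w : ip w 0 = 0.
Proof. by rewrite ipC ip0l. Qed.

Lemma ip_sumr (I : Type) (s : seq I) (F : I -> H) w :
  ip w (\sum_(y <- s) F y) = \sum_(y <- s) ip w (F y).
Proof.
elim: s => [|y s IH]; first by rewrite !big_nil ip0r.
by rewrite !big_cons ipDr IH.
Qed.

Lemma orth_subspace (S : set H) : is_subspace (orth ip S).
Proof.
split=> [v _|a u v hu hv w Sw]; first by rewrite ip0l.
by rewrite ipDl ipZl hu // hv // mulr0 addr0.
Qed.

Hypothesis ip_norm : forall u, `|u| ^+ 2 = ip u u.

Lemma ip_ge0 u : 0 <= ip u u.
Proof. by rewrite -ip_norm exprn_ge0. Qed.

Lemma ip_eq0 u : ip u u = 0 -> u = 0.
Proof.
by rewrite -ip_norm => /eqP; rewrite expf_eq0 /= normr_eq0 => /eqP.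
Qed.

Lemma cauchy_schwarz u v : `|ip u v| <= `|u| * `|v|.
Proof.
have [->|v0] := eqVneq v 0; first by rewrite ip0r !normr0 mulr0.
have nv : 0 < `|v| by rewrite normr_gt0.
rewrite -(@ler_pXn2r _ 2) ?nnegrE ?mulr_ge0 // exprMn !ip_norm real_normK ?num_real //.
have := ip_ge0 (ip v v *: u - ip u v *: v).
have vv : 0 < ip v v by rewrite -ip_norm exprn_gt0.
rewrite !(ipBl, ipBr, ipZl, ipZr) (ipC v u).
have -> : ip v v * (ip v v * ip u u) - ip v v * (ip u v * ip u v) -
  (ip u v * (ip v v * ip u v) - ip u v * (ip u v * ip v v)) =
  ip v v * (ip u u * ip v v - ip u v ^+ 2) by ring.
by rewrite pmulr_rge0 // subr_ge0.
Qed.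

Lemma ip_le u v : ip u v <= `|u| * `|v|.
Proof. exact: le_trans (ler_norm _) (cauchy_schwarz u v). Qed.

Lemma norm_le_ip (u : H) (c : R) :
  0 <= c -> (forall v, ip u v <= c * `|v|) -> `|u| <= c.
Proof.
move=> c0 hu; have [->|u0] := eqVneq u 0; first by rewrite normr0.
have nu : 0 < `|u| by rewrite normr_gt0.
by have := hu u; rewrite -ip_norm expr2 ler_pM2r.
Qed.

Lemma continuous_ipl v : continuous (ip^~ v).
Proof.
move=> u; apply/continuous_at_distP => e e0.
exists (e / (`|v| + 1)); first by rewrite divr_gt0 // ltr_wpDl.
move=> w; rewrite ltr_pdivlMr ?ltr_wpDl // => hw.
rewrite -ipBl (le_lt_trans (cauchy_schwarz _ _)) //.
by apply: le_lt_trans hw; rewrite ler_wpM2l // lerDl.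
Qed.

Lemma closed_orth (S : set H) : closed (orth ip S).
Proof.
have -> : orth ip S = \bigcap_(v in S) [set u | ip u v = 0] by [].
apply: closed_bigI => v _.
apply: (@closed_comp _ _ (ip^~ v) [set 0]); last exact: closed_eq.
by move=> u _; exact: continuous_ipl.
Qed.

(* A nonnegative form q(w) = b w w which vanishes at u: as a function of s,
   q(u + s w) is a nonnegative polynomial without constant term. *)
Lemma form_ge0_vanish (b : H -> H -> R) (u w : H) :
  (forall s : R, 0 <= s * b u w *+ 2 + s ^+ 2 * b w w) -> b u w = 0.
Proof.
move=> hb; apply/eqP; rewrite eq_le; apply/andP.
set q := b w w in hb; set p := b u w in hb *.
have d0 : 0 < `|q| + 1 by rewrite ltr_wpDl.
have hs := hb (- p / (`|q| + 1)).
have : 0 <= (- p / (`|q| + 1) * p *+ 2 + (- p / (`|q| + 1)) ^+ 2 * q) * (`|q| + 1) ^+ 2.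
  by rewrite mulr_ge0 // exprn_ge0 // ltW.
have -> : (- p / (`|q| + 1) * p *+ 2 + (- p / (`|q| + 1)) ^+ 2 * q) * (`|q| + 1) ^+ 2 =
  - (p ^+ 2) * (2 * (`|q| + 1) - q) by field; rewrite gt_eqF.
have : q <= `|q| by exact: ler_norm.
move=> hq; have q1 : 1 <= 2 * (`|q| + 1) - q by have := normr_ge0 q; lra.
move: (2 * _ - q) q1 => t t1 hp; split; nra.
Qed.

End inner_product.

(** * Finite orthonormal expansions and Gram-Schmidt *)

Section expansion.
Variables (R : realType) (H : normedModType R) (ip : {dot H for idfun}).

(** The form is a parameter because orthonormality is needed both for the inner product and, on H^+,
    for the form (B(0)u, w). *)
Definition orthonormal_seq (b : H -> H -> R) (e : seq H) : Prop :=
  uniq e /\ forall x y, x \in e -> y \in e -> b x y = (x == y)%:R.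

Lemma sum_orthonormal (b : H -> H -> R) (e : seq H) (F : H -> R) z :
  orthonormal_seq b e -> z \in e ->
  \sum_(y <- e) F y * b y z = F z.
Proof.
move=> [ue be] ze; rewrite (bigD1_seq z) //= be // eqxx mulr1.
rewrite big_seq_cond big1 ?addr0 // => y /andP[ye yz].
by rewrite be // (negPf yz) mulr0.
Qed.

(** Coefficients are taken in H while the vectors [c y] may lie elsewhere. For an orthonormal [e] in
    X, [c = id] gives the orthogonal projection onto its span and [c = toX i] the same projection
    with values in X, continuous from H to X. *)
Definition expand (E : normedModType R) (e : seq H) (c : H -> E) (u : H) : E :=
  \sum_(y <- e) ip u y *: c y.

Lemma expand_is_linear (E : normedModType R) (e : seq H) (c : H -> E) :
  linear (expand e c).
Proof.
move=> a u v; rewrite /expand scaler_sumr -big_split /=.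
by apply: eq_bigr => y _; rewrite ipDl ipZl scalerDl scalerA.
Qed.

HB.instance Definition _ (E : normedModType R) (e : seq H) (c : H -> E) :=
  GRing.isLinear.Build R H E _ (expand e c) (expand_is_linear e c).

Lemma linear_expand (E F : normedModType R) (f : {linear E -> F}) (e : seq H)
  (c : H -> E) u : f (expand e c u) = expand e (f \o c) u.
Proof.
by rewrite linear_sum; apply: eq_bigr => y _; rewrite linearZ.
Qed.

Lemma eq_expand (E : normedModType R) (e : seq H) (c c' : H -> E) u :
  {in e, c =1 c'} -> expand e c u = expand e c' u.
Proof. by move=> cc'; apply: eq_big_seq => y /cc' ->. Qed.

Hypothesis ip_norm : forall u, `|u| ^+ 2 = ip u u.

Lemma expand_bound (E : normedModType R) (e : seq H) (c : H -> E) u :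
  `|expand e c u| <= (\sum_(y <- e) `|y| * `|c y|) * `|u|.
Proof.
rewrite mulr_suml (le_trans (ler_norm_sum _ _ _)) //.
apply: ler_sum => y _; rewrite normrZ mulrC (mulrC (_ * _)) mulrCA mulrC mulrA.
by rewrite ler_wpM2r // mulrC; exact: cauchy_schwarz.
Qed.

Lemma expand_continuous (E : normedModType R) (e : seq H) (c : H -> E) :
  continuous (expand e c).
Proof.
move=> u; apply/continuous_at_distP => eps eps0.
set C := \sum_(y <- e) `|y| * `|c y|.
have C0 : 0 <= C by apply: sumr_ge0 => y _; rewrite mulr_ge0.
exists (eps / (C + 1)); first by rewrite divr_gt0 // ltr_wpDl.
move=> w; rewrite ltr_pdivlMr ?ltr_wpDl // => hw.
rewrite -linearB (le_lt_trans (expand_bound _ _ _)) // -/C.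
by apply: le_lt_trans hw; rewrite mulrC ler_wpM2l // lerDl.
Qed.

Lemma expand_perp (e : seq H) u : orthonormal_seq ip e ->
  forall y, y \in e -> ip (u - expand e id u) y = 0.
Proof.
move=> oe y ye; rewrite ipBl.
rewrite [X in _ - X]ipC ip_sumr.
under eq_bigr do rewrite ipZr [ip y _]ipC.
by rewrite (sum_orthonormal _ oe ye) subrr.
Qed.

Lemma expand_sub (S : set H) (e : seq H) u :
  is_subspace S -> (forall y, y \in e -> S y) -> S (expand e id u).
Proof.
move=> [S0 Sl] eS; rewrite /expand big_seq.
apply: big_rec => [//|y v ye Sv]; apply: Sl => //; exact: eS.
Qed.

(** Bessel's inequality, by Pythagoras: the residual is orthogonal to the expansion. *)
Lemma expand_le (e : seq H) u : orthonormal_seq ip e -> `|expand e id u| <= `|u|.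
Proof.
move=> oe; rewrite -(@ler_pXn2r _ 2) ?nnegrE // !ip_norm.
set v := expand e id u.
have uv0 : ip (u - v) v = 0.
  rewrite /v {2}/expand ip_sumr big_seq big1 // => y ye.
  by rewrite ipZr expand_perp ?mulr0.
have -> : ip u u = ip (u - v) (u - v) + ip v v.
  rewrite -[in LHS](subrK v u) !(ipDl _ (u - v)) !(ipDr _ (u - v)).
  by rewrite uv0 (ipC _ v) uv0; ring.
by rewrite lerDr ip_ge0.
Qed.

Lemma orthonormal_norm (e : seq H) y : orthonormal_seq ip e -> y \in e -> `|y| = 1.
Proof.
move=> [_ oe] ye; apply/eqP; rewrite -(@eqrXn2 _ 2) // expr1n ip_norm oe //.
by rewrite eqxx.
Qed.

(* Parseval in both directions: sum_{x in e'} |x|^2 <= sum_{y in e} |y|^2. *)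
Lemma orthonormal_size (e e' : seq H) :
  orthonormal_seq ip e -> orthonormal_seq ip e' ->
  (forall x, x \in e' -> expand e id x = x) -> (size e' <= size e)%N.
Proof.
move=> oe oe' sp.
have parseval f u : orthonormal_seq ip f ->
    ip (expand f id u) u = \sum_(y <- f) ip u y ^+ 2.
  move=> of_; rewrite ipC ip_sumr; apply: eq_bigr => y _.
  by rewrite ipZr expr2.
have bessel f u : orthonormal_seq ip f -> \sum_(y <- f) ip u y ^+ 2 <= `|u| ^+ 2.
  move=> of_; rewrite -parseval // (le_trans (ip_le ip_norm _ _)) //.
  by rewrite expr2 ler_wpM2r // expand_le.
have sz f : orthonormal_seq ip f -> \sum_(y <- f) `|y| ^+ 2 = (size f)%:R.
  move=> of_; rewrite big_seq (eq_bigr (fun=> 1)); last first.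
    by move=> y ye; rewrite (orthonormal_norm of_) // expr1n.
  by rewrite -big_seq big_const_seq count_predT iter_addr addr0.
rewrite -(@ler_nat R) -!sz //.
rewrite big_seq (eq_bigr (fun x => \sum_(y <- e) ip x y ^+ 2)); last first.
  by move=> x xe; rewrite -parseval // sp // ip_norm.
rewrite -big_seq exchange_big /=; apply: ler_sum => y _.
by under eq_bigr do rewrite ipC; exact: bessel.
Qed.

End expansion.

Section gram_schmidt.
Variables (R : realType) (H : normedModType R) (S : set H) (b : H -> H -> R).
Hypotheses (subS : is_subspace S)
  (bD : forall u v w, b (u + v) w = b u w + b v w)
  (bZ : forall (a : R) u w, b (a *: u) w = a * b u w)
  (bC : forall u v, b u v = b v u)
  (bpos : forall u, S u -> u != 0 -> 0 < b u u).

Let b0 w : b 0 w = 0.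
Proof. by rewrite -(scale0r 0) bZ mul0r. Qed.

Let bsum (s : seq H) (F : H -> H) w :
  b (\sum_(y <- s) F y) w = \sum_(y <- s) b (F y) w.
Proof.
elim: s => [|y s IH]; first by rewrite !big_nil b0.
by rewrite !big_cons bD IH.
Qed.

Lemma gram_schmidt_residual (e : seq H) u : orthonormal_seq b e ->
  forall y, y \in e -> b (u - \sum_(z <- e) b u z *: z) y = 0.
Proof.
move=> oe y ye; rewrite -scaleN1r bD bZ bsum mulN1r.
under eq_bigr do rewrite bZ.
by rewrite (sum_orthonormal _ oe ye) subrr.
Qed.

(** Positivity of [b] is asked on [S] only, so that (B(0)u, w) qualifies on H^+. A vector that
    depends on the earlier ones leaves the residual [g = 0] and adds nothing, hence the input may be
    any finite list. *)
Lemma gram_schmidt (s : seq H) : (forall x, x \in s -> S x) ->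
  exists e : seq H, [/\ orthonormal_seq b e, forall x, x \in e -> S x &
    forall x, x \in s -> x = \sum_(y <- e) b x y *: y].
Proof.
have subsum (e : seq H) (c : H -> R) : (forall x, x \in e -> S x) ->
    S (\sum_(y <- e) c y *: y).
  case: subS => S0 Sl eS; rewrite big_seq.
  by apply: big_rec => [//|y v ye Sv]; apply: Sl => //; exact: eS.
elim: s => [|x s IH] sS; first by exists [::].
have [|e [oe eS es]] := IH.
  by move=> y ys; apply: sS; rewrite inE ys orbT.
have Sx : S x by apply: sS; rewrite inE eqxx.
pose g := x - \sum_(z <- e) b x z *: z.
have ge : forall y, y \in e -> b g y = 0 by exact: gram_schmidt_residual.
have Sg : S g.
  by rewrite /g addrC -scaleN1r; apply: subS.2 => //; exact: subsum.
have [g0|g0] := eqVneq g 0.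
  exists e; split => // y; rewrite inE => /predU1P[->|/es //].
  by apply/eqP; rewrite -subr_eq0 -/g g0.
have bg : 0 < b g g by exact: bpos.
pose k := (Num.sqrt (b g g))^-1.
have k0 : 0 < k by rewrite invr_gt0 sqrtr_gt0.
have kk : k ^+ 2 * b g g = 1.
  by rewrite exprVn sqr_sqrtr ?ltW // mulVf // gt_eqF.
have be y : y \in e -> b (k *: g) y = 0 by move=> ye; rewrite bZ ge // mulr0.
have bee : b (k *: g) (k *: g) = 1 by rewrite bZ bC bZ mulrA -expr2.
have nin : k *: g \notin e.
  by apply/negP => /be; rewrite bee => /eqP; rewrite oner_eq0.
case: oe => ue be1; exists (k *: g :: e); split.
- split; first by rewrite /= nin.
  move=> y z; rewrite !inE => /predU1P[->|ye] /predU1P[->|ze].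
  + by rewrite eqxx.
  + by rewrite be //; case: eqP => // h; rewrite -h (negPf nin) in ze.
  + by rewrite bC be //; case: eqP => // h; rewrite h (negPf nin) in ye.
  + exact: be1.
- move=> y; rewrite inE => /predU1P[->|/eS //].
  by have := subS.2 k g 0 Sg subS.1; rewrite addr0.
move=> y; rewrite inE big_cons => /predU1P[->|ys].
  have xg : x = g + \sum_(z <- e) b x z *: z by rewrite subrK.
  have -> : b x (k *: g) = k * b g g.
    rewrite bC bZ bC {1}xg bD bsum big_seq big1 ?addr0 // => z ze.
    by rewrite bZ [b z g]bC ge // mulr0.
  by rewrite scalerA mulrC mulrA -expr2 kk scale1r.
rewrite -es // [X in X *: _](_ : _ = 0) ?scale0r ?add0r //.
rewrite (es _ ys) bsum big_seq big1 // => z ze.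
by rewrite bZ [b z _]bC be // mulr0.
Qed.

End gram_schmidt.

(** * Compactness in finite-dimensional spans and finite nets *)

Fixpoint coef_box (R : realType) (E : normedModType R) (r : R) (e : seq E) : set E :=
  if e is y :: e' then
    (fun p : R * E => p.1 *: y + p.2) @` ([set t | `|t| <= r] `*` coef_box r e')
  else [set 0].

Lemma coef_box_compact (R : realType) (E : normedModType R) (r : R) (e : seq E) :
  compact (coef_box r e).
Proof.
elim: e => [|y e IH] /=; first exact: compact_set1.
apply: continuous_compact.
  apply: continuous_subspaceT => p; apply: cvgD; last exact: cvg_snd.
  by apply: cvgZl; exact: cvg_fst.
apply: compact_setX => //.
have -> : [set t : R | `|t| <= r] = `[- r, r]%classic.
  by apply/seteqP; split => t /=; rewrite in_itv /= ler_norml.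
exact: segment_compact.
Qed.

Lemma coef_box_sum (R : realType) (E : normedModType R) (r : R) (e : seq E)
    (c : E -> R) :
  (forall y, y \in e -> `|c y| <= r) -> coef_box r e (\sum_(y <- e) c y *: y).
Proof.
elim: e => [|y e IH] hc; first by rewrite big_nil.
rewrite big_cons /=; exists (c y, \sum_(y <- e) c y *: y) => //=; split => /=.
  by apply: hc; rewrite inE eqxx.
by apply: IH => z ze; apply: hc; rewrite inE ze orbT.
Qed.

(** By Cauchy-Schwarz the coefficients of u in an orthonormal list are bounded by |u|, so [K] is a
    closed subset of a compact box of linear combinations. *)
Lemma compact_in_span (R : realType) (H : normedModType R)
    (ip : {dot H for idfun}) (ip_norm : forall u, `|u| ^+ 2 = ip u u)
    (e : seq H) (oe : orthonormal_seq ip e) (r : R) (K : set H) :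
  closed K -> (forall u, K u -> expand ip e id u = u /\ `|u| <= r) -> compact K.
Proof.
move=> cK hK; apply: (subclosed_compact cK (@coef_box_compact _ _ r e)).
move=> u /hK[uE ur]; rewrite -uE; apply: coef_box_sum => y ye.
rewrite (le_trans (cauchy_schwarz ip_norm _ _)) //.
by rewrite (orthonormal_norm ip_norm oe ye) mulr1.
Qed.

(** The net serves through [net_small]: orthogonality to the finitely many [ys] makes the quadratic
    form of [Q] small. *)
Lemma compact_operator_net (R : realType) (E F : normedModType R)
    (Q : {linear E -> F}) (e : R) :
  compact_operator Q -> 0 < e ->
  exists ys : seq F, forall u, `|u| <= 1 -> exists2 y, y \in ys & `|Q u - y| < e.
Proof.
rewrite /compact_operator precompactE compact_cover => hQ e0.
have [||D _ hD] := hQ F setT (fun y => ball y e).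
- by move=> y _; exact: ball_open.
- by move=> y _; exists y => //; exact: ballxx.
exists (finmap.enum_fset D) => u u1.
have [|y yD] := hD (Q u).
  by apply: subset_closure; exists u.
rewrite -ball_normE /= => hy; exists y => //.
by rewrite distrC.
Qed.

(** * Radial reparametrization by functions that grow along rays *)

Section direction.
Variables (R : realType) (E : normedModType R).

(** Equal to 0 at the origin, since the inverse of 0 is 0. *)
Definition dir (v : E) : E := `|v|^-1 *: v.

Lemma norm_dir v : v != 0 -> `|dir v| = 1.
Proof.
by move=> v0; rewrite /dir normrZ normfV normr_id mulVf // normr_eq0.
Qed.

Lemma dirK v : `|v| *: dir v = v.
Proof.
have [->|v0] := eqVneq v 0; first by rewrite /dir !scaler0.
by rewrite /dir scalerA mulfV ?scale1r // normr_eq0.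
Qed.

Lemma dirZ (t : R) v : 0 < t -> dir (t *: v) = dir v.
Proof.
move=> t0; rewrite /dir normrZ gtr0_norm // scalerA invfM mulrAC mulVf ?mul1r //.
by rewrite gt_eqF.
Qed.

(** The factor |v| compensates for the discontinuity of [dir] at 0. *)
Lemma dir_dist v v' : `|v| * `|dir v - dir v'| <= 2 * `|v - v'|.
Proof.
have [->|v'0] := eqVneq v' 0.
  rewrite /dir scaler0 subr0 -{1}(normr_id v) -normrZ -/(dir v) dirK subr0.
  by rewrite ler_peMl // ler1n.
have nv' : `|v'| != 0 by rewrite normr_eq0.
rewrite -{1}(normr_id v) -normrZ scalerBr dirK.
have -> : v - `|v| *: dir v' = (v - v') + (`|v'| - `|v|) *: dir v'.
  by rewrite scalerBl dirK; zmod.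
rewrite (le_trans (ler_normD _ _)) // normrZ norm_dir // mulr1.
by have := ler_dist_dist v' v; rewrite (distrC v' v); lra.
Qed.

End direction.

(** Since |sqrt a - sqrt b| is at most sqrt a + sqrt b, its square is at most |a - b|. This modulus
    of continuity is uniform down to 0, where the square root is not Lipschitz. *)
Lemma sqrt_dist (R : realType) (a b : R) : 0 <= a -> 0 <= b ->
  `|Num.sqrt a - Num.sqrt b| ^+ 2 <= `|a - b|.
Proof.
move=> a0 b0; rewrite -{2}(sqr_sqrtr a0) -{2}(sqr_sqrtr b0) subr_sqr normrM expr2.
rewrite ler_wpM2l // ger0_norm; last by rewrite addr_ge0 ?sqrtr_ge0.
by rewrite ler_norml; have := sqrtr_ge0 a; have := sqrtr_ge0 b; move=> ? ?; apply/andP; split; lra.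
Qed.

(** [rad_scale] is what convexity says along rays from a zero at the origin; together with [rad_ge]
    it gives strict growth. The constants are separated from [f] so that they can be shared by a
    family of functions, which is what continuity in a parameter requires. *)
Record radial (R : realType) (E : normedModType R) (S : set E) (rho c K : R)
    (f : E -> R) : Prop := {
  rad0 : f 0 = 0 ;
  rad_scale : forall u t, S u -> `|u| <= rho -> 0 <= t <= 1 -> f (t *: u) <= t * f u ;
  rad_ge : forall u, S u -> `|u| <= rho -> c * `|u| ^+ 2 <= f u ;
  rad_lip : forall u v, S u -> `|u| <= rho -> S v -> `|v| <= rho ->
    `|f u - f v| <= K * `|u - v|
}.

Definition radmap (R : realType) (E : normedModType R) (f : E -> R) (u : E) : E :=
  Num.sqrt (f u) *: dir u.

(** The condition [u = |u| *: dir v] keeps u on the ray of v and forces u = 0 when v = 0. *)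
Definition radinv (R : realType) (E : normedModType R) (S : set E) (rho : R)
    (f : E -> R) (v : E) : E :=
  xget 0 [set u | [/\ S u, `|u| <= rho, u = `|u| *: dir v & f u = `|v| ^+ 2]].

Section radial_theory.
Variables (R : realType) (E : normedModType R) (S : set E) (rho c K : R).
Hypotheses (subS : is_subspace S) (rho0 : 0 < rho) (c0 : 0 < c) (K0 : 0 <= K).

Let SZ t u : S u -> S (t *: u).
Proof. by move=> Su; have := subS.2 t u 0 Su subS.1; rewrite addr0. Qed.

Let Sdir u : S u -> S (dir u). Proof. exact: SZ. Qed.

Section one.
Variable f : E -> R.
Hypothesis rf : radial S rho c K f.

Lemma radial_ge0 u : S u -> `|u| <= rho -> 0 <= f u.
Proof.
move=> Su ur; rewrite (le_trans _ (rad_ge rf Su ur)) // mulr_ge0 ?exprn_ge0 //.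
exact: ltW.
Qed.

(** By [rad_scale] with ratio s/t, f(s w) is at most (s/t) f(t w). The difference is thus at least
    (1 - s/t) c t^2 = c t (t - s), which dominates c (t - s)^2. *)
Lemma radial_ray w s t : S w -> `|w| = 1 -> 0 <= s -> s <= t -> t <= rho ->
  c * (t - s) ^+ 2 <= f (t *: w) - f (s *: w).
Proof.
move=> Sw w1 s0 st tr.
have [t0|t_neq0] := eqVneq t 0.
  have -> : s = t by apply/eqP; rewrite eq_le st t0.
  by rewrite !subrr expr0n mulr0.
have t0 : 0 < t by rewrite lt_neqAle eq_sym t_neq0 (le_trans s0).
have nt : `|t *: w| = t by rewrite normrZ w1 mulr1 gtr0_norm.
have htr : `|t *: w| <= rho by rewrite nt.
have st01 : 0 <= s / t <= 1.
  by rewrite divr_ge0 ?(ltW t0) //= ler_pdivrMr // mul1r.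
have := rad_scale rf (SZ t Sw) htr st01.
rewrite scalerA mulfVK // => h1.
have := rad_ge rf (SZ t Sw) htr; rewrite nt => h2.
set F := f (t *: w) in h1 h2 *; set G := f _ in h1 *.
have sE : s = s / t * t by rewrite mulfVK.
set q := s / t in st01 h1 sE; rewrite sE; case/andP: st01 => q0 q1.
have : c * (t - q * t) ^+ 2 <= (1 - q) * F.
  have -> : c * (t - q * t) ^+ 2 = (1 - q) * ((1 - q) * (c * t ^+ 2)) by ring.
  rewrite ler_wpM2l ?subr_ge0 //.
  have : 0 <= c * t ^+ 2 by rewrite mulr_ge0 ?exprn_ge0 ?ltW.
  nra.
lra.
Qed.

Lemma radial_ray_dist w s t : S w -> `|w| = 1 -> 0 <= s <= rho -> 0 <= t <= rho ->
  c * (t - s) ^+ 2 <= `|f (t *: w) - f (s *: w)|.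
Proof.
move=> Sw w1 /andP[s0 sr] /andP[t0 tr]; have [st|/ltW ts] := leP s t.
  exact: le_trans (radial_ray Sw w1 s0 st tr) (ler_norm _).
rewrite distrC -sqrrN opprB.
exact: le_trans (radial_ray Sw w1 t0 ts sr) (ler_norm _).
Qed.

Lemma radial_ray_inj v u u' : S v -> S u -> S u' -> `|u| <= rho -> `|u'| <= rho ->
  u = `|u| *: dir v -> u' = `|u'| *: dir v -> f u = f u' -> u = u'.
Proof.
move=> Sv Su Su' ur ur' uv uv' ff.
have [v0|v0] := eqVneq v 0.
  by rewrite uv uv' v0 /dir !scaler0.
have := @radial_ray_dist (dir v) `|u| `|u'| (Sdir Sv) (norm_dir v0).
rewrite -uv -uv' ff subrr normr0 !normr_ge0 ur ur' => /(_ isT isT) h.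
have : (`|u'| - `|u|) ^+ 2 <= 0 by rewrite -(pmulr_rle0 _ c0).
rewrite le_eqVlt ltNge sqr_ge0 orbF sqrf_eq0 subr_eq0 => /eqP nn.
by rewrite uv uv' nn.
Qed.

Lemma radmap_norm u : S u -> `|u| <= rho -> `|radmap f u| ^+ 2 = f u.
Proof.
move=> Su ur; have [->|u0] := eqVneq u 0.
  by rewrite /radmap /dir !scaler0 normr0 expr0n (rad0 rf).
rewrite /radmap normrZ norm_dir // mulr1 ger0_norm ?sqrtr_ge0 // sqr_sqrtr //.
exact: radial_ge0.
Qed.

Lemma radmap_sub u : S u -> S (radmap f u).
Proof. by move=> Su; apply/SZ/Sdir. Qed.

(** Along the ray of v the values of f run from 0 to at least c rho^2, and the intermediate value
    theorem applies. This is the origin of the bound on |v| in all statements about [radinv]. *)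
Lemma radinv_ex v : S v -> `|v| ^+ 2 < c * rho ^+ 2 ->
  exists u, [/\ S u, `|u| <= rho, u = `|u| *: dir v & f u = `|v| ^+ 2].
Proof.
move=> Sv vr; have [->|v0] := eqVneq v 0.
  exists 0; rewrite (rad0 rf) normr0 expr0n /= ltW // scale0r.
  by split => //; case: subS.
have nw := norm_dir v0; have Sw := Sdir Sv.
have nt t : 0 <= t -> `|t *: dir v| = t.
  by move=> t0; rewrite normrZ nw mulr1 ger0_norm.
pose g (t : R) := f (t *: dir v).
have [||t] := @IVT R g 0 rho (`|v| ^+ 2) (ltW rho0).
- apply/(@within_continuous_distP R R R) => t; rewrite /= in_itv /= => /andP[t0 tr] e e0.
  have K1 : 0 < K + 1 by rewrite ltr_wpDl.
  exists (e / (K + 1)); first exact: divr_gt0.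
  move=> s; rewrite /= in_itv /= => /andP[s0 sr]; rewrite ltr_pdivlMr // mulrC => h1.
  rewrite /g (le_lt_trans (rad_lip rf _ _ _ _)) ?nt //; try exact: SZ.
  rewrite -scalerBl normrZ nw mulr1; apply: le_lt_trans h1.
  by rewrite ler_wpM2r // lerDl.
- rewrite /g scale0r (rad0 rf).
  have grho : `|v| ^+ 2 <= f (rho *: dir v).
    rewrite (le_trans (ltW vr)) //.
    by have := rad_ge rf (SZ rho Sw); rewrite nt; [apply; exact: lexx|exact: ltW].
  have f0 : 0 <= f (rho *: dir v) by rewrite (le_trans _ grho) // exprn_ge0.
  by rewrite (min_idPl f0) (max_idPr f0) exprn_ge0.
rewrite in_itv /= => /andP[t0 tr] gt; exists (t *: dir v).
by split; rewrite ?nt //; exact: SZ.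
Qed.

Lemma radinvP v : S v -> `|v| ^+ 2 < c * rho ^+ 2 ->
  let u := radinv S rho f v in
  [/\ S u, `|u| < rho, u = `|u| *: dir v & f u = `|v| ^+ 2].
Proof.
move=> Sv vr /=; have [u0 hu0] := radinv_ex Sv vr.
have := @xgetI _ 0 [set u | [/\ S u, `|u| <= rho, u = `|u| *: dir v & f u = `|v| ^+ 2]] u0 hu0.
rewrite -/(radinv S rho f v) => -[Su ur uv fu]; split => //.
have := rad_ge rf Su ur; rewrite fu => h.
have := le_lt_trans h vr; rewrite ltr_pM2l // ltr_pXn2r // nnegrE //.
exact: ltW.
Qed.

Lemma radinv_le v : S v -> `|v| ^+ 2 < c * rho ^+ 2 ->
  Num.sqrt c * `|radinv S rho f v| <= `|v|.
Proof.
move=> Sv vr; have [Su ur _ fu] := radinvP Sv vr.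
have := rad_ge rf Su (ltW ur); rewrite fu => h.
rewrite -(@ler_pXn2r _ 2) ?nnegrE ?mulr_ge0 ?sqrtr_ge0 // exprMn sqr_sqrtr //.
exact: ltW.
Qed.

Lemma radinvK v : S v -> `|v| ^+ 2 < c * rho ^+ 2 ->
  radmap f (radinv S rho f v) = v.
Proof.
move=> Sv vr; have [Su ur uv fu] := radinvP Sv vr.
rewrite /radmap fu sqrtr_sqr normr_id.
have [v0|v0] := eqVneq v 0; first by rewrite v0 normr0 scale0r.
have u0 : 0 < `|radinv S rho f v|.
  rewrite normr_gt0; apply/eqP => u0.
  by move: fu; rewrite u0 (rad0 rf) => /esym/eqP; rewrite sqrf_eq0 normr_eq0 (negPf v0).
rewrite uv dirZ // /dir scalerA normrZ normfV normr_id mulVf ?normr_eq0 //.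
by rewrite invr1 mul1r -/(dir v) dirK.
Qed.

Lemma radmapK u : S u -> `|u| <= rho -> f u < c * rho ^+ 2 ->
  radinv S rho f (radmap f u) = u.
Proof.
move=> Su ur fu.
have Sv := radmap_sub Su; have nv := radmap_norm Su ur.
have fv : `|radmap f u| ^+ 2 < c * rho ^+ 2 by rewrite nv.
have [Sw wr wv fw] := radinvP Sv fv.
apply: (radial_ray_inj Sv Sw Su (ltW wr) ur wv _); last by rewrite fw nv.
have [u0|u0] := eqVneq u 0; first by rewrite {2}u0 normr0 scale0r.
have fu0 : 0 < f u.
  apply: lt_le_trans (rad_ge rf Su ur).
  by rewrite mulr_gt0 // exprn_gt0 // normr_gt0.
rewrite /radmap dirZ ?sqrtr_gt0 // /dir scalerA normrZ normfV normr_id.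
by rewrite mulVf ?normr_eq0 // invr1 mul1r -/(dir u) dirK.
Qed.

End one.

(** Continuity jointly in the point and in the function, the latter for the uniform distance on the
    ball: the fibre maps vary with the base point through the function. *)
Lemma radmap_cont f u : radial S rho c K f -> S u -> `|u| <= rho ->
  forall e : R, 0 < e -> exists2 d : R, 0 < d & forall f' u',
    radial S rho c K f' -> S u' -> `|u'| <= rho ->
    (forall w, S w -> `|w| <= rho -> `|f' w - f w| <= d) -> `|u' - u| < d ->
    `|radmap f' u' - radmap f u| < e.
Proof.
move=> rf Su ur e e0.
(* The Lipschitz constant at u of the direction weighted by sqrt(f u), from [dir_dist]; it is 0 at u
   = 0 because [f 0 = 0]. *)
pose M := 2 * Num.sqrt (f u) / `|u|.
have M0 : 0 <= M by rewrite /M divr_ge0 // mulr_ge0 ?sqrtr_ge0.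
have hM u' : Num.sqrt (f u) * `|dir u - dir u'| <= M * `|u - u'|.
  have [u0|u0] := eqVneq u 0.
    by rewrite u0 (rad0 rf) sqrtr0 mul0r mulr_ge0 // /M u0 (rad0 rf) sqrtr0 mulr0 mul0r.
  have nu : 0 < `|u| by rewrite normr_gt0.
  rewrite /M -mulrA mulrAC -mulrA mulrC [X in X <= _]mulrC.
  rewrite [leRHS](_ : _ = Num.sqrt (f u) * (2 * `|u - u'| / `|u|)); last by ring.
  rewrite ler_wpM2l ?sqrtr_ge0 // ler_pdivlMr // mulrC; exact: dir_dist.
have K1 : 0 < 1 + K by rewrite ltr_pwDl.
have M1 : 0 < M + 1 by lra.
(* The first entry gives |f' u' - f u| <= (1 + K) d <= e^2/8, below the (e/2)^2 that [sqrt_dist]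
   asks for; the second bounds the change of direction by e/2. *)
exists (Num.min (e ^+ 2 / 8 / (1 + K)) (e / 2 / (M + 1))).
  by rewrite lt_min !divr_gt0 ?exprn_gt0.
set d := Num.min _ _ => f' u' rf' Su' ur' ff uu.
have d1 : d <= e ^+ 2 / 8 / (1 + K) by rewrite /d ge_min lexx.
have d2 : d <= e / 2 / (M + 1) by rewrite /d ge_min lexx orbT.
have -> : radmap f' u' - radmap f u =
    (Num.sqrt (f' u') - Num.sqrt (f u)) *: dir u' + Num.sqrt (f u) *: (dir u' - dir u).
  by rewrite /radmap scalerBl scalerBr; zmod.
have nd (w : E) : `|dir w| <= 1.
  have [->|w0] := eqVneq w 0; first by rewrite /dir scaler0 normr0.
  by rewrite norm_dir.
have h1 : `|Num.sqrt (f' u') - Num.sqrt (f u)| < e / 2.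
  rewrite -(@ltr_pXn2r _ 2) ?nnegrE //; last by lra.
  rewrite (le_lt_trans (sqrt_dist _ _)) //; try exact: (radial_ge0 rf').
    exact: radial_ge0 rf _ _ _.
  rewrite (le_lt_trans (ler_distD (f u') _ _)) //.
  have a1 := ff _ Su' ur'.
  have a2 := rad_lip rf Su' ur' Su ur.
  have a3 : K * `|u' - u| <= K * d by rewrite ler_wpM2l // ltW.
  move: d1; rewrite ler_pdivlMr // expr_div_n (_ : 2 ^+ 2 = 4 :> R); last by ring.
  have : 0 < e ^+ 2 by rewrite exprn_gt0.
  lra.
have h2 : M * `|u - u'| < e / 2.
  move: d2; rewrite ler_pdivlMr // => d2.
  have : M * `|u - u'| <= M * d by rewrite ler_wpM2l // distrC ltW.
  have : d > 0 by exact: le_lt_trans uu.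
  lra.
rewrite (le_lt_trans (ler_normD _ _)) // (normrZ _ (dir u')).
rewrite (normrZ _ (dir u' - dir u)) (ger0_norm (sqrtr_ge0 _)).
rewrite (distrC (dir u')).
have h3 := hM u'.
have h4 : `|Num.sqrt (f' u') - Num.sqrt (f u)| * `|dir u'| <= `|Num.sqrt (f' u') - Num.sqrt (f u)|.
  by rewrite ler_piMr // nd.
lra.
Qed.

(** The length |u'| is transported to the ray of v, where [radial_ray_dist] bounds the difference of
    lengths by a difference of values of f. The three terms pay for replacing f by f', for turning
    the ray (Lipschitz bound of f'), and for the change of the target value |v|^2. *)
Lemma radinv_dist f f' v v' (d : R) : radial S rho c K f -> radial S rho c K f' ->
  S v -> `|v| ^+ 2 < c * rho ^+ 2 -> S v' -> `|v'| ^+ 2 < c * rho ^+ 2 ->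
  (forall w, S w -> `|w| <= rho -> `|f' w - f w| <= d) ->
  c * (`|radinv S rho f' v'| - `|radinv S rho f v|) ^+ 2 <=
  d + K * (2 / Num.sqrt c * `|v' - v|) + `| `|v'| ^+ 2 - `|v| ^+ 2|.
Proof.
move=> rf rf' Sv vr Sv' vr' ff.
have [Su ur uv fu] := radinvP rf Sv vr.
have [Su' ur' uv' fu'] := radinvP rf' Sv' vr'.
have le' := radinv_le rf' Sv' vr'.
set u := radinv S rho f v in Su ur uv fu *.
set u' := radinv S rho f' v' in Su' ur' uv' fu' le' *.
have sc : 0 < Num.sqrt c by rewrite sqrtr_gt0.
have d0 : 0 <= d.
  apply: le_trans (ff 0 _ _) => //; first by case: subS.
  by rewrite normr0 ltW.
have Kt : 0 <= K * (2 / Num.sqrt c * `|v' - v|).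
  by rewrite mulr_ge0 // mulr_ge0 // divr_ge0 // ltW.
have [v0|v0] := eqVneq v 0.
  have -> : u = 0 by rewrite uv v0 /dir !scaler0.
  rewrite v0 !normr0 subr0 expr0n /= (subr0 (`|v'| ^+ 2)) -v0.
  have := rad_ge rf' Su' (ltW ur'); rewrite fu'.
  have := ler_norm (`|v'| ^+ 2); lra.
have nw := norm_dir v0; have Sw := Sdir Sv.
have nt t : 0 <= t -> `|t *: dir v| = t.
  by move=> t0; rewrite normrZ nw mulr1 ger0_norm.
have := @radial_ray_dist f rf (dir v) `|u| `|u'| Sw nw.
rewrite !normr_ge0 (ltW ur) (ltW ur') => /(_ isT isT) /le_trans; apply.
rewrite -uv fu -fu'.
have wr : `| `|u'| *: dir v| <= rho by rewrite nt // ltW.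
have Sw' := SZ `|u'| Sw.
rewrite (le_trans (ler_distD (f' u') _ _)) // lerD //.
rewrite (le_trans (ler_distD (f' (`|u'| *: dir v)) _ _)) // lerD //.
  by rewrite distrC ff.
rewrite (le_trans (rad_lip rf' Sw' wr Su' (ltW ur'))) // ler_wpM2l //.
rewrite {2}uv' -scalerBr normrZ normr_id distrC.
have := dir_dist v' v.
rewrite mulrAC ler_pdivlMr //; apply: le_trans.
by rewrite mulrAC ler_wpM2r // mulrC.
Qed.

Lemma radinv_cont f v : radial S rho c K f -> S v -> `|v| ^+ 2 < c * rho ^+ 2 ->
  forall e : R, 0 < e -> exists2 d : R, 0 < d & forall f' v',
    radial S rho c K f' -> S v' -> `|v'| ^+ 2 < c * rho ^+ 2 ->
    (forall w, S w -> `|w| <= rho -> `|f' w - f w| <= d) -> `|v' - v| < d ->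
    `|radinv S rho f' v' - radinv S rho f v| < e.
Proof.
move=> rf Sv vr e e0.
have sc : 0 < Num.sqrt c by rewrite sqrtr_gt0.
(* The coefficients of d in [radinv_dist]: turning the ray, the difference of squares (using d <=
   1), and the change of function. *)
pose M := K * (2 / Num.sqrt c) + (2 * `|v| + 1) + 1.
have t0 : 0 <= 2 / Num.sqrt c by rewrite divr_ge0 // ltW.
have M0 : 0 < M.
  have : 0 <= K * (2 / Num.sqrt c) by rewrite mulr_ge0.
  by rewrite /M; have := normr_ge0 v; lra.
exists (Num.min 1 (Num.min (c * (e / 2) ^+ 2 / (M + 1)) (e / 2 / (2 / Num.sqrt c + 1)))).
  rewrite !lt_min ltr01 /= !divr_gt0 ?mulr_gt0 ?exprn_gt0 //; lra.
set d := Num.min _ _ => f' v' rf' Sv' vr' ff vv.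
have d1 : d <= 1 by rewrite /d ge_min lexx.
have d2 : d <= c * (e / 2) ^+ 2 / (M + 1) by rewrite /d !ge_min lexx !orbT.
have d3 : d <= e / 2 / (2 / Num.sqrt c + 1) by rewrite /d !ge_min lexx !orbT.
have d0 : 0 < d by exact: le_lt_trans vv.
have [Su ur uv fu] := radinvP rf Sv vr.
have [Su' ur' uv' fu'] := radinvP rf' Sv' vr'.
have le1 := radinv_le rf Sv vr.
have dist := radinv_dist rf rf' Sv vr Sv' vr' ff.
set u := radinv S rho f v in Su ur uv fu dist le1 *.
set u' := radinv S rho f' v' in Su' ur' uv' fu' dist *.
have sqd : `| `|v'| ^+ 2 - `|v| ^+ 2| <= (2 * `|v| + 1) * d.
  rewrite subr_sqr normrM mulrC ler_pM //.
    rewrite ger0_norm ?addr_ge0 //.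
    have := ler_dist_dist v' v; rewrite ler_norml => /andP[_]; lra.
  by rewrite (le_trans (ler_dist_dist _ _)) // ltW.
have hK : K * (2 / Num.sqrt c * `|v' - v|) <= K * (2 / Num.sqrt c) * d.
  by rewrite mulrA ler_wpM2l ?mulr_ge0 // ltW.
have h1 : `| `|u'| - `|u| | < e / 2.
  rewrite -(@ltr_pXn2r _ 2) ?nnegrE //; last by lra.
  rewrite real_normK ?num_real // -(ltr_pM2l c0).
  apply: le_lt_trans dist _.
  move: d2; rewrite ler_pdivlMr; last by lra.
  move=> d2.
  apply: lt_le_trans d2; rewrite /M; lra.
have h2 : `|u| * `|dir v' - dir v| < e / 2.
  have := dir_dist v v'; rewrite distrC (distrC v) => dd.
  have a1 : Num.sqrt c * `|u| * `|dir v' - dir v| <= 2 * `|v' - v|.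
    by apply: le_trans dd; rewrite ler_wpM2r.
  move: d3; rewrite ler_pdivlMr; last by lra.
  have : `|u| * `|dir v' - dir v| <= 2 / Num.sqrt c * `|v' - v|.
    by rewrite mulrAC ler_pdivlMr // mulrC mulrA.
  have : 2 / Num.sqrt c * `|v' - v| <= 2 / Num.sqrt c * d.
    by rewrite ler_wpM2l // ltW.
  lra.
have -> : u' - u = (`|u'| - `|u|) *: dir v' + `|u| *: (dir v' - dir v).
  by rewrite scalerBl scalerBr -uv -uv'; zmod.
rewrite (le_lt_trans (ler_normD _ _)) // (normrZ _ (dir v')).
rewrite (normrZ _ (dir v' - dir v)) normr_id.
have h4 : `| `|u'| - `|u| | * `|dir v'| <= `| `|u'| - `|u| |.
  rewrite ler_piMr //.
  have [->|w0] := eqVneq v' 0; first by rewrite /dir scaler0 normr0.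
  by rewrite norm_dir.
lra.
Qed.

End radial_theory.

(** * Fixed points, the inclusion of X in H, operator norms *)

Lemma contraction_fixpoint (R : realType) (E : completeNormedModType R)
    (U : set E) (f : E -> E) (q : R) :
  closed U -> U !=set0 -> 0 <= q -> q < 1 -> (forall x, U x -> U (f x)) ->
  (forall x y, U x -> U y -> `|f x - f y| <= q * `|x - y|) ->
  exists x, U x /\ f x = x.
Proof.
move=> cU U0 q0 q1 fU fq.
have hf : {homo f : x / U x >-> U x} by [].
have cf : is_contraction (mkfun hf).
  by exists (NngNum q0); split => // -[x y] /= [Ux Uy]; exact: fq.
have [p Up pf] := banach_fixed_point cf cU U0.
by exists p; split => //; rewrite [RHS]pf.
Qed.

Lemma continuous_linear_bound (R : realType) (E F : normedModType R)
    (T : {linear E -> F}) :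
  continuous T -> exists2 M : R, 0 < M & forall u, `|T u| <= M * `|u|.
Proof.
move=> cT.
have /linear_boundedP/pinfty_ex_gt0[M M0 hM] := continuous_linear_bounded 0 (cT 0).
by exists M.
Qed.

Lemma is_derive_comp_linear (R : realType) (E F G : normedModType R)
    (T : {linear E -> F}) (f : F -> G) (x u : E) (l : G) :
  is_derive x u (f \o T) l <-> is_derive (T x) (T u) f l.
Proof.
have lin (t : R) : T (t *: u + x) = t *: T u + T x by rewrite linearD linearZ.
by split=> /is_derive_distP h; apply/is_derive_distP => e /h[d d0 hd];
   exists d => // t t0 td; have := hd t t0 td; rewrite /= lin.
Qed.

Section inclusion.
Variables (R : realType) (H X : normedModType R) (i : {linear X -> H}).
Hypothesis inj_i : injective i.

Lemma toX_i x : toX i (i x) = x.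
Proof.
apply: inj_i; have := @xgetI _ 0 [set y | i y = i x] x erefl; exact.
Qed.

Lemma i_toX u : range i u -> i (toX i u) = u.
Proof. by move=> [x _ <-]; rewrite toX_i. Qed.

Lemma normX_i x : normX i (i x) = `|x|.
Proof. by rewrite /normX toX_i. Qed.

Lemma range_subspace : is_subspace (range i).
Proof.
split; first by exists 0 => //; rewrite linear0.
by move=> a _ _ [x _ <-] [y _ <-]; exists (a *: x + y) => //; rewrite linearP.
Qed.

End inclusion.

Lemma subspaceD (R : realType) (E : normedModType R) (S : set E) u v :
  is_subspace S -> S u -> S v -> S (u + v).
Proof. by move=> [_ h] Su Sv; have := h 1 u v Su Sv; rewrite scale1r. Qed.

Lemma subspaceZ (R : realType) (E : normedModType R) (S : set E) a u :
  is_subspace S -> S u -> S (a *: u).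
Proof. by move=> [S0 h] Su; have := h a u 0 Su S0; rewrite addr0. Qed.

Lemma subspaceB (R : realType) (E : normedModType R) (S : set E) u v :
  is_subspace S -> S u -> S v -> S (u - v).
Proof.
by move=> sS Su Sv; apply: subspaceD => //; rewrite -scaleN1r; exact: subspaceZ.
Qed.

(* q(u - T u / M) >= 0 where q(u) = ip (T u) u *)
Lemma form_ge0_norm (R : realType) (H : normedModType R) (ip : {dot H for idfun})
    (ip_norm : forall u, `|u| ^+ 2 = ip u u) (S : set H) (T : H -> H) (M : R) :
  is_subspace S -> (forall (a : R) u v, T (a *: u + v) = a *: T u + T v) ->
  (forall u v, ip (T u) v = ip u (T v)) ->
  0 < M -> (forall u, `|T u| <= M * `|u|) -> (forall u, S u -> S (T u)) ->
  (forall u, S u -> 0 <= ip (T u) u) ->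
  forall u, S u -> `|T u| ^+ 2 <= M * ip (T u) u.
Proof.
move=> subS Tl Ts M0 TM TS T0 u Su.
have := T0 (- M^-1 *: T u + u).
rewrite Tl !(ipDl, ipDr, ipZl, ipZr) [ip (T (T u)) u]Ts -(ip_norm (T u)).
have := ip_le ip_norm (T (T u)) (T u).
have := TM (T u); move: (ip (T (T u)) (T u)) => p.
set t := `|T u|; set s := `|T (T u)|; set q := ip (T u) u.
have t0 : 0 <= t by exact: normr_ge0.
move=> sM ps.
have pM : p <= M * t ^+ 2.
  by rewrite (le_trans ps) // expr2 mulrA ler_wpM2r.
have Mi : 0 < M^-1 by rewrite invr_gt0.
have Sv : S (- M^-1 *: T u + u) by apply: subS.2 => //; exact: TS.
move=> /(_ Sv) h; have h2 : 0 <= M^-1 * (M^-1 * p) - 2 * M^-1 * t ^+ 2 + q by move: h; lra.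
have : M^-1 * (M^-1 * p) <= M^-1 * t ^+ 2.
  by rewrite ler_wpM2l ?(ltW Mi) // ler_pdivrMl.
move=> h3; have : M^-1 * t ^+ 2 <= q by lra.
by rewrite ler_pdivrMl.
Qed.

(** Q applied to the direction of g lies within e of some y of the net, and y contributes nothing to
    the product with g. *)
Lemma net_small (R : realType) (H : normedModType R) (ip : {dot H for idfun})
    (ip_norm : forall u, `|u| ^+ 2 = ip u u) (Q : {linear H -> H}) (e : R)
    (ys : seq H) (g : H) :
  (forall u, `|u| <= 1 -> exists2 y, y \in ys & `|Q u - y| < e) ->
  (forall y, y \in ys -> ip g y = 0) -> `|ip (Q g) g| <= e * `|g| ^+ 2.
Proof.
move=> net gy; have [->|g0] := eqVneq g 0.
  by rewrite ip0r !normr0 expr0n mulr0.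
have [|y yys hy] := net (dir g); first by rewrite norm_dir.
rewrite -{1}(dirK g) linearZ /= ipZl normrM normr_id.
have -> : ip (Q (dir g)) g = ip (Q (dir g) - y) g by rewrite ipBl (ipC _ y) gy // subr0.
have := cauchy_schwarz ip_norm (Q (dir g) - y) g.
have ng : 0 < `|g| by rewrite normr_gt0.
move=> cs; rewrite mulrC expr2 mulrA; apply: ler_wpM2r => //.
by apply: le_trans cs _; apply: ler_wpM2r => //; exact: ltW.
Qed.

(** As [e] is a finite list, the existence of such a basis is how finite dimension is expressed. *)
Definition hilbert_basis (R : realType) (H : normedModType R)
    (ip : {dot H for idfun}) (S : set H) (e : seq H) : Prop :=
  [/\ orthonormal_seq ip e, forall y, y \in e -> S y &
      forall u, S u -> expand ip e id u = u].

Lemma opnorm_le (R : realType) (E F : normedModType R) (S : set E) (T : E -> F)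
    (K : R) : S 0 -> 0 <= K -> (forall u, S u -> `|T u| <= K * `|u|) -> opnorm S T <= K.
Proof.
move=> S0 K0 TK; apply: sup_le_ub.
  by exists `|T 0|, 0 => //; split => //; rewrite normr0 ler01.
move=> _ [u [Su u1] <-]; rewrite (le_trans (TK u Su)) //.
by rewrite ler_piMr.
Qed.

(** The crude bound [K] makes the supremum meaningful: the supremum of an unbounded set is 0. *)
Lemma le_opnorm (R : realType) (E F : normedModType R) (S : set E) (T : E -> F)
    (K : R) : is_subspace S -> (forall u, S u -> `|T u| <= K * `|u|) ->
  (forall (a : R) u, S u -> T (a *: u) = a *: T u) ->
  forall u, S u -> `|T u| <= opnorm S T * `|u|.
Proof.
move=> sS TK TZ u Su.
have T0 : T 0 = 0 by rewrite -(scale0r 0) TZ ?scale0r //; case: sS.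
have [->|u0] := eqVneq u 0; first by rewrite T0 !normr0 mulr0.
have nu : 0 < `|u| by rewrite normr_gt0.
rewrite -ler_pdivrMr //.
have -> : `|T u| / `|u| = `|T (dir u)|.
  by rewrite /dir TZ // normrZ normfV normr_id mulrC.
apply: sup_upper_bound; last first.
  by exists (dir u) => //; split; [exact: subspaceZ|rewrite norm_dir].
split; first by exists `|T (dir u)|, (dir u) => //; split; [exact: subspaceZ|rewrite norm_dir].
exists (`|K|); move=> _ [v [Sv v1] <-]; rewrite (le_trans (TK v Sv)) //.
rewrite (le_trans (ler_norm _)) // normrM normr_id ler_piMr //.
Qed.

Lemma compact_operator_bounded (R : realType) (E F : normedModType R)
    (Q : {linear E -> F}) : compact_operator Q ->
  exists2 K : R, 0 <= K & forall u, `|Q u| <= K * `|u|.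
Proof.
move=> /compact_operator_net/(_ ltr01)[ys net].
exists (1 + \sum_(y <- ys) `|y|); first by rewrite addr_ge0 // sumr_ge0.
move=> u; have [->|u0] := eqVneq u 0; first by rewrite linear0 !normr0 mulr0.
have [|y yys hy] := net (dir u); first by rewrite norm_dir.
rewrite -{1}(dirK u) linearZ /= normrZ normr_id mulrC; apply: ler_wpM2r => //.
rewrite -(subrK y (Q (dir u))) (le_trans (ler_normD _ _)) // lerD //; first exact: ltW.
elim: ys yys {net} => [//|z ys IH]; rewrite inE big_cons => /predU1P[->|/IH h].
  by rewrite lerDl sumr_ge0.
by rewrite (le_trans h) // lerDr.
Qed.

(** * Consequences of continuous directional differentiability *)

Lemma cont_dir_diff_dist (R : realType) (E F : normedModType R) (T : E -> F)
    (U : set E) (x u : E) : cont_dir_diff T U -> U x ->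
  forall e : R, 0 < e -> exists2 d : R, 0 < d & forall y w, `|y - x| < d ->
    `|w - u| < d -> `|'D_w T y - 'D_u T x| < e.
Proof.
move=> [_ cT] Ux e e0.
have /cvgrPdist_lt/(_ e e0)[[N1 N2] /= [h1 h2] hN] := cT x u Ux.
have /nbhs_normP[d1 /= d10 hd1] := h1.
have /nbhs_normP[d2 /= d20 hd2] := h2.
exists (Num.min d1 d2); first by rewrite lt_min d10.
move=> y w; rewrite !lt_min => /andP[y1 _] /andP[_ w2].
rewrite distrC; apply: (hN (y, w)); split => /=; [apply: hd1|apply: hd2];
  by rewrite /ball_ /= distrC.
Qed.

Lemma norm_segment (R : realType) (E : normedModType R) (c x y : E) (t r : R) :
  0 <= t <= 1 -> `|x - c| < r -> `|y - c| < r -> `|x + t *: (y - x) - c| < r.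
Proof.
move=> /andP[t0 t1] xr yr.
have -> : x + t *: (y - x) - c = (1 - t) *: (x - c) + t *: (y - c).
  by rewrite scalerBl scale1r !scalerBr; zmod.
rewrite (le_lt_trans (ler_normD _ _)) // !normrZ (ger0_norm t0).
rewrite ger0_norm ?subr_ge0 //.
have : (1 - t) * `|x - c| <= (1 - t) * r by rewrite ler_wpM2l ?subr_ge0 // ltW.
have : t * `|y - c| <= t * r by rewrite ler_wpM2l // ltW.
have [->|t_neq1] := eqVneq t 1; first by rewrite subrr !mul0r !mul1r; lra.
have : (1 - t) * `|x - c| < (1 - t) * r.
  by rewrite ltr_pM2l // subr_gt0 lt_neqAle t_neq1.
lra.
Qed.

(** Joint continuity at (x, 0), where the derivative is 0, bounds it by 1 for y near x and
    directions shorter than d; homogeneity turns this into the bound (2/d)|w|, and the mean value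
    inequality along segments concludes. *)
Lemma cont_dir_diff_lip (R : realType) (E F : normedModType R) (T : E -> F)
    (U : set E) (x : E) : cont_dir_diff T U -> open U -> U x ->
  exists2 K : R, 0 <= K & exists2 r : R, 0 < r &
    (forall y, `|y - x| < r -> U y) /\
    (forall y z, `|y - x| < r -> `|z - x| < r -> `|T y - T z| <= K * `|y - z|).
Proof.
move=> cT oU Ux.
have /nbhs_normP[r1 /= r10 hr1] : nbhs x U by exact: open_nbhs_nbhs.
have [d d0 hd] := cont_dir_diff_dist 0 cT Ux ltr01.
have r1U y : `|y - x| < r1 -> U y by move=> h; apply: hr1; rewrite /ball_ /= distrC.
have D0 : 'D_0 T x = 0 by apply: derive_val; exact: is_derive0.
have bound y w : `|y - x| < Num.min r1 d -> `|'D_w T y| <= 2 / d * `|w|.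
  rewrite lt_min => /andP[yr yd].
  have [->|w0] := eqVneq w 0.
    have -> : 'D_0 T y = 0 by apply: derive_val; exact: is_derive0.
    by rewrite !normr0 mulr0.
  have nw : 0 < `|w| by rewrite normr_gt0.
  have [k k0 kw] : exists2 k, 0 < k & k * `|w| = d / 2.
    by exists (d / 2 / `|w|); rewrite ?mulfVK ?gt_eqF // !divr_gt0.
  have [_ dk] := derive_scale k (cT.1 y w (r1U y yr)).
  have := hd y (k *: w) yd.
  rewrite D0 !subr0 dk !normrZ gtr0_norm // kw => h.
  have {}h : k * `|'D_w T y| < 1 by apply: h; lra.
  have -> : `|'D_w T y| = 2 / d * `|w| * (k * `|'D_w T y|).
    have -> : 2 / d * `|w| * (k * `|'D_w T y|) = 2 / d * (k * `|w|) * `|'D_w T y| by ring.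
    by rewrite kw; field; rewrite gt_eqF.
  by rewrite ler_piMr ?ltW // mulr_gt0 // divr_gt0.
exists (2 / d); first by rewrite divr_ge0 // ltW.
exists (Num.min r1 d); first by rewrite lt_min r10.
split=> [y|y z yr zr]; first by rewrite lt_min => /andP[/r1U].
have hs (t : R) : 0 <= t <= 1 -> `|z + t *: (y - z) - x| < Num.min r1 d.
  by move=> t01; exact: norm_segment.
have -> : T y - T z = T (z + 1 *: (y - z)) - T (z + 0 *: (y - z)).
  by congr (T _ - T _); [rewrite scale1r addrC subrK|rewrite scale0r addr0].
apply: (@mean_value_ineq R F (fun t => T (z + t *: (y - z)))
  (fun t => 'D_(y - z) T (z + t *: (y - z)))) => t t01.
  apply: is_derive_line; apply: cT.1; apply: r1U.
  by have := hs t t01; rewrite lt_min => /andP[].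
by apply: bound; exact: hs.
Qed.

Section strong_convexity_along.
Variables (R : realType) (E : normedModType R) (S : set E) (G : E -> R) (a rho : R).
Hypotheses (subS : is_subspace S)
  (derG : forall p w : E, `|p| < rho -> derivable G p w)
  (mono : forall p w, S w -> `|p| < rho -> `|p + w| < rho ->
     a * `|w| ^+ 2 <= 'D_w G (p + w) - 'D_w G p).

Let seg (p w : E) (t : R) : `|p| < rho -> `|p + w| < rho -> 0 <= t <= 1 -> `|p + t *: w| < rho.
Proof.
move=> pr pwr t01; have := @norm_segment R E 0 p (p + w) t rho t01.
by rewrite !subr0 addrAC subrr add0r; apply.
Qed.

Let hder (p w : E) : `|p| < rho -> `|p + w| < rho -> forall t : R, 0 <= t <= 1 ->
  is_derive t 1 (fun s : R => G (p + s *: w)) ('D_w G (p + t *: w)).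
Proof. by move=> pr pwr t t01; apply: is_derive_line; apply: derG; exact: seg. Qed.

(** [mono] is applied to the increment (t - s) w, and one factor t - s is cancelled by homogeneity
    of the derivative. *)
Let hmono (p w : E) : S w -> `|p| < rho -> `|p + w| < rho ->
  forall s t : R, 0 <= s -> s < t -> t <= 1 ->
  a * `|w| ^+ 2 * (t - s) <= 'D_w G (p + t *: w) - 'D_w G (p + s *: w).
Proof.
move=> Sw pr pwr s t s0 st t1.
have ts : 0 < t - s by rewrite subr_gt0.
have s01 : 0 <= s <= 1 by rewrite s0; lra.
have t01 : 0 <= t <= 1 by rewrite t1; lra.
have ps := seg pr pwr s01; have pt := seg pr pwr t01.
have tE : p + s *: w + (t - s) *: w = p + t *: w by rewrite scalerBl; zmod.
have := @mono (p + s *: w) ((t - s) *: w) (subspaceZ _ subS Sw) ps.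
rewrite tE => /(_ pt).
have [_ ->] := derive_scale (t - s) (derG pt : derivable G _ w).
have [_ ->] := derive_scale (t - s) (derG ps : derivable G _ w).
rewrite normrZ gtr0_norm // exprMn -scalerBr.
have -> : a * ((t - s) ^+ 2 * `|w| ^+ 2) = (t - s) * (a * `|w| ^+ 2 * (t - s)) by ring.
by rewrite -[(t - s) *: _]/((t - s) * _) ler_pM2l.
Qed.

Lemma strong_convex_along (p w : E) (t : R) : S w -> `|p| < rho -> `|p + w| < rho -> 0 <= t <= 1 ->
  G (p + t *: w) <= (1 - t) * G p + t * G (p + w) - a / 2 * `|w| ^+ 2 * (t * (1 - t)).
Proof.
move=> Sw pr pwr t01.
have := strong_convex01 (hder pr pwr) (hmono Sw pr pwr) t01.
by rewrite scale0r addr0 scale1r [_ / 2]mulrAC.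
Qed.

Lemma strong_tangent_along p w : S w -> `|p| < rho -> `|p + w| < rho ->
  G p + 'D_w G p + a / 2 * `|w| ^+ 2 <= G (p + w).
Proof.
move=> Sw pr pwr.
have := strong_convex_tangent (hder pr pwr) (hmono Sw pr pwr).
by rewrite scale0r addr0 scale1r [_ / 2]mulrAC.
Qed.

End strong_convexity_along.

(** * The normal form in one fibre z + h(z) + H^+ + H^- *)

(** What the fibre construction uses of L, free of X, A and B. Concavity along H^- carries a
    quadratic gain, from which [amax_strong] gets uniqueness and continuity of the maximum point;
    along H^+ convexity is paired with a quadratic tangent bound. *)
Record energy_bounds (R : realType) (H : normedModType R) (Hp Hm V : set H)
    (L : H -> R) (a rho K : R) : Prop := {
  eb_a0 : 0 < a ;
  eb_rho0 : 0 < rho ;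
  eb_K0 : 0 <= K ;
  eb_V : forall y, `|y| < rho -> V y ;
  eb_lip : forall y z, `|y| < rho -> `|z| < rho -> `|L y - L z| <= K * `|y - z| ;
  eb_convex : forall p w (t : R), Hp w -> `|p| < rho -> `|p + w| < rho -> 0 <= t <= 1 ->
    L (p + t *: w) <= (1 - t) * L p + t * L (p + w) ;
  eb_above : forall p w, Hp w -> `|p| < rho -> `|p + w| < rho ->
    L p + 'D_w L p + a * `|w| ^+ 2 <= L (p + w) ;
  eb_concave : forall p w (t : R), Hm w -> `|p| < rho -> `|p + w| < rho -> 0 <= t <= 1 ->
    (1 - t) * L p + t * L (p + w) + a * `|w| ^+ 2 * (t * (1 - t)) <= L (p + t *: w) ;
  eb_below : forall p w, Hm w -> `|p| < rho -> `|p + w| < rho ->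
    L (p + w) <= L p + 'D_w L p - a * `|w| ^+ 2
}.

(** With |q| < rho/2 and |x|, |y| <= rho/8, the point q + x + y stays in the ball of radius rho. *)
Definition fib_rad (R : realType) (rho : R) : R := rho / 8.
(** The second entry ensures K s1 <= a (s/2)^2, where s is [fib_rad rho] and s1 the present radius.
    By [amax_small] the maximum point over x then has norm at most s/2, which leaves room for
    displacements v of norm s/2. *)
Definition fib_radp (R : realType) (a rho K : R) : R :=
  Num.min (fib_rad rho) (a * (fib_rad rho / 2) ^+ 2 / (K + 1)).

Lemma fib_radp_gt0 (R : realType) (a rho K : R) :
  0 < a -> 0 < rho -> 0 <= K -> 0 < fib_radp a rho K.
Proof.
move=> a0 rho0 K0; have s0 : 0 < fib_rad rho by rewrite divr_gt0.
by rewrite lt_min s0 divr_gt0 // ?mulr_gt0 // ?exprn_gt0 ?divr_gt0 // ltr_wpDl.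
Qed.

(** [Bs] stands for the set of points z + h(z). Keeping it abstract separates the fibrewise
    construction from the way the base points are produced. *)
Record fiber_data (R : realType) (H : normedModType R) (Hp Hm V : set H)
    (L : H -> R) (a rho K : R) (Bs : set H) : Prop := {
  fd_energy : energy_bounds Hp Hm V L a rho K ;
  fd_subp : is_subspace Hp ;
  fd_subm : is_subspace Hm ;
  fd_compact : forall r, compact (Hm `&` [set y | `|y| <= r]) ;
  fd_small : forall q, Bs q -> `|q| < rho / 2 ;
  fd_critp : forall q v, Bs q -> Hp v -> 'D_v L q = 0 ;
  fd_critm : forall q v, Bs q -> Hm v -> 'D_v L q = 0
}.

Section fiber.
Variables (R : realType) (H : normedModType R) (Hp Hm V : set H) (L : H -> R)
  (a rho K : R) (Bs : set H).
Hypothesis fd : fiber_data Hp Hm V L a rho K Bs.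

Let subp := fd_subp fd.
Let subm := fd_subm fd.
Let a0 := eb_a0 (fd_energy fd).
Let rho0 := eb_rho0 (fd_energy fd).
Let K0 := eb_K0 (fd_energy fd).
Let lipL := eb_lip (fd_energy fd).
Let cvxp := eb_convex (fd_energy fd).
Let tanp := eb_above (fd_energy fd).
Let ccvm := eb_concave (fd_energy fd).
Let tanm := eb_below (fd_energy fd).
Let compm := fd_compact fd.
Let Bsmall := fd_small fd.
Let critp := fd_critp fd.
Let critm := fd_critm fd.

Let s : R := fib_rad rho.
Let s1 : R := fib_radp a rho K.

Let s0 : 0 < s. Proof. by rewrite divr_gt0. Qed.
Let K1 : 0 < K + 1. Proof. by rewrite ltr_wpDl. Qed.
Let s10 : 0 < s1. Proof. exact: fib_radp_gt0. Qed.

Let s1s : s1 <= s. Proof. by rewrite ge_min lexx. Qed.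

Let s1K : K * s1 <= a * (s / 2) ^+ 2.
Proof.
have : s1 <= a * (s / 2) ^+ 2 / (K + 1) by rewrite ge_min lexx orbT.
rewrite ler_pdivlMr // => h; apply: le_trans h; rewrite mulrC ler_wpM2l ?lerDl //.
exact: ltW s10.
Qed.

Let in3 (q x y : H) : Bs q -> `|x| <= s -> `|y| <= s -> `|q + x + y| < rho.
Proof.
move=> /Bsmall qr xs ys; have := ler_normD (q + x) y; have := ler_normD q x.
have := normr_ge0 q; move: qr xs ys; rewrite /s /fib_rad; lra.
Qed.

Let in2 (q x : H) : Bs q -> `|x| <= s -> `|q + x| < rho.
Proof. by move=> Bq xs; have := @in3 q x 0 Bq xs; rewrite addr0 normr0 ltW //; apply. Qed.

Let in1 q : Bs q -> `|q| < rho.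
Proof. by move=> Bq; have := @in2 q 0 Bq; rewrite addr0 normr0 ltW //; apply. Qed.

(** The m(x) of the overview, at the base point q; [jval] and [gval] below are its j and g. *)
Definition amax (q x : H) : H :=
  xget 0 [set y | [/\ Hm y, `|y| <= s &
    forall y', Hm y' -> `|y'| <= s -> L (q + x + y') <= L (q + x + y)]].

Lemma amaxP q x : Bs q -> `|x| <= s ->
  [/\ Hm (amax q x), `|amax q x| <= s &
    forall y', Hm y' -> `|y'| <= s -> L (q + x + y') <= L (q + x + amax q x)].
Proof.
move=> Bq xs.
have [||y yK hy] := @compact_EVT_max H R (fun y => L (q + x + y)) _ _ (@compm s).
- by exists 0; split; [exact: subm.1|rewrite /= normr0 ltW].
- apply/within_continuous_distP => y [_ /= ys] e ep.
  exists (e / (K + 1)); first exact: divr_gt0.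
  move=> z [_ /= zs]; rewrite ltr_pdivlMr // => h.
  rewrite (le_lt_trans (lipL (in3 Bq xs zs) (in3 Bq xs ys))) //.
  have -> : q + x + z - (q + x + y) = z - y by zmod.
  by apply: le_lt_trans h; rewrite mulrC ler_wpM2l // lerDl.
have {yK} [Hy /= ys] : (Hm `&` [set y | `|y| <= s]) y by move: yK; rewrite inE.
have := @xgetI _ 0 [set y | [/\ Hm y, `|y| <= s &
    forall y', Hm y' -> `|y'| <= s -> L (q + x + y') <= L (q + x + y)]] y.
rewrite -/(amax q x); apply; split => // y' Hy' ys'.
by apply: hy; rewrite inE.
Qed.

(** On the segment from the maximum point z to y, concavity and maximality give L(q+x+y) - L(q+x+z)
    + c (1 - t) <= 0 for every t in (0, 1], with c = a |y - z|^2; then t tends to 0. *)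
Lemma amax_strong q x y : Bs q -> `|x| <= s -> Hm y -> `|y| <= s ->
  L (q + x + y) + a * `|y - amax q x| ^+ 2 <= L (q + x + amax q x).
Proof.
move=> Bq xs Hy ys; have [Hz zs hz] := amaxP Bq xs.
set z := amax q x in Hz zs hz *; set w := y - z.
have Hw : Hm w by exact: subspaceB.
have yE : q + x + z + w = q + x + y by rewrite /w; zmod.
apply/ler_addgt0Pr => e ep.
set c := a * `|w| ^+ 2; have c0 : 0 <= c by rewrite mulr_ge0 ?exprn_ge0 // ltW.
have c1 : 0 < c + 1 by rewrite ltr_wpDl.
pose t := Num.min 1 (e / (c + 1)).
have t0 : 0 < t by rewrite lt_min ltr01 divr_gt0.
have t1 : t <= 1 by rewrite ge_min lexx.
have te : t <= e / (c + 1) by rewrite ge_min lexx orbT.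
have t01 : 0 <= t <= 1 by rewrite (ltW t0).
have yr : `|q + x + z + w| < rho by rewrite yE; exact: in3.
have := ccvm Hw (in3 Bq xs zs) yr t01; rewrite yE -/c.
have zt : `|z + t *: w| <= s.
  have -> : z + t *: w = (1 - t) *: z + t *: y.
    by rewrite /w scalerBl scale1r scalerBr; zmod.
  rewrite (le_trans (ler_normD _ _)) // !normrZ (ger0_norm (ltW t0)).
  rewrite ger0_norm ?subr_ge0 //.
  have : (1 - t) * `|z| <= (1 - t) * s by rewrite ler_wpM2l // subr_ge0.
  have : t * `|y| <= t * s by rewrite ler_wpM2l // ltW.
  lra.
have Hzt : Hm (z + t *: w).
  by apply: (subspaceD subm) => //; exact: (subspaceZ _ subm).
have := hz _ Hzt zt; rewrite addrA => h1 h2.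
have h3 : t * (L (q + x + y) - L (q + x + z) + c * (1 - t)) <= 0 by lra.
move: h3; rewrite pmulr_rle0 // => h3.
have : t * (c + 1) <= e by rewrite -ler_pdivlMr.
have : 0 < t by []. lra.
Qed.

(** Write z for the maximum point. Criticality of q gives a |z|^2 <= L(q) - L(q+z) and L(q) <=
    L(q+x), maximality gives L(q+x) <= L(q+x+z), and L(q+x+z) - L(q+z) <= K |x|. *)
Lemma amax_small q x : Bs q -> Hp x -> `|x| <= s -> a * `|amax q x| ^+ 2 <= K * `|x|.
Proof.
move=> Bq Hx xs; have [Hz zs hz] := amaxP Bq xs.
set z := amax q x in Hz zs hz *.
have s00 : `|0 : H| <= s by rewrite normr0 ltW.
have := hz 0 subm.1 s00; rewrite addr0 => h1.
have := tanp Hx (in1 Bq) (in2 Bq xs); rewrite critp // => h2.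
have := tanm Hz (in1 Bq) (in2 Bq zs); rewrite critm // => h3.
have := lipL (in3 Bq xs zs) (in2 Bq zs).
have -> : q + x + z - (q + z) = x by zmod.
rewrite ler_norml => /andP[_ h4].
have : 0 <= a * `|x| ^+ 2 by rewrite mulr_ge0 ?exprn_ge0 // ltW.
lra.
Qed.

Lemma amax_half q x : Bs q -> Hp x -> `|x| <= s1 -> `|amax q x| <= s / 2.
Proof.
move=> Bq Hx xs1; have xs := le_trans xs1 s1s.
have h := amax_small Bq Hx xs.
have : a * `|amax q x| ^+ 2 <= a * (s / 2) ^+ 2.
  by apply: le_trans h (le_trans _ s1K); rewrite ler_wpM2l.
by rewrite ler_pM2l // ler_pXn2r ?nnegrE // divr_ge0 // ltW.
Qed.

Lemma amax0 q : Bs q -> amax q 0 = 0.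
Proof.
move=> Bq; have := @amax_small q 0 Bq subp.1; rewrite normr0 mulr0 ltW // => /(_ isT).
rewrite pmulr_rle0 // => h; apply/eqP; rewrite -normr_eq0 -sqrf_eq0.
by rewrite eq_le h exprn_ge0.
Qed.

(** Each maximum point is tested against the other in [amax_strong]. In the sum of the two
    inequalities the values of L cancel up to two Lipschitz errors. *)
Lemma amax_dist q q' x x' : Bs q -> Bs q' -> `|x| <= s -> `|x'| <= s ->
  a * `|amax q' x' - amax q x| ^+ 2 <= K * (`|q' - q| + `|x' - x|).
Proof.
move=> Bq Bq' xs xs'.
have [Hy ys _] := amaxP Bq xs; have [Hy' ys' _] := amaxP Bq' xs'.
have h1 := amax_strong Bq xs Hy' ys'.
have := amax_strong Bq' xs' Hy ys; rewrite distrC => h2.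
have l1 := lipL (in3 Bq xs ys) (in3 Bq' xs' ys).
have l2 := lipL (in3 Bq' xs' ys') (in3 Bq xs ys').
set y := amax q x in h1 h2 l1 l2 *; set y' := amax q' x' in h1 h2 l1 l2 *.
have n1 : `|q + x + y - (q' + x' + y)| <= `|q' - q| + `|x' - x|.
  have -> : q + x + y - (q' + x' + y) = - ((q' - q) + (x' - x)) by zmod.
  by rewrite normrN ler_normD.
have n2 : `|q' + x' + y' - (q + x + y')| <= `|q' - q| + `|x' - x|.
  have -> : q' + x' + y' - (q + x + y') = (q' - q) + (x' - x) by zmod.
  exact: ler_normD.
have m1 := le_trans l1 (ler_wpM2l K0 n1).
have m2 := le_trans l2 (ler_wpM2l K0 n2).
move: m1 m2; rewrite !ler_norml => /andP[_ m1] /andP[_ m2].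
lra.
Qed.

Definition jval (q x : H) : R := L (q + x + amax q x) - L q.

Lemma jval_lip q q' x x' : Bs q -> Bs q' -> `|x| <= s -> `|x'| <= s ->
  L (q + x + amax q x) - L (q' + x' + amax q' x') <= K * (`|q' - q| + `|x' - x|).
Proof.
move=> Bq Bq' xs xs'.
have [Hy ys _] := amaxP Bq xs; have [_ _ h] := amaxP Bq' xs'.
have h1 := h _ Hy ys.
have := lipL (in3 Bq xs ys) (in3 Bq' xs' ys).
have -> : q + x + amax q x - (q' + x' + amax q x) = - ((q' - q) + (x' - x)) by zmod.
rewrite normrN ler_norml => /andP[_ h2].
have := ler_wpM2l K0 (ler_normD (q' - q) (x' - x)); lra.
Qed.

Lemma jval_dist q q' x : Bs q -> Bs q' -> `|x| <= s ->
  `|jval q' x - jval q x| <= 2 * K * `|q' - q|.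
Proof.
move=> Bq Bq' xs.
have := jval_lip Bq Bq' xs xs; have := jval_lip Bq' Bq xs xs.
have := lipL (in1 Bq') (in1 Bq).
rewrite subrr normr0 addr0 (distrC q q') ler_norml => /andP[l1 l2] h1 h2.
rewrite ler_norml /jval; apply/andP; split; lra.
Qed.

(* A supremum over y of functions that are convex in x. *)
Lemma jval_radial q : Bs q -> radial Hp s1 a K (jval q).
Proof.
move=> Bq; split.
- by rewrite /jval amax0 // !addr0 subrr.
- move=> u t Hu us1 t01; have us := le_trans us1 s1s.
  have us' : `|t *: u| <= s.
    case/andP: t01 => t0 t1; rewrite normrZ ger0_norm //.
    by rewrite (le_trans _ us) // ler_piMl.
  have [Hy ys _] := amaxP Bq us'; set y := amax q (t *: u) in Hy ys *.
  have [_ _ hm] := amaxP Bq us.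
  have quy : `|q + y + u| < rho by rewrite addrAC; exact: in3.
  have h1 := cvxp Hu (in2 Bq ys) quy t01.
  have h2 := tanm Hy (in1 Bq) (in2 Bq ys); rewrite critm // in h2.
  have h3 := hm y Hy ys.
  rewrite /jval -/y; rewrite (addrAC q) in h1.
  rewrite (addrAC q u) in h3; move: h1; rewrite (addrAC q y) => h1.
  rewrite (addrAC q y) in h3.
  have a1 : 0 <= a * `|y| ^+ 2 by rewrite mulr_ge0 ?exprn_ge0 // ltW.
  case/andP: t01 => t0 t1.
  have b1 : (1 - t) * L (q + y) <= (1 - t) * L q by rewrite ler_wpM2l ?subr_ge0 //; lra.
  have b2 : t * L (q + u + y) <= t * L (q + u + amax q u) by rewrite ler_wpM2l.
  lra.
- move=> u Hu us1; have us := le_trans us1 s1s.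
  have [_ _ hm] := amaxP Bq us.
  have s00 : `|0 : H| <= s by rewrite normr0 ltW.
  have := hm 0 subm.1 s00; rewrite addr0.
  have := tanp Hu (in1 Bq) (in2 Bq us); rewrite critp // /jval; lra.
- move=> u v _ us1 _ vs1; have us := le_trans us1 s1s; have vs := le_trans vs1 s1s.
  have := jval_lip Bq Bq us vs; have := jval_lip Bq Bq vs us.
  rewrite subrr normr0 add0r (distrC v u) => h1 h2.
  rewrite ler_norml /jval; apply/andP; split; lra.
Qed.

Definition gval (q x v : H) : R :=
  L (q + x + amax q x) - L (q + x + amax q x + v).

Let in_half (y v : H) : `|y| <= s / 2 -> `|v| <= s / 2 -> `|y + v| <= s.
Proof. by move=> h1 h2; rewrite (le_trans (ler_normD _ _)) //; lra. Qed.

(** Concavity of L along H^- is convexity of g in v, whence the scaling inequality; the quadratic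
    lower bound is [amax_strong]. *)
Lemma gval_radial q x : Bs q -> Hp x -> `|x| <= s1 ->
  radial Hm (s / 2) a K (gval q x).
Proof.
move=> Bq Hx xs1; have xs := le_trans xs1 s1s.
have [Hy ys _] := amaxP Bq xs; have yh := amax_half Bq Hx xs1.
set y := amax q x in Hy ys yh *.
have inv' v : `|v| <= s / 2 -> `|q + x + y + v| < rho.
  by move=> vs; rewrite -(addrA _ y); apply: in3 => //; exact: in_half.
split.
- by rewrite /gval addr0 subrr.
- move=> u t Hu us t01.
  have := ccvm Hu (in3 Bq xs ys) (inv' _ us) t01.
  have : 0 <= a * `|u| ^+ 2 * (t * (1 - t)).
    case/andP: t01 => t0 t1.
    by rewrite mulr_ge0 // mulr_ge0 ?subr_ge0 ?exprn_ge0 // ltW.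
  rewrite /gval -/y; lra.
- move=> u Hu us.
  have Hyu : Hm (y + u) by exact: subspaceD.
  have := amax_strong Bq xs Hyu (in_half yh us).
  by rewrite -/y (addrC y) addrK /gval -/y [u + y]addrC addrA; lra.
- move=> u v Hu us Hv vs; rewrite /gval -/y.
  have := lipL (inv' _ us) (inv' _ vs).
  have -> : q + x + y + u - (q + x + y + v) = u - v by zmod.
  by rewrite !ler_norml => /andP[h1 h2]; apply/andP; split; lra.
Qed.

Lemma gval_dist q q' x x' v : Bs q -> Bs q' -> Hp x -> Hp x' ->
  `|x| <= s1 -> `|x'| <= s1 -> Hm v -> `|v| <= s / 2 ->
  `|gval q' x' v - gval q x v| <=
    2 * K * (`|q' - q| + `|x' - x| + `|amax q' x' - amax q x|).
Proof.
move=> Bq Bq' Hx Hx' xs1 xs1' Hv vs.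
have xs := le_trans xs1 s1s; have xs' := le_trans xs1' s1s.
have yh := amax_half Bq Hx xs1; have yh' := amax_half Bq' Hx' xs1'.
have := jval_lip Bq Bq' xs xs'; have := jval_lip Bq' Bq xs' xs.
rewrite (distrC q q') (distrC x x').
set y := amax q x in yh *; set y' := amax q' x' in yh' *.
have i1 : `|q + x + y + v| < rho by rewrite -(addrA _ y); apply: in3 => //; exact: in_half.
have i2 : `|q' + x' + y' + v| < rho by rewrite -(addrA _ y'); apply: in3 => //; exact: in_half.
have := lipL i2 i1.
have -> : q' + x' + y' + v - (q + x + y + v) = (q' - q) + (x' - x) + (y' - y) by zmod.
have n1 := ler_wpM2l K0 (ler_normD (q' - q + (x' - x)) (y' - y)).
have n2 := ler_wpM2l K0 (ler_normD (q' - q) (x' - x)).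
have n3 : 0 <= K * `|y' - y| by rewrite mulr_ge0.
rewrite !ler_norml /gval -/y -/y' => /andP[l1 l2] h1 h2; apply/andP; split; lra.
Qed.

(** [fibp] undoes x |-> sqrt(j(x)) x/|x| at q, and [fibm] undoes v |-> sqrt(g(v)) v/|v| at (q,
    x). *)
Definition fibp (q v : H) : H := radinv Hp s1 (jval q) v.
Definition fibm (q x v : H) : H := radinv Hm (s / 2) (gval q x) v.

Variable eps : R.
Hypotheses (eps0 : 0 < eps) (epsp : eps ^+ 2 <= a * s1 ^+ 2)
  (epsm : eps ^+ 2 <= a * (s / 2) ^+ 2).

Let ltp (v : H) : `|v| < eps -> `|v| ^+ 2 < a * s1 ^+ 2.
Proof.
move=> h; apply: lt_le_trans epsp.
by rewrite ltr_pXn2r // nnegrE // ltW.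
Qed.

Let ltm (v : H) : `|v| < eps -> `|v| ^+ 2 < a * (s / 2) ^+ 2.
Proof.
move=> h; apply: lt_le_trans epsm.
by rewrite ltr_pXn2r // nnegrE // ltW.
Qed.

Let s20 : 0 < s / 2. Proof. by rewrite divr_gt0. Qed.

Lemma fibpP q v : Bs q -> Hp v -> `|v| < eps ->
  [/\ Hp (fibp q v), `|fibp q v| < s1, fibp q v = `|fibp q v| *: dir v,
      jval q (fibp q v) = `|v| ^+ 2 & radmap (jval q) (fibp q v) = v].
Proof.
move=> Bq Hv /ltp vr; have rj := jval_radial Bq.
have [h1 h2 h0 h3] := radinvP subp s10 a0 K0 rj Hv vr.
by split => //; exact: (radinvK subp s10 a0 K0 rj).
Qed.

Lemma fibmP q x v : Bs q -> Hp x -> `|x| <= s1 -> Hm v -> `|v| < eps ->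
  [/\ Hm (fibm q x v), `|fibm q x v| < s / 2, gval q x (fibm q x v) = `|v| ^+ 2 &
      radmap (gval q x) (fibm q x v) = v].
Proof.
move=> Bq Hx xs Hv /ltm vr; have rg := gval_radial Bq Hx xs.
have [h1 h2 _ h3] := radinvP subm s20 a0 K0 rg Hv vr.
by split => //; exact: (radinvK subm s20 a0 K0 rg).
Qed.

Lemma fibpK q x : Bs q -> Hp x -> `|x| <= s1 -> `|radmap (jval q) x| < eps ->
  fibp q (radmap (jval q) x) = x.
Proof.
move=> Bq Hx xs hlt; have rj := jval_radial Bq.
apply: (radmapK subp s10 a0 K0 rj Hx xs).
by rewrite -(radmap_norm a0 rj Hx xs); exact: ltp.
Qed.

Lemma fibmK q x v : Bs q -> Hp x -> `|x| <= s1 -> Hm v -> `|v| <= s / 2 ->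
  `|radmap (gval q x) v| < eps -> fibm q x (radmap (gval q x) v) = v.
Proof.
move=> Bq Hx xs Hv vs hlt; have rg := gval_radial Bq Hx xs.
apply: (radmapK subm s20 a0 K0 rg Hv vs).
by rewrite -(radmap_norm a0 rg Hv vs); exact: ltm.
Qed.

(** The telescoping behind the normal form: the fibre map will choose x and v with j = |u^+|^2 and g
    = |u^-|^2. *)
Lemma fib_value q x v : Bs q -> Hp x -> `|x| <= s1 -> Hm v ->
  L (q + (x + amax q x + v)) = jval q x - gval q x v + L q.
Proof. by move=> Bq Hx xs Hv; rewrite /jval /gval !addrA; ring. Qed.

Section limits.
(** An arbitrary filter, because the limits are later taken at points of H * H, of H and of X *
    X. *)
Variables (T : Type) (F : set_system T).
Hypothesis FF : ProperFilter F.
Variables (q_ : T -> H) (q : H).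
Hypotheses (Bq : Bs q) (Bq_ : \forall t \near F, Bs (q_ t)) (cq : q_ @ F --> q).

Let dist_near (f : T -> H) (l : H) (e : R) : f @ F --> l -> 0 < e ->
  \forall t \near F, `|f t - l| < e.
Proof.
by move=> /cvgrPdist_lt h /h; apply: filterS => t; rewrite distrC.
Qed.

Lemma amax_cvg (x_ : T -> H) (x : H) : `|x| <= s ->
  (\forall t \near F, `|x_ t| <= s) -> x_ @ F --> x ->
  amax (q_ t) (x_ t) @[t --> F] --> amax q x.
Proof.
move=> xs xs_ cx; apply/cvgrPdist_lt => e ep.
have d0 : 0 < a * e ^+ 2 / (2 * K + 1).
  by rewrite divr_gt0 ?mulr_gt0 ?exprn_gt0 // ltr_wpDl // mulr_ge0.
have h1 := dist_near cq d0; have h2 := dist_near cx d0.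
near=> t; rewrite distrC.
have b1 : Bs (q_ t) by near: t.
have b2 : `|x_ t| <= s by near: t.
have b3 : `|q_ t - q| < a * e ^+ 2 / (2 * K + 1) by near: t.
have b4 : `|x_ t - x| < a * e ^+ 2 / (2 * K + 1) by near: t.
rewrite -(@ltr_pXn2r _ 2) ?nnegrE ?(ltW ep) // -(ltr_pM2l a0).
apply: le_lt_trans (amax_dist Bq b1 xs b2) _.
set d := a * e ^+ 2 / (2 * K + 1) in d0 b3 b4 *.
have -> : a * e ^+ 2 = d * (2 * K + 1).
  by rewrite /d mulfVK // gt_eqF // ltr_wpDl // mulr_ge0.
have : K * (`|q_ t - q| + `|x_ t - x|) <= K * (d + d).
  by rewrite ler_wpM2l // lerD // ltW.
lra.
Unshelve. all: by end_near. Qed.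

Lemma fibp_cvg (v_ : T -> H) (v : H) : Hp v -> `|v| < eps ->
  (\forall t \near F, Hp (v_ t) /\ `|v_ t| < eps) -> v_ @ F --> v ->
  fibp (q_ t) (v_ t) @[t --> F] --> fibp q v.
Proof.
move=> Hv ve hv_ cv; apply/cvgrPdist_lt => e ep.
have [d d0 hd] := radinv_cont subp s10 a0 K0 (jval_radial Bq) Hv (ltp ve) ep.
have d1 : 0 < d / (2 * K + 1) by rewrite divr_gt0 // ltr_wpDl // mulr_ge0.
have h1 := dist_near cq d1; have h2 := dist_near cv d0.
near=> t; rewrite distrC.
have b1 : Bs (q_ t) by near: t.
have [b2 b2'] : Hp (v_ t) /\ `|v_ t| < eps by near: t.
have b3 : `|q_ t - q| < d / (2 * K + 1) by near: t.
have b4 : `|v_ t - v| < d by near: t.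
apply: hd => //; [exact: jval_radial|exact: ltp|].
move=> w _ ws; rewrite (le_trans (jval_dist Bq b1 (le_trans ws s1s))) //.
move: b3; rewrite ltr_pdivlMr ?ltr_wpDl ?mulr_ge0 //.
by have := normr_ge0 (q_ t - q); lra.
Unshelve. all: by end_near. Qed.

Let gval_near (x_ : T -> H) (x : H) : Hp x -> `|x| <= s1 ->
  (\forall t \near F, Hp (x_ t) /\ `|x_ t| <= s1) -> x_ @ F --> x ->
  forall d : R, 0 < d -> \forall t \near F,
    forall w, Hm w -> `|w| <= s / 2 -> `|gval (q_ t) (x_ t) w - gval q x w| <= d.
Proof.
move=> Hx xs hx_ cx d d0.
have K21 : 0 < 2 * K + 1 by rewrite ltr_wpDl // mulr_ge0.
have d1 : 0 < d / 3 / (2 * K + 1) by rewrite !divr_gt0.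
have hxs : \forall t \near F, `|x_ t| <= s.
  by apply: filterS hx_ => t [_ h]; exact: le_trans s1s.
have h1 := dist_near cq d1; have h2 := dist_near cx d1.
have h3 := dist_near (amax_cvg (le_trans xs s1s) hxs cx) d1.
near=> t => w Hw ws.
have b1 : Bs (q_ t) by near: t.
have [b2 b2'] : Hp (x_ t) /\ `|x_ t| <= s1 by near: t.
have b3 : `|q_ t - q| < d / 3 / (2 * K + 1) by near: t.
have b4 : `|x_ t - x| < d / 3 / (2 * K + 1) by near: t.
have b5 : `|amax (q_ t) (x_ t) - amax q x| < d / 3 / (2 * K + 1) by near: t.
rewrite (le_trans (gval_dist Bq b1 Hx b2 xs b2' Hw ws)) //.
set c := d / 3 / (2 * K + 1) in d1 b3 b4 b5.
have : 2 * K * (`|q_ t - q| + `|x_ t - x| + `|amax (q_ t) (x_ t) - amax q x|) <= 2 * K * (c + c + c).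
  by rewrite ler_wpM2l ?mulr_ge0 // !lerD // ltW.
have -> : d = 3 * (c * (2 * K + 1)) by rewrite /c mulfVK ?gt_eqF //; field.
lra.
Unshelve. all: by end_near. Qed.

Lemma fibm_cvg (x_ v_ : T -> H) (x v : H) : Hp x -> `|x| <= s1 ->
  (\forall t \near F, Hp (x_ t) /\ `|x_ t| <= s1) -> x_ @ F --> x ->
  Hm v -> `|v| < eps ->
  (\forall t \near F, Hm (v_ t) /\ `|v_ t| < eps) -> v_ @ F --> v ->
  fibm (q_ t) (x_ t) (v_ t) @[t --> F] --> fibm q x v.
Proof.
move=> Hx xs hx_ cx Hv ve hv_ cv; apply/cvgrPdist_lt => e ep.
have [d d0 hd] := radinv_cont subm s20 a0 K0 (gval_radial Bq Hx xs) Hv (ltm ve) ep.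
have h1 := gval_near Hx xs hx_ cx d0; have h2 := dist_near cv d0.
near=> t; rewrite distrC.
have b1 : Bs (q_ t) by near: t.
have [b2 b2'] : Hm (v_ t) /\ `|v_ t| < eps by near: t.
have [b3 b3'] : Hp (x_ t) /\ `|x_ t| <= s1 by near: t.
apply: hd => //; [exact: gval_radial|exact: ltm|by near: t|by near: t].
Unshelve. all: by end_near. Qed.

Lemma radp_cvg (x_ : T -> H) (x : H) : Hp x -> `|x| <= s1 ->
  (\forall t \near F, Hp (x_ t) /\ `|x_ t| <= s1) -> x_ @ F --> x ->
  radmap (jval (q_ t)) (x_ t) @[t --> F] --> radmap (jval q) x.
Proof.
move=> Hx xs hx_ cx; apply/cvgrPdist_lt => e ep.
have [d d0 hd] := radmap_cont a0 K0 (jval_radial Bq) Hx xs ep.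
have d1 : 0 < d / (2 * K + 1) by rewrite divr_gt0 // ltr_wpDl // mulr_ge0.
have h1 := dist_near cq d1; have h2 := dist_near cx d0.
near=> t; rewrite distrC.
have b1 : Bs (q_ t) by near: t.
have [b2 b2'] : Hp (x_ t) /\ `|x_ t| <= s1 by near: t.
have b3 : `|q_ t - q| < d / (2 * K + 1) by near: t.
apply: hd => //; [exact: jval_radial| |by near: t].
move=> w _ ws; rewrite (le_trans (jval_dist Bq b1 (le_trans ws s1s))) //.
move: b3; rewrite ltr_pdivlMr ?ltr_wpDl ?mulr_ge0 //.
by have := normr_ge0 (q_ t - q); lra.
Unshelve. all: by end_near. Qed.

Lemma radm_cvg (x_ v_ : T -> H) (x v : H) : Hp x -> `|x| <= s1 ->
  (\forall t \near F, Hp (x_ t) /\ `|x_ t| <= s1) -> x_ @ F --> x ->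
  Hm v -> `|v| <= s / 2 ->
  (\forall t \near F, Hm (v_ t) /\ `|v_ t| <= s / 2) -> v_ @ F --> v ->
  radmap (gval (q_ t) (x_ t)) (v_ t) @[t --> F] --> radmap (gval q x) v.
Proof.
move=> Hx xs hx_ cx Hv vs hv_ cv; apply/cvgrPdist_lt => e ep.
have [d d0 hd] := radmap_cont a0 K0 (gval_radial Bq Hx xs) Hv vs ep.
have h1 := gval_near Hx xs hx_ cx d0; have h2 := dist_near cv d0.
near=> t; rewrite distrC.
have b1 : Bs (q_ t) by near: t.
have [b2 b2'] : Hm (v_ t) /\ `|v_ t| <= s / 2 by near: t.
have [b3 b3'] : Hp (x_ t) /\ `|x_ t| <= s1 by near: t.
apply: hd => //; [exact: gval_radial|by near: t|by near: t].
Unshelve. all: by end_near. Qed.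

End limits.

End fiber.

(** * Data of the reduction; homeomorphisms and Frechet derivatives *)

Lemma opnorm_ge0 (R : realType) (E F : normedModType R) (S : set E) (T : E -> F) :
  0 <= opnorm S T.
Proof.
rewrite /opnorm; set Z := [set _ | _ in _].
have [hs|hs] := pselect (has_sup Z); last by rewrite sup_out.
have [[r [u hu ur]] _] := hs.
by rewrite (le_trans (normr_ge0 (T u))) // sup_upper_bound //; exists u.
Qed.

(** The equation (I - P^0) y = 0 is written as P^0 y = y, and P^0 as an expansion, with [toX i]
    where its value is needed in X. [h] takes any w in H and depends on P^0 w alone. Solutions have
    norm at most R1/2 but are unique up to R1; this gap yields uniqueness among continuous maps
    without a bound. [rd_size] keeps z + h(z) within rho/2. *)
Record reduction_data (R : realType) (H X : normedModType R)
    (ip : {dot H for idfun}) (i : {linear X -> H}) (A : X -> X) (B0 : H -> H)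
    (e0 : seq H) (rho r0 R1 Kh : R) (h : H -> X) : Prop := {
  rd_r0 : 0 < r0 ;
  rd_R1 : 0 < R1 ;
  rd_Kh : 0 <= Kh ;
  rd_size : r0 + R1 <= rho / 2 ;
  rd_pm : forall w, `|expand ip e0 id w| < r0 -> Xpm ip i B0 (h w) ;
  rd_le : forall w, `|expand ip e0 id w| < r0 -> `|h w| <= R1 / 2 ;
  rd_sol : forall w, `|expand ip e0 id w| < r0 ->
    let y := i (A (expand ip e0 (toX i) w + h w)) in expand ip e0 id y = y ;
  rd_uniq : forall w x, `|expand ip e0 id w| < r0 -> Xpm ip i B0 x -> `|x| < R1 ->
    (let y := i (A (expand ip e0 (toX i) w + x)) in expand ip e0 id y = y) -> x = h w ;
  rd_lip : forall w w', `|expand ip e0 id w| < r0 -> `|expand ip e0 id w'| < r0 ->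
    `|h w - h w'| <= Kh * `|expand ip e0 id w - expand ip e0 id w'|
}.

Lemma homeo_on_image (T U : topologicalType) (D : set T) (f : T -> U) (g : U -> T) :
  (forall x, D x -> g (f x) = x) -> {within D, continuous f} ->
  (forall x, D x -> {for f x, continuous g}) -> homeo_on D (f @` D) f.
Proof.
move=> gf cf cg; split; last first.
  split => //; exists g; split => //.
  by apply: continuous_in_subspaceT => y; rewrite inE => -[x Dx <-]; exact: cg.
split.
- by move=> x Dx; exists x.
- move=> x y; rewrite !inE => Dx Dy fxy.
  by rewrite -(gf x Dx) -(gf y Dy) fxy.
- by move=> y [x Dx <-]; exists x.
Qed.

Lemma is_fderive_in_is_derive (R : realType) (E : normedModType R) (S : set E)
    (f : E -> R) (z u : E) (l : E -> R) :
  is_subspace S -> is_fderive_in S f z l -> S u -> is_derive z u f (l u).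
Proof.
move=> subS [lin [_ fd]] Su; apply/is_derive_distP => e e0.
have u1 : 0 < `|u| + 1 by rewrite ltr_wpDl.
have [d d0 hd] := fd (e / (`|u| + 1)) (divr_gt0 e0 u1).
exists (d / (`|u| + 1)); first exact: divr_gt0.
move=> t t0; rewrite ltr_pdivlMr // => td.
have tn : 0 < `|t| by rewrite normr_gt0.
have lt : l (t *: u) = t * l u.
  have l0 : l 0 = 0.
    by have := lin 1 0 0 subS.1 subS.1; rewrite scaler0 addr0 mul1r; lra.
  by have := lin t u 0 Su subS.1; rewrite !addr0 l0 addr0.
have := hd (t *: u) (subspaceZ t subS Su); rewrite normrZ => /(_ _).
rewrite lt (le_lt_trans _ td) ?ler_pM2l ?lerDl // => /(_ isT) k.
have -> : t^-1 *: (f (t *: u + z) - f z) - l u = t^-1 * (f (z + t *: u) - f z - t * l u).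
  by rewrite mulrBr mulKf // (addrC z).
rewrite normrM normfV -(ltr_pM2l tn) mulVKf ?gt_eqF //.
apply: le_lt_trans k _; rewrite mulrCA ltr_pM2l // mulrAC ltr_pdivrMr // ltr_pM2l //.
by rewrite ltrDl.
Qed.

(** * Structure of B(0): coercivity, surjectivity, finite dimension of H^- *)

Section admissible.
Variables (R : realType) (H X : completeNormedModType R)
  (ip : {dot H for idfun}) (i : {linear X -> H}) (V : set H) (L : H -> R)
  (A : X -> X) (B P Q : X -> {linear H -> H}).
Hypothesis wa : weakly_admissible ip i V L A B P Q.
Variables (Hp Hm : set H).
Hypothesis spl : definite_splitting ip (B 0) Hp Hm.

Let B0 : {linear H -> H} := B 0.
Let H0 : set H := kerop B0.
Let nrm := wa_hilbert wa.

Let iB a b : i (a - b) = i a - i b. Proof. exact: linearB. Qed.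
Let iD a b : i (a + b) = i a + i b. Proof. exact: linearD. Qed.
Let iZ k a : i (k *: a) = k *: i a. Proof. exact: linearZ. Qed.

Let subX : is_subspace (Xpm ip i B0).
Proof.
have [s0 sl] := orth_subspace ip H0; split; first by rewrite /Xpm /= linear0.
by move=> a u v hu hv; rewrite /Xpm /= linearP; exact: sl.
Qed.

Lemma V_i0 : V (i 0).
Proof. by rewrite linear0; exact: wa_V0 wa. Qed.

Lemma B0_sym u v : ip (B0 u) v = ip u (B0 v).
Proof. by have [_] := wa_F3_sa wa V_i0; exact. Qed.

Lemma B0_continuous : continuous B0.
Proof. by have [] := wa_F3_sa wa V_i0. Qed.

Lemma i_continuous : continuous i.
Proof.
move=> x; apply/continuous_at_distP => e e0; exists e => // y xy.
by rewrite -linearB (le_lt_trans (wa_norm_le wa _)).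
Qed.

Lemma kerop_subspace : is_subspace H0.
Proof.
split; first by rewrite /H0 /kerop /= linear0.
by rewrite /H0 /kerop /= => a u v hu hv; rewrite linearP hu hv scaler0 addr0.
Qed.

Lemma B0_orth u : orth ip H0 (B0 u).
Proof. by move=> v hv; rewrite B0_sym hv ip0r. Qed.

Lemma ker_orth_eq0 u : H0 u -> orth ip H0 u -> u = 0.
Proof. by move=> h0 /(_ u h0); exact: ip_eq0. Qed.

Lemma B0_ker_range u : H0 u -> range i u.
Proof.
move=> hu; apply: (wa_C2 wa); rewrite -/B0 hu.
by exists 0 => //; rewrite linear0.
Qed.

Lemma near_range u (e : R) : 0 < e -> exists x, `|i x - u| < e.
Proof.
move=> e0; have := wa_dense wa (O := ball u e).
case; [by exists u; exact: ballxx|exact: ball_open|].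
move=> z [hb [x _ xE]]; exists x; move: hb; rewrite -xE -ball_normE /=.
by rewrite distrC.
Qed.

Lemma range_perp u : (forall x, ip u (i x) = 0) -> u = 0.
Proof.
move=> hu; apply/eqP; rewrite -normr_eq0 eq_le normr_ge0 andbT.
apply/ler_addgt0Pr => e e0; rewrite add0r.
apply: (norm_le_ip nrm (ltW e0)) => v.
apply/ler_addgt0Pr => d d0.
have [x hx] := @near_range v (d / (`|u| + 1)) (divr_gt0 d0 (ltr_wpDl (normr_ge0 _) ltr01)).
have -> : ip u v = ip u (v - i x) by rewrite ipBr hu subr0.
rewrite (le_trans (ip_le nrm _ _)) //.
move: hx; rewrite ltr_pdivlMr ?ltr_wpDl // distrC mulrDr mulr1 => hx.
have := normr_ge0 (v - i x); have : 0 <= e * `|v| by rewrite mulr_ge0 // ltW.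
by rewrite mulrC; lra.
Qed.

(** (F3) compares both sides against vectors of X only; density of X removes the test vector. *)
Lemma i_derive x u : V (i x) -> i ('D_u A x) = B x (i u).
Proof.
move=> Vx; apply/eqP; rewrite -subr_eq0; apply/eqP/range_perp => v.
by rewrite ipBl (wa_F3 wa) // subrr.
Qed.

(** Criticality makes A(0) orthogonal to X, which is dense. *)
Lemma A0_eq0 : A 0 = 0.
Proof.
apply: (wa_inj wa); rewrite linear0; apply: range_perp => u.
rewrite -(wa_F2_grad wa) ?V_i0 //.
have [_ /(_ u Logic.I) hu] := wa_C1_crit wa.
  by have /is_derive_comp_linear[_ ->] := hu.
exact: V_i0.
Qed.

Lemma Hp_orth u : Hp u <-> orth ip H0 u /\ orth ip Hm u.
Proof.
split=> [hu|[h0 hm]].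
  by split; [exact: ds_orth0p spl _ hu|exact: ds_orthpm spl _ hu].
have [u0 [up [um [k0 hp hm' uE]]]] := ds_sum spl u.
have pm : ip up um = 0 by apply: (ds_orthpm spl).
have p0 : ip up u0 = 0 by apply: (ds_orth0p spl).
have m0 : ip um u0 = 0 by apply: (ds_orth0m spl).
have u00 : u0 = 0.
  apply: (ip_eq0 nrm); have := h0 _ k0; rewrite uE !ipDl p0 m0; lra.
have um0 : um = 0.
  apply: (ip_eq0 nrm); have := hm _ hm'; rewrite uE !ipDl pm (ipC _ u0) m0; lra.
by rewrite uE u00 um0 add0r addr0.
Qed.

Lemma Hm_orth u : Hm u <-> orth ip H0 u /\ orth ip Hp u.
Proof.
split=> [hu|[h0 hp]].
  split; first exact: ds_orth0m spl _ hu.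
  by move=> v hv; rewrite ipC; exact: (ds_orthpm spl).
have [u0 [up [um [k0 hp' hm uE]]]] := ds_sum spl u.
have pm : ip up um = 0 by apply: (ds_orthpm spl).
have p0 : ip up u0 = 0 by apply: (ds_orth0p spl).
have m0 : ip um u0 = 0 by apply: (ds_orth0m spl).
have u00 : u0 = 0.
  apply: (ip_eq0 nrm); have := h0 _ k0; rewrite uE !ipDl p0 m0; lra.
have up0 : up = 0.
  apply: (ip_eq0 nrm); have := hp _ hp'; rewrite uE !ipDl (ipC _ u0) (ipC _ um) p0 pm; lra.
by rewrite uE u00 up0 !add0r.
Qed.

Lemma closed_Hm : closed Hm.
Proof.
have -> : Hm = orth ip H0 `&` orth ip Hp.
  by apply/seteqP; split => u /Hm_orth.
by apply: closedI; exact: closed_orth.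
Qed.

(** (D4) for the constant sequence 0. *)
Lemma P0_coercive : exists2 C0 : R, 0 < C0 & forall u, C0 * `|u| ^+ 2 <= ip (P 0 u) u.
Proof.
have [||C0 [n0 [C00 h]]] := wa_D4 wa (x_ := fun=> 0).
- by move=> _; exact: V_i0.
- by rewrite linear0 normr0; exact: cvg_cst.
by exists C0 => // u; exact: h.
Qed.

(** Otherwise there are unit vectors orthogonal to the kernel with B(0) u_n tending to 0.
    Compactness of Q(0) gives a subsequence along which Q(0) u_n converges, and coercivity of P(0) =
    B(0) - Q(0) makes it Cauchy. Its limit is a unit vector both in the kernel and orthogonal to
    it. *)
Lemma B0_bounded_below : exists2 c : R, 0 < c &
  forall u, orth ip H0 u -> c * `|u| <= `|B0 u|.
Proof.
apply: contrapT => N.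
have [C0 C00 hP] := P0_coercive.
have [M M0 hM] := continuous_linear_bound B0_continuous.
have [r [r0 r_le small]] : exists r : nat -> R, [/\ forall n, 0 < r n,
    forall k n, (n <= k)%N -> r k <= r n & forall e : R, 0 < e -> exists n, r n < e].
  exists (fun n => n.+1%:R^-1); split=> [n|k n nk|e e0].
  - by rewrite invr_gt0.
  - by rewrite lef_pV2 ?posrE // ler_nat ltnS.
  have [n _ hn] := near_infty_natSinv_lt (PosNum e0).
  by exists n; exact: hn n (leqnn n).
have ex n : exists u, [/\ orth ip H0 u, `|u| = 1 & `|B0 u| < r n].
  apply: contrapT => hn; apply: N; exists (r n) => // u hu.
  have [->|u0] := eqVneq u 0; first by rewrite normr0 mulr0.
  rewrite leNgt; apply/negP => hlt; apply: hn; exists (dir u); split.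
  - exact: subspaceZ (orth_subspace _ _) hu.
  - exact: norm_dir.
  rewrite /dir linearZ /= normrZ normfV normr_id mulrC.
  by rewrite ltr_pdivrMr // normr_gt0.
have /choice[u_ hu] := ex.
have : compact_operator (Q 0) := wa_D_compact wa V_i0.
rewrite /compact_operator precompactE => cK.
have [|w [_ cw]] := cK (Q 0 (u_ n) @[n --> \oo]) _.
  exists 0%N => // n _; apply: subset_closure; exists (u_ n) => //=.
  by have [_ -> _] := hu n.
have sub k : exists n, (k <= n)%N /\ `|Q 0 (u_ n) - w| < r k.
  have [||_ [[n kn <-]]] := cw ((Q 0 \o u_) @` [set n | (k <= n)%N]) (ball w (r k)).
  - by exists k => // n /= kn; exists n.
  - by apply: nbhsx_ballx.
  by rewrite -ball_normE /= distrC => hb; exists n.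
have /choice[s hs] := sub.
pose v k := u_ (s k).
have vorth k : orth ip H0 (v k) by have [] := hu (s k).
have v1 k : `|v k| = 1 by have [] := hu (s k).
have vB k : `|B0 (v k)| < r k.
  have [_ _ h] := hu (s k); apply: lt_le_trans h _.
  by apply: r_le; have [] := hs k.
have vQ k : `|Q 0 (v k) - w| < r k by have [] := hs k.
have vdist n k l : (n <= k)%N -> (n <= l)%N -> C0 * `|v k - v l| <= 4 * r n.
  move=> nk nl; have [->|kl] := eqVneq (v k) (v l).
    by rewrite subrr normr0 mulr0 mulr_ge0 // ltW.
  have d0 : 0 < `|v k - v l| by rewrite normr_gt0 subr_eq0.
  have := hP (v k - v l).
  move=> /le_trans/(_ (ip_le nrm _ _)); rewrite expr2 mulrA ler_pM2r // => /le_trans; apply.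
  have -> : P 0 (v k - v l) = (B0 (v k) - B0 (v l)) - ((Q 0 (v k) - w) - (Q 0 (v l) - w)).
    have := wa_D wa (v k - v l) V_i0; rewrite -/B0 => hB.
    have -> : P 0 (v k - v l) = B0 (v k - v l) - Q 0 (v k - v l) by rewrite hB addrK.
    by rewrite !linearB /=; zmod.
  rewrite (le_trans (ler_normB _ _)) //.
  have := ler_normB (B0 (v k)) (B0 (v l)).
  have := ler_normB (Q 0 (v k) - w) (Q 0 (v l) - w).
  have := vB k; have := vB l; have := vQ k; have := vQ l.
  have := r_le _ _ nk; have := r_le _ _ nl; lra.
have /cauchy_dist_cvg : forall e : R, 0 < e -> exists N, forall k l, (N <= k)%N ->
    (N <= l)%N -> `|v k - v l| < e.
  move=> e e0; have [|n hn] := small (C0 * e / 4); first by rewrite divr_gt0 // mulr_gt0.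
  exists n => k l nk nl; have := vdist _ _ _ nk nl; rewrite -(ltr_pM2l C00); lra.
set l := limn v => cl.
have l1 : `|l| = 1.
  apply: (cvg_unique _ (cvg_norm cl)) => //.
  by have -> : (fun k => `|v k|) = cst 1; [apply/funext => k; exact: v1|exact: cvg_cst].
have lorth : orth ip H0 l.
  apply: (@closed_cvg _ _ _ eventually_filter v (orth ip H0)) cl; first exact: closed_orth.
  exact: nearW vorth.
have lker : H0 l.
  have h1 : B0 (v k) @[k --> \oo] --> B0 l by apply: (cvg_comp v B0 cl); exact: B0_continuous.
  apply: (cvg_unique _ h1) => //; apply/cvgrPdist_lt => e e0; have [n hn] := small e e0.
  exists n => // k /= nk; rewrite sub0r normrN.
  exact: lt_trans (vB k) (le_lt_trans (r_le _ _ nk) hn).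
have := ker_orth_eq0 lker lorth => l0.
by move: l1; rewrite l0 normr0 => /esym/eqP; rewrite oner_eq0.
Qed.

(** On H^+ the form is nonnegative, so [form_ge0_norm] gives |B(0)u|^2 <= M (B(0)u, u), while
    |B(0)u| >= c|u|; hence the constant c^2/M. On H^- the same applies to -B(0). *)
Lemma B0_coercive : exists2 a : R, 0 < a &
  (forall u, Hp u -> a * `|u| ^+ 2 <= ip (B0 u) u) /\
  (forall u, Hm u -> a * `|u| ^+ 2 <= - ip (B0 u) u).
Proof.
have [c c0 hc] := B0_bounded_below.
have [M M0 hM] := continuous_linear_bound B0_continuous.
exists (c ^+ 2 / M); first by rewrite divr_gt0 // exprn_gt0.
have key u (q : R) : orth ip H0 u -> `|B0 u| ^+ 2 <= M * q -> c ^+ 2 / M * `|u| ^+ 2 <= q.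
  move=> hu hq; rewrite mulrAC ler_pdivrMr // mulrC (mulrC q) (le_trans _ hq) //.
  by rewrite mulrC -exprMn ler_pXn2r ?nnegrE ?mulr_ge0 ?(ltW c0) // hc.
split=> u hu.
  apply: key; first exact: ds_orth0p spl _ hu.
  apply: (form_ge0_norm nrm (ds_subp spl)) => //.
  - by move=> *; exact: linearP.
  - exact: B0_sym.
  - exact: ds_invp spl.
  move=> w hw; have [->|w0] := eqVneq w 0; first by rewrite ip0r.
  exact: ltW (ds_pos spl hw w0).
apply: key; first exact: ds_orth0m spl _ hu.
have := @form_ge0_norm _ _ ip nrm _ (fun u => - B0 u) M (ds_subm spl).
rewrite /= => H1; have := H1 _ _ M0 _ _ _ _ hu; rewrite normrN ipNl; apply.
- by move=> a w z; rewrite linearP opprD scalerN.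
- by move=> w z; rewrite ipNl ipNr B0_sym.
- by move=> w; rewrite normrN.
- move=> w hw; rewrite -scaleN1r; apply: subspaceZ (ds_subm spl) _.
  exact: ds_invm spl _ hw.
move=> w hw; have [->|w0] := eqVneq w 0; first by rewrite ip0r.
by rewrite ipNl oppr_ge0 ltW // (ds_neg spl hw w0).
Qed.

(* w - B0^2 w / M^2 is a contraction on the orthogonal complement of the kernel. *)
Lemma B0_surj y : orth ip H0 y -> exists2 u, orth ip H0 u & B0 u = y.
Proof.
move=> hy.
have [c c0 hc] := B0_bounded_below.
have [M1 M10 hM1] := continuous_linear_bound B0_continuous.
(* Adding c makes M > c, so that 1 - c^2/M^2 below is nonnegative. *)
pose M := M1 + c; have M0 : 0 < M by rewrite addr_gt0.
have hM u : `|B0 u| <= M * `|u|.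
  by rewrite (le_trans (hM1 u)) // ler_wpM2r // lerDl ltW.
pose t := (M ^+ 2)^-1.
have t0 : 0 < t by rewrite invr_gt0 exprn_gt0.
have subo := orth_subspace ip H0.
pose f u := u - t *: (B0 (B0 u) - B0 y).
(* In |w|^2 - 2t |B(0)w|^2 + t^2 |B(0)^2 w|^2 the last term is at most t |B(0)w|^2 as t = 1/M^2, and
   |B(0)w| >= c|w|; hence [q2] bounds the squared contraction ratio. *)
pose q2 := 1 - c ^+ 2 * t.
have q20 : 0 <= q2.
  rewrite subr_ge0 /t ler_pdivrMr ?exprn_gt0 // mul1r ler_pXn2r ?nnegrE ?ltW //.
  by rewrite /M ltrDr.
have q21 : q2 < 1 by rewrite ltrBlDr ltrDl mulr_gt0 // exprn_gt0.
have [||||||x [hx fx]] := @contraction_fixpoint R H (orth ip H0) f (Num.sqrt q2).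
- exact: closed_orth.
- by exists 0; exact: subo.1.
- exact: sqrtr_ge0.
- by rewrite -sqrtr1 ltr_sqrt.
- move=> u hu; rewrite /f; apply: (subspaceB subo) => //; apply: (subspaceZ _ subo).
  by apply: (subspaceB subo); exact: B0_orth.
- move=> u v hu hv; have -> : f u - f v = (u - v) - t *: B0 (B0 (u - v)).
    rewrite /f !linearB /=; zmod.
  move: (u - v) (subspaceB subo hu hv) => w hw.
  rewrite -(@ler_pXn2r _ 2) ?nnegrE ?mulr_ge0 ?sqrtr_ge0 // exprMn sqr_sqrtr //.
  have e1 : ip w (B0 (B0 w)) = `|B0 w| ^+ 2 by rewrite -B0_sym -nrm.
  have e2 : ip (B0 (B0 w)) w = `|B0 w| ^+ 2 by rewrite ipC.
  rewrite nrm !(ipBl, ipBr, ipZl, ipZr) e1 e2 -!nrm.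
  have h1 := hc _ hw; have h2 := hM (B0 w).
  have h1' : c ^+ 2 * `|w| ^+ 2 <= `|B0 w| ^+ 2.
    by rewrite -exprMn ler_pXn2r ?nnegrE ?mulr_ge0 ?(ltW c0).
  have h2' : t * `|B0 (B0 w)| ^+ 2 <= `|B0 w| ^+ 2.
    rewrite /t ler_pdivrMl ?exprn_gt0 // -exprMn.
    by rewrite ler_pXn2r ?nnegrE ?mulr_ge0 ?(ltW M0).
  rewrite /q2; move: (`|B0 (B0 w)| ^+ 2) (`|B0 w| ^+ 2) (`|w| ^+ 2) h1' h2' => a b d h1' h2'.
  have : t * (c ^+ 2 * d) <= t * b by rewrite ler_wpM2l // ltW.
  have : t * (t * a) <= t * b by rewrite ler_wpM2l // ltW.
  lra.
exists x => //; apply/eqP; rewrite -subr_eq0; apply/eqP.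
apply: ker_orth_eq0; last by apply: (subspaceB subo) => //; exact: B0_orth.
rewrite /H0 /kerop /= linearB /=.
move: fx; rewrite /f => /eqP; rewrite -subr_eq0 addrAC subrr add0r oppr_eq0.
by rewrite scaler_eq0 gt_eqF //= => /eqP.
Qed.

Lemma B0_inj u v : orth ip H0 u -> orth ip H0 v -> B0 u = B0 v -> u = v.
Proof.
move=> hu hv uv; apply/eqP; rewrite -subr_eq0; apply/eqP.
apply: ker_orth_eq0; last exact: subspaceB (orth_subspace _ _) hu hv.
by rewrite /H0 /kerop /= linearB /= uv subrr.
Qed.

(* On Hm the compact part of B0 is bounded away from 0, so that no nonzero vector of
   Hm is orthogonal to a fine enough net of Q 0 (unit ball). *)
Lemma Hm_finite : exists e, hilbert_basis ip Hm e.
Proof.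
have [C0 C00 hP] := P0_coercive.
have [ys net] := compact_operator_net (wa_D_compact wa V_i0) C00.
have proj y : exists p, Hm p /\ forall g, Hm g -> ip g y = ip g p.
  have [u0 [up [um [k0 hp hm ->]]]] := ds_sum spl y.
  exists um; split => // g hg; rewrite !ipDr.
  rewrite (ds_orth0m spl hg k0) (ipC _ g up) (ds_orthpm spl hp hg); lra.
have /choice[p hp] := proj.
have [||||x|e [oe eS es]] := @gram_schmidt R H Hm ip (ds_subm spl) _ _ _ _ (map p ys).
- by move=> *; exact: ipDl.
- by move=> *; exact: ipZl.
- by move=> *; exact: ipC.
- by move=> u _ u0; rewrite -nrm exprn_gt0 // normr_gt0.
- by case/mapP => y _ ->; have [] := hp y.
exists e; split => // u hu; apply/eqP; rewrite -subr_eq0 -opprB oppr_eq0; apply/eqP.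
set g := u - _.
have hg : Hm g.
  by apply: subspaceB (ds_subm spl) hu _; exact: expand_sub (ds_subm spl) eS.
have ge y : y \in e -> ip g y = 0 by exact: expand_perp.
have gys y : y \in ys -> ip g y = 0.
  move=> yys; have [_ ->] := hp y => //.
  rewrite (es (p y)) ?map_f // ip_sumr big_seq big1 // => z ze.
  by rewrite ipZr ge // mulr0.
have [//|g0] := eqVneq g 0.
have := ds_neg spl hg g0; rewrite -/B0.
have -> : B0 g = P 0 g + Q 0 g by apply: (wa_D wa); exact: V_i0.
rewrite ipDl => hlt.
have := net_small nrm net gys; have := hP g.
rewrite ler_norml => h1 /andP[h2 _].
exfalso; lra.
Qed.

(** The vectors of H^- orthogonal to the eigenvectors in [l] form an invariant subspace, whose unit
    sphere is compact. At a minimum point of (B(0)u, u) with value m, the form of B(0) - m is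
    nonnegative and vanishes, so [form_ge0_vanish] makes the point an eigenvector. *)
Lemma Hm_eigenvector (l : seq H) (t : H) :
  (forall y, y \in l -> Hm y /\ exists m : R, B0 y = m *: y) ->
  Hm t -> (forall y, y \in l -> ip t y = 0) -> t != 0 ->
  exists u, [/\ Hm u, forall y, y \in l -> ip u y = 0, `|u| = 1 &
    exists2 m : R, m < 0 & B0 u = m *: u].
Proof.
move=> hl ht tl t0.
have [e [oe eS es]] := Hm_finite.
have [M M0 hM] := continuous_linear_bound B0_continuous.
pose T := Hm `&` orth ip [set y | y \in l].
have subT : is_subspace T.
  split; first by split; [exact: (ds_subm spl).1|exact: (orth_subspace _ _).1].
  move=> a u v [u1 u2] [v1 v2]; split; first exact: (ds_subm spl).2.
  exact: (orth_subspace _ _).2.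
have TB u : T u -> T (B0 u).
  move=> [hu ul]; split; first exact: ds_invm spl _ hu.
  by move=> y /= yl; have [_ [m my]] := hl y yl; rewrite B0_sym my ipZr ul // mulr0.
pose K := T `&` [set u | `|u| = 1].
have cK : closed K.
  apply: closedI; first by apply: closedI; [exact: closed_Hm|exact: closed_orth].
  apply: (@closed_comp _ _ (fun x : H => `|x|) [set 1]); last exact: closed_eq.
  by move=> ? _; exact: norm_continuous.
have compK : compact K.
  apply: (compact_in_span nrm oe (r := 1) cK) => u [[hu _] /= ->].
  by rewrite es.
have [||u0 u0K hmin] := @compact_EVT_min H R (fun u => ip (B0 u) u) K _ compK.
- exists (dir t); split; last exact: norm_dir.
  by apply: subspaceZ.
- apply/within_continuous_distP => u [_ /= u1] d d0.
  exists (d / (2 * M)); first by rewrite divr_gt0 // mulr_gt0.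
  move=> v [_ /= v1]; rewrite ltr_pdivlMr ?mulr_gt0 //.
  have -> : ip (B0 v) v - ip (B0 u) u = ip (B0 (v - u)) (v + u).
    have sy : ip (B0 v) u = ip (B0 u) v by rewrite B0_sym ipC.
    rewrite linearB /= ipBl !ipDr sy; lra.
  apply: le_lt_trans; rewrite (le_trans (cauchy_schwarz nrm _ _)) //.
  have h1 := hM (v - u).
  have h2 : `|v + u| <= 2 by rewrite (le_trans (ler_normD _ _)) // u1 v1; lra.
  rewrite (le_trans (ler_pM _ _ h1 h2)) //.
  by have := normr_ge0 (v - u); lra.
have [Tu0 /= nu0] : K u0 by move: u0K; rewrite inE.
pose m := ip (B0 u0) u0.
have q_ge v : T v -> m * ip v v <= ip (B0 v) v.
  move=> Tv; have [->|v0] := eqVneq v 0; first by rewrite !ip0r mulr0.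
  have nv : 0 < `|v| by rewrite normr_gt0.
  have [w vE Kw] : exists2 w, v = `|v| *: w & w \in K.
    exists (dir v); first by rewrite dirK.
    by rewrite inE; split; [exact: subspaceZ|exact: norm_dir].
  have h : m <= ip (B0 w) w := hmin _ Kw.
  have -> : ip (B0 v) v = `|v| ^+ 2 * ip (B0 w) w.
    have -> : B0 v = `|v| *: B0 w by rewrite {1}vE linearZ.
    by rewrite ipZl {2}vE ipZr mulrA -expr2.
  by rewrite -nrm mulrC ler_wpM2l // exprn_ge0.
have van w : T w -> ip (B0 u0) w - m * ip u0 w = 0.
  move=> Tw; apply: (@form_ge0_vanish R H (fun u w => ip (B0 u) w - m * ip u w) u0 w) => s.
  have := q_ge (s *: w + u0) (subT.2 _ _ _ Tw Tu0).
  have e1 : B0 (s *: w + u0) = s *: B0 w + B0 u0 by exact: linearP.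
  have e2 : ip (B0 w) u0 = ip (B0 u0) w by rewrite B0_sym ipC.
  have e3 : ip u0 u0 = 1 by rewrite -nrm nu0 expr1n.
  rewrite e1 !(ipDl, ipDr, ipZl, ipZr) e2 e3 -/m (ipC _ w u0).
  lra.
have Bu0 : B0 u0 = m *: u0.
  apply/eqP; rewrite -subr_eq0; apply/eqP/(ip_eq0 nrm).
  rewrite [LHS]ipBl ipZl van //.
  by apply: subspaceB => //; [exact: TB|exact: subspaceZ].
have u00 : u0 != 0 by rewrite -normr_eq0 nu0 oner_eq0.
exists u0; case: Tu0 => h1 h2; split => //.
by exists m => //; exact: (ds_neg spl h1 u00).
Qed.

(** For u in H^- outside X, the residual of u with respect to any list of vectors of X is nonzero,
    so [Hm_eigenvector] supplies one more eigenvector, which lies in X by (D1). The orthonormal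
    lists so obtained are arbitrarily long, against finite dimension. *)
Lemma Hm_range u : Hm u -> range i u.
Proof.
move=> hu; apply: contrapT => nu.
have [e [oe eS es]] := Hm_finite.
have ex k : exists l : seq H, [/\ size l = k, orthonormal_seq ip l &
    forall y, y \in l -> [/\ Hm y, range i y & exists m : R, B0 y = m *: y]].
  elim: k => [|k [l [sl ol hl]]]; first by exists [::].
  pose t := u - expand ip l id u.
  have ht : Hm t.
    apply: subspaceB (ds_subm spl) hu _; apply: expand_sub (ds_subm spl) _.
    by move=> y /hl[].
  have tl y : y \in l -> ip t y = 0 by exact: expand_perp.
  have t0 : t != 0.
    apply/eqP => t0; apply: nu.
    have -> : u = expand ip l id u by apply/eqP; rewrite -subr_eq0 -/t t0.
    by apply: expand_sub (range_subspace i) _ => y /hl[].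
  have hl' y : y \in l -> Hm y /\ exists m : R, B0 y = m *: y by move=> /hl[].
  have [v [hv vl v1 [m m0 vm]]] := Hm_eigenvector hl' ht tl t0.
  exists (v :: l); split; first by rewrite /= sl.
    have vin : v \notin l.
      apply/negP => /vl; rewrite -nrm v1 expr1n => /eqP; by rewrite oner_eq0.
    case: ol => ul ol; split; first by rewrite /= vin.
    move=> x y; rewrite !inE => /predU1P[->|xl] /predU1P[->|yl].
    + by rewrite eqxx -nrm v1 expr1n.
    + by rewrite vl //; case: eqP => // h; rewrite h yl in vin.
    + by rewrite ipC vl //; case: eqP => // h; rewrite -h xl in vin.
    + exact: ol.
  move=> y; rewrite inE => /predU1P[->|/hl //]; split => //; last by exists m.
  by apply: (wa_D1 wa m0) vm; rewrite -normr_eq0 v1 oner_eq0.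
have [l [sl ol hl]] := ex (size e).+1.
have := orthonormal_size nrm oe ol; rewrite sl ltnn => h.
by have := h (fun x xl => let: And3 hx _ _ := hl x xl in es x hx).
Qed.

Lemma H0_finite nu : has_dim H0 nu -> exists e, hilbert_basis ip H0 e.
Proof.
move=> [b [hb _]].
have [||||x|e [oe eS es]] := @gram_schmidt R H H0 ip kerop_subspace _ _ _ _ (codom b).
- by move=> *; exact: ipDl.
- by move=> *; exact: ipZl.
- by move=> *; exact: ipC.
- by move=> u _ u0; rewrite -nrm exprn_gt0 // normr_gt0.
- case/codomP => j ->; apply/hb; exists (fun k => (k == j)%:R).
  rewrite (bigD1 j) //= eqxx scale1r big1 ?addr0 // => k /negPf ->.
  by rewrite scale0r.
exists e; split => // u /hb[c ->].
rewrite linear_sum; apply: eq_bigr => j _; rewrite linearZ /=; congr (_ *: _).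
by rewrite {2}(es (b j)) ?codom_f.
Qed.

(** * Projections onto H^0, H^- and H^+, and the inverse of B(0) on X^pm *)

Variables (e0 em : seq H).
Hypotheses (he0 : hilbert_basis ip H0 e0) (hem : hilbert_basis ip Hm em).

Let p0 : {linear H -> H} := expand ip e0 id.
Let pm : {linear H -> H} := expand ip em id.
Let pp (u : H) : H := u - p0 u - pm u.

Let p0X : {linear H -> X} := expand ip e0 (toX i).
Let pmX : {linear H -> X} := expand ip em (toX i).

Let sub0 : is_subspace H0. Proof. exact: kerop_subspace. Qed.

Lemma p0_in u : H0 (p0 u).
Proof. by case: he0 => _ eS _; exact: expand_sub. Qed.

Lemma pm_in u : Hm (pm u).
Proof. by case: hem => _ eS _; exact: expand_sub (ds_subm spl) eS. Qed.

Lemma p0_id u : H0 u -> p0 u = u.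
Proof. by case: he0 => _ _; exact. Qed.

Lemma pm_id u : Hm u -> pm u = u.
Proof. by case: hem => _ _; exact. Qed.

Lemma p0_perp u : orth ip H0 u -> p0 u = 0.
Proof.
move=> hu; rewrite /p0 /= /expand big_seq big1 // => y ye.
by case: he0 => _ eS _; rewrite hu ?scale0r //; exact: eS.
Qed.

Lemma pm_perp u : orth ip Hm u -> pm u = 0.
Proof.
move=> hu; rewrite /pm /= /expand big_seq big1 // => y ye.
by case: hem => _ eS _; rewrite hu ?scale0r //; exact: eS.
Qed.

Lemma p0_residual u : orth ip H0 (u - p0 u).
Proof.
case: he0 => oe _ es v hv; rewrite -(es v hv) ip_sumr big_seq big1 // => y ye.
by rewrite ipZr expand_perp // mulr0.
Qed.

Lemma pm_residual u : orth ip Hm (u - pm u).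
Proof.
case: hem => oe _ es v hv; rewrite -(es v hv) ip_sumr big_seq big1 // => y ye.
by rewrite ipZr expand_perp // mulr0.
Qed.

Lemma Hm_perp0 u : Hm u -> orth ip H0 u. Proof. exact: ds_orth0m spl _. Qed.
Lemma Hp_perp0 u : Hp u -> orth ip H0 u. Proof. exact: ds_orth0p spl _. Qed.
Lemma Hp_perpm u : Hp u -> orth ip Hm u. Proof. exact: ds_orthpm spl _. Qed.

Lemma pp_in u : Hp (pp u).
Proof.
apply/Hp_orth; split.
  apply: subspaceB (orth_subspace _ _) (p0_residual u) (Hm_perp0 (pm_in u)).
have -> : pp u = (u - pm u) - p0 u by rewrite /pp; zmod.
apply: subspaceB (orth_subspace _ _) (pm_residual u) _ => v hv.
by rewrite ipC; apply: (Hm_perp0 hv); exact: p0_in.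
Qed.

Lemma pp_id u : Hp u -> pp u = u.
Proof.
by move=> hu; rewrite /pp (p0_perp (Hp_perp0 hu)) (pm_perp (Hp_perpm hu)) !subr0.
Qed.

Lemma oproj_p0 u : oproj ip H0 u = p0 u.
Proof.
have h : is_oproj ip H0 u (p0 u) by split; [exact: p0_in|exact: p0_residual].
have [h1 h2] : is_oproj ip H0 u (oproj ip H0 u) by exact: xgetI h.
apply/eqP; rewrite -subr_eq0; apply/eqP.
apply: ker_orth_eq0; first exact: (subspaceB sub0 h1 (p0_in u)).
have -> : oproj ip H0 u - p0 u = (u - p0 u) - (u - oproj ip H0 u) by zmod.
by apply: subspaceB (orth_subspace _ _) _ h2; exact: p0_residual.
Qed.

Lemma p0_cont : continuous p0. Proof. exact: expand_continuous. Qed.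
Lemma pm_cont : continuous pm. Proof. exact: expand_continuous. Qed.

Lemma pp_cont : continuous pp.
Proof.
move=> u; apply: cvgB; last exact: pm_cont.
by apply: cvgB; [exact: cvg_id|exact: p0_cont].
Qed.

Lemma i_expandX e u : (forall y, y \in e -> range i y) ->
  i (expand ip e (toX i) u) = expand ip e id u.
Proof.
move=> eX; rewrite linear_expand; apply: eq_expand => y ye /=.
by rewrite i_toX //; [exact: wa_inj wa|exact: eX].
Qed.

Lemma i_p0X u : i (expand ip e0 (toX i) u) = p0 u.
Proof. by apply: i_expandX => y ye; apply: B0_ker_range; case: he0 => _ + _; exact. Qed.

Lemma i_pmX u : i (expand ip em (toX i) u) = pm u.
Proof. by apply: i_expandX => y ye; apply: Hm_range; case: hem => _ + _; exact. Qed.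

Let DA0 (x : X) : X := 'D_x A 0.

Lemma i_DA0 x : i (DA0 x) = B0 (i x).
Proof. by rewrite /DA0 i_derive //; exact: V_i0. Qed.

(* x |-> DA(0) x + P^0 x is a continuous bijection of X. *)
Lemma Xpm_inv_bounded : exists2 C : R, 0 < C &
  forall x, Xpm ip i B0 x -> `|x| <= C * `|DA0 x|.
Proof.
have inj_i := wa_inj wa.
pose T (x : X) : X := DA0 x + expand ip e0 (toX i) (i x).
have iT x : i (T x) = B0 (i x) + p0 (i x) by rewrite /T linearD i_DA0 i_p0X.
have linT : linear T.
  move=> a x y; apply: inj_i.
  have e1 : i (a *: x + y) = a *: i x + i y by exact: linearP.
  have e2 : i (a *: T x + T y) = a *: i (T x) + i (T y) by exact: linearP.
  have e3 (f : {linear H -> H}) : f (a *: i x + i y) = a *: f (i x) + f (i y).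
    exact: linearP.
  by rewrite e2 !iT e1 !e3; zmod.
pose Tl : {linear X -> X} := HB.pack T (GRing.isLinear.Build _ _ _ _ _ linT).
have inT x y : T x = T y -> x = y.
  move=> /(congr1 i); rewrite !iT => h; apply: inj_i.
  have h0 : p0 (i x) = p0 (i y).
    have := congr1 p0 h; rewrite !linearD /=.
    by rewrite !(p0_perp (B0_orth _)) !add0r !(p0_id (p0_in _)).
  move: h; rewrite h0 => /addIr hB.
  apply/eqP; rewrite -subr_eq0 -linearB; apply/eqP.
  have hk : H0 (i (x - y)) by rewrite /H0 /kerop /= !linearB /= hB subrr.
  by rewrite -(p0_id hk) !linearB /= h0 subrr.
have suT y : exists x, T x = y.
  (* Here B(0)u = y - P^0 y lies in X, so (C2) puts u in X; P^0 y is then added as the kernel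
     component. *)
  have [u hu Bu] := B0_surj (p0_residual (i y)).
  have [x0 _ hx0] : range i u.
    apply: (wa_C2 wa); rewrite -/B0 Bu -i_p0X -linearB.
    by exists (y - expand ip e0 (toX i) (i y)).
  exists (x0 + expand ip e0 (toX i) (i y)); apply: inj_i.
  rewrite iT linearD i_p0X hx0 !linearD /= Bu (p0_perp hu) add0r (p0_id (p0_in _)).
  by rewrite (p0_in (i y)) addr0 subrK.
have /choice[S hS] := suT.
have invS : cancel Tl S by move=> x; apply: inT; rewrite hS.
have cTl : continuous Tl.
  apply: continuousfor0_continuous; apply/continuous_at_distP => e ep.
  have [d d0 hd] := cont_dir_diff_dist 0 (wa_F2_diff wa) V_i0 (divr_gt0 ep (ltr0n R 2)).
  have /continuous_at_distP/(_ (e / 2))[|d' d'0 hd'] :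
    {for 0, continuous (expand ip e0 (toX i))} by exact: expand_continuous.
    by rewrite divr_gt0.
  exists (Num.min d d'); first by rewrite lt_min d0.
  move=> x; rewrite subr0 lt_min => /andP[xd xd'].
  have h1 : `|DA0 x| < e / 2.
    have := hd 0 x; rewrite subrr normr0 subr0 d0 xd => /(_ isT isT).
    have -> : 'D_0 A 0 = 0 by apply: derive_val; exact: is_derive0.
    by rewrite subr0.
  have h2 : `|expand ip e0 (toX i) (i x)| < e / 2.
    have := hd' (i x); rewrite subr0 linear0 subr0; apply.
    by rewrite (le_lt_trans (wa_norm_le wa _)).
  rewrite linear0 subr0 /= /T (le_lt_trans (ler_normD _ _)) //; lra.
have [C C0 hC] := bounded_inverse cTl invS hS.
exists C => // x hx; have := hC (T x).
have -> : S (T x) = x by apply: inT; rewrite hS.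
congr (_ <= _ * `| _ |); rewrite /T.
have -> : expand ip e0 (toX i) (i x) = 0.
  by apply: inj_i; rewrite i_p0X linear0 p0_perp.
by rewrite addr0.
Qed.

(** The bound from [Xpm_inv_bounded] makes the supremum defining C_1 that of a bounded set, so that
    C_1 really bounds the inverse. *)
Lemma Xpm_invP y : Xpm ip i B0 y -> let x := Xpm_inv ip i B0 y in
  [/\ Xpm ip i B0 x, B0 (i x) = i y & `|x| <= C1const ip i B0 * `|y|].
Proof.
have inj_i := wa_inj wa.
have invP z : Xpm ip i B0 z ->
    Xpm ip i B0 (Xpm_inv ip i B0 z) /\ B0 (i (Xpm_inv ip i B0 z)) = i z.
  move=> hz; have [u hu Bu] := B0_surj hz.
  have [x0 _ hx0] : range i u by apply: (wa_C2 wa); rewrite -/B0 Bu; exists z.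
  have h : [set x | Xpm ip i B0 x /\ B0 (i x) = i z] x0.
    by rewrite /= /Xpm /= hx0.
  exact: (xgetI 0 h).
move=> hy /=; have [h1 h2] := invP y hy; split => //.
have [C C0 hC] := Xpm_inv_bounded.
apply: (@le_opnorm R X X _ _ C subX _ _ y hy) => [z hz|a z hz].
  have [k1 k2] := invP z hz; rewrite (le_trans (hC _ k1)) //.
  by rewrite (_ : DA0 _ = z) //; apply: inj_i; rewrite i_DA0.
have [k1 k2] := invP z hz; have [l1 l2] := invP (a *: z) (subspaceZ a subX hz).
apply: inj_i; apply: B0_inj => //.
  exact: (subspaceZ a subX k1).
have e2 w : B0 (a *: w) = a *: B0 w by exact: linearZ.
by rewrite -/B0 l2 !iZ e2 k2.
Qed.

(** * Estimates on B(x) uniform for x small in the norm of H *)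

(** (D2) and (D4) speak of sequences; this turns the failure of a uniform estimate near the origin
    into a sequence that contradicts them. *)
Lemma small_sequence (G : nat -> X -> Prop) :
  (forall n (d : R), 0 < d -> exists x, [/\ V (i x), `|i x| < d & G n x]) ->
  exists x_ : nat -> X, [/\ forall k, V (i (x_ k)),
    `|i (x_ k)| @[k --> \oo] --> (0 : R) & forall k, G k (x_ k)].
Proof.
move=> h.
have h' n : exists x, [/\ V (i x), `|i x| < n.+1%:R^-1 & G n x].
  by apply: h; rewrite invr_gt0.
have /choice[x_ hx] := h'.
exists x_; split=> [k||k]; try by have [] := hx k.
apply: (@squeeze_cvgr _ _ _ _ (fun=> 0) (fun k => k.+1%:R^-1)).
- by apply: nearW => k; rewrite normr_ge0 /= ltW //; have [] := hx k.
- exact: cvg_cst.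
- exact: cvg_harmonic.
Qed.

(** The constant in (D4) depends on the sequence. Were there no common one, a sequence whose n-th
    member violates the bound 1/(n+1) would contradict (D4). *)
Lemma P_coercive : exists C0 d : R, [/\ 0 < C0, 0 < d &
  forall x, V (i x) -> `|i x| < d -> forall u, C0 * `|u| ^+ 2 <= ip (P x u) u].
Proof.
apply: contrapT => N.
have [|x_ [xV x0 hx]] := @small_sequence
  (fun n x => ~ forall u, n.+1%:R^-1 * `|u| ^+ 2 <= ip (P x u) u).
  move=> n d d0; apply: contrapT => hN; apply: N; exists n.+1%:R^-1, d.
  split => // x Vx xd; apply: contrapT => hx; apply: hN; by exists x.
have [C0 [n0 [C00 hC]]] := wa_D4 wa xV x0.
have [n1 _ hn1] := near_infty_natSinv_lt (PosNum C00).
apply: (hx (maxn n0 n1)) => u; apply: le_trans (hC _ u (leq_maxl _ _)).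
rewrite ler_wpM2r ?exprn_ge0 // ltW //; exact: (hn1 _ (leq_maxr n0 n1)).
Qed.

Lemma Q_cont (e : R) : 0 < e -> exists2 d : R, 0 < d & forall x, V (i x) ->
  `|i x| < d -> forall u, `|Q x u - Q 0 u| <= e * `|u|.
Proof.
move=> ep; have [d d0 hd] := wa_D3 wa ep; exists d => // x Vx xd u.
have := hd x Vx xd; set N := opnorm _ _ => hN.
have [K1 K10 hK1] := compact_operator_bounded (wa_D_compact wa Vx).
have [K2 K20 hK2] := compact_operator_bounded (wa_D_compact wa V_i0).
have : `|Q x u - Q 0 u| <= N * `|u|.
  apply: (@le_opnorm R H H setT (fun u => Q x u - Q 0 u) (K1 + K2)) => //.
    move=> v _; rewrite (le_trans (ler_normB _ _)) // mulrDl lerD //.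
  move=> a v _; have e1 (f : {linear H -> H}) : f (a *: v) = a *: f v by exact: linearZ.
  by rewrite !e1 scalerBr.
by move=> /le_trans; apply; rewrite ler_wpM2r // ltW.
Qed.

(** Pointwise in [u], as (D2) gives strong continuity of P. Uniformity is recovered only over
    finitely many vectors, which is why the estimates on B reduce to finite-dimensional spaces. *)
Lemma B_cont u (e : R) : 0 < e -> exists2 d : R, 0 < d & forall x, V (i x) ->
  `|i x| < d -> `|B x u - B0 u| <= e.
Proof.
move=> ep; apply: contrapT => N.
have u1 : 0 < `|u| + 1 by rewrite ltr_wpDl.
have [d1 d10 hd1] := Q_cont (divr_gt0 (divr_gt0 ep (ltr0n R 2)) u1).
have [|x_ [xV x0 hx]] := @small_sequence (fun n x => e / 2 < `|P x u - P 0 u|).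
  move=> _ d d0; apply: contrapT => hN; apply: N.
  exists (Num.min d d1); first by rewrite lt_min d0.
  move=> x Vx; rewrite lt_min => /andP[xd xd1].
  have hP : `|P x u - P 0 u| <= e / 2.
    by rewrite leNgt; apply/negP => h; apply: hN; exists x.
  rewrite /B0 (wa_D wa _ Vx) (wa_D wa _ V_i0).
  have -> : P x u + Q x u - (P 0 u + Q 0 u) = (P x u - P 0 u) + (Q x u - Q 0 u) by zmod.
  rewrite (le_trans (ler_normD _ _)) //.
  have := hd1 x Vx xd1 u; rewrite mulrAC ler_pdivlMr // => h.
  have : `|Q x u - Q 0 u| <= `|Q x u - Q 0 u| * (`|u| + 1) by rewrite ler_peMr // lerDr.
  have : e / 2 * `|u| / (`|u| + 1) <= e / 2.
    by rewrite ler_pdivrMr // ler_wpM2l ?lerDl // divr_ge0 // ltW.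
  by move: h; rewrite -ler_pdivlMr //; lra.
have /cvgrPdist_lt/(_ (e / 2))[|n _ hn] := wa_D2 wa xV x0 u.
  by rewrite divr_gt0.
have := hn n (leqnn n); rewrite sub0r normrN normr_id.
by have := hx n => h1 h2; have := lt_trans h1 h2; rewrite ltxx.
Qed.

Lemma B_cont_seq (s : seq H) (e : R) : 0 < e -> exists2 d : R, 0 < d &
  forall x, V (i x) -> `|i x| < d -> forall y, y \in s -> `|B x y - B0 y| <= e.
Proof.
move=> ep; elim: s => [|y s [d d0 hd]]; first by exists 1.
have [d' d'0 hd'] := B_cont y ep.
exists (Num.min d d'); first by rewrite lt_min d0.
move=> x Vx; rewrite lt_min => /andP[xd xd'] z; rewrite inE => /predU1P[->|zs].
  exact: hd'.
exact: hd zs.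
Qed.

(** Closeness of B(x) to B(0) on the basis vectors of H^- gives |B(x)u - B(0)u| <= (a/2)|u| on all
    of H^-, which costs half of the coercivity constant. *)
Lemma B_minus : exists a d : R, [/\ 0 < a, 0 < d & forall x, V (i x) -> `|i x| < d ->
  forall u, Hm u -> a * `|u| ^+ 2 <= - ip (B x u) u].
Proof.
have [a a0 [_ ha]] := B0_coercive.
pose n : R := (size em)%:R + 1.
have n0 : 0 < n by rewrite ltr_wpDl.
have [d d0 hd] := B_cont_seq em (divr_gt0 (divr_gt0 a0 (ltr0n R 2)) n0).
exists (a / 2), d; split => //; first by rewrite divr_gt0.
move=> x Vx xd u hu.
have hB : `|B x u - B0 u| <= a / 2 * `|u|.
  have [oe eS es] := hem.
  have -> : B x u - B0 u = \sum_(y <- em) ip u y *: (B x y - B0 y).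
    have e1 (f : {linear H -> H}) : f u = expand ip em f u.
      by rewrite -{1}(es u hu) linear_expand.
    rewrite (e1 (B x)) (e1 B0) /expand -sumrB.
    by apply: eq_bigr => y _; rewrite scalerBr.
  apply: le_trans (_ : \sum_(y <- em) a / 2 / n * `|u| <= _); last first.
    rewrite big_const_seq count_predT iter_addr addr0 -[leLHS]mulr_natr.
    have -> : a / 2 * `|u| = a / 2 / n * `|u| * n by field; rewrite gt_eqF.
    apply: ler_wpM2l; last by rewrite /n lerDl.
    by rewrite mulr_ge0 // !divr_ge0 // ltW.
  rewrite (le_trans (ler_norm_sum _ _ _)) // big_seq [leRHS]big_seq.
  apply: ler_sum => y ye; rewrite normrZ mulrC ler_pM //; first exact: hd.
  rewrite (le_trans (cauchy_schwarz nrm _ _)) // (orthonormal_norm nrm oe ye).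
  by rewrite mulr1.
have -> : - ip (B x u) u = - ip (B0 u) u - ip (B x u - B0 u) u by rewrite ipBl; ring.
have := ha u hu; have := ip_le nrm (B x u - B0 u) u.
have : `|B x u - B0 u| * `|u| <= a / 2 * `|u| * `|u| by rewrite ler_wpM2r.
rewrite -/B0; move: (`|u|) (ip (B0 u) u) (ip (B x u - B0 u) u) => t p q.
by rewrite expr2; lra.
Qed.

Lemma B0_surj_p y : Hp y -> exists2 u, Hp u & B0 u = y.
Proof.
move=> hy; have [u hu Bu] := B0_surj (Hp_perp0 hy).
have uE : u = pp u + pm u by rewrite /pp (p0_perp hu); zmod.
have Bm : Hm (B0 (pm u)) by apply: (ds_invm spl); exact: pm_in.
have Bp : Hp (B0 (pp u)) by apply: (ds_invp spl); exact: pp_in.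
have Bm0 : B0 (pm u) = 0.
  have hp : Hp (B0 (pm u)).
    have -> : B0 (pm u) = y - B0 (pp u) by rewrite -Bu {2}uE linearD /= addrC addKr.
    exact: subspaceB (ds_subp spl) hy Bp.
  by apply: (ip_eq0 nrm); exact: (Hp_perpm hp).
exists (pp u); first exact: pp_in.
have : B0 u = B0 (pp u) + B0 (pm u) by rewrite {1}uE linearD.
by rewrite Bm0 addr0 => <-.
Qed.

(* Split u in Hp as f + g, B0-orthogonally, where f lies in a fixed finite-dimensional
   space on which B x is close to B0, and where the compact part Q 0 is small
   on g: it suffices that g be orthogonal to a net of Q 0 (unit ball). *)
Lemma B_plus : exists a d : R, [/\ 0 < a, 0 < d & forall x, V (i x) -> `|i x| < d ->
  forall u, Hp u -> a * `|u| ^+ 2 <= ip (B x u) u].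
Proof.
have [a a0 [ha _]] := B0_coercive.
have [C0 [d1 [C00 d10 hP]]] := P_coercive.
have [M M0 hM] := continuous_linear_bound B0_continuous.
have C4 : 0 < C0 / 4 by rewrite divr_gt0.
have [ys net] := compact_operator_net (wa_D_compact wa V_i0) C4.
(* For g in H^+ one has (B(0)g, s) = (g, y), so B(0)-orthogonality to these s is orthogonality to
   the net. *)
have ex y : exists s, Hp s /\ B0 s = pp y.
  by have [s hs Bs] := B0_surj_p (pp_in y); exists s.
have /choice[s hs] := ex.
pose b u w := ip (B0 u) w.
have bC u w : b u w = b w u by rewrite /b B0_sym ipC.
have [||||x|e [oe eS es]] := @gram_schmidt R H Hp b (ds_subp spl) _ _ _ _ (map s ys).
- by move=> u v w; rewrite /b linearD ipDl.
- by move=> k u w; rewrite /b linearZ ipZl.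
- exact: bC.
- exact: (ds_pos spl).
- by case/mapP => y _ ->; have [] := hs y.
have bound u y : `|b u y| <= M * `|u| * `|y|.
  by rewrite (le_trans (cauchy_schwarz nrm _ _)) // ler_wpM2r.
pose k1 : R := M * \sum_(y <- e) `|y|.
pose k2 : R := M * \sum_(y <- e) `|y| ^+ 2.
have k10 : 0 <= k1 by rewrite mulr_ge0 ?(ltW M0) // sumr_ge0.
have k20 : 0 <= k2 by rewrite mulr_ge0 ?(ltW M0) // sumr_ge0 // => y _; rewrite exprn_ge0.
(* f contributes at least a |f|^2, and g at least (C0 - C0/4 - C0/4)|g|^2. Since |u|^2 <= 2(|f|^2 +
   |g|^2), these leave (m/2)|u|^2. *)
pose m : R := Num.min a (C0 / 2).
have m0 : 0 < m by rewrite lt_min a0 divr_gt0.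
have ma : m <= a by rewrite ge_min lexx.
have mC : m <= C0 / 2 by rewrite ge_min lexx orbT.
(* The errors on (f, f) and twice on (f, g) add up to eta k1 (k2 + 2(1 + k2)) |u|^2; [eta] keeps
   this below (m/4)|u|^2. *)
pose den : R := k1 * (3 * k2 + 2) + 1.
have den0 : 0 < den by rewrite ltr_wpDl // mulr_ge0 // addr_ge0 // mulr_ge0.
pose eta : R := m / 4 / den.
have eta0 : 0 < eta by rewrite !divr_gt0.
have eta_le : eta * (k1 * (3 * k2 + 2)) <= m / 4.
  have : eta * den = m / 4 by rewrite /eta mulfVK ?gt_eqF.
  by rewrite /den mulrDr mulr1; lra.
have [d2 d20 hd2] := Q_cont C4.
have [d3 d30 hd3] := B_cont_seq e eta0.
exists (m / 4), (Num.min d1 (Num.min d2 d3)); split.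
- by rewrite divr_gt0.
- by rewrite !lt_min d10 d20.
move=> x Vx; rewrite !lt_min => /and3P[xd1 xd2 xd3] u hu.
pose f := \sum_(z <- e) b u z *: z.
pose g := u - f.
have hf : Hp f.
  rewrite /f big_seq; apply: big_rec => [|z v ze hv]; first exact: (ds_subp spl).1.
  by apply: (ds_subp spl).2 => //; exact: eS.
have hg : Hp g by exact: subspaceB (ds_subp spl) hu hf.
have ge z : z \in e -> b g z = 0.
  apply: gram_schmidt_residual => //.
  - by move=> u' v w; rewrite /b linearD ipDl.
  - by move=> k u' w; rewrite /b linearZ ipZl.
have bsum w : b f w = \sum_(z <- e) b u z * b z w.
  rewrite /b linear_sum -[LHS](ipC ip w) ip_sumr; apply: eq_bigr => z _.
  by rewrite linearZ ipZr ipC.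
have bfg : b f g = 0.
  by rewrite bsum big_seq big1 // => z ze; rewrite (bC z) ge // mulr0.
have gys y : y \in ys -> ip g y = 0.
  move=> yys; have [sy Bsy] := hs y.
  have : b g (s y) = 0.
    rewrite (es (s y)) ?map_f // /b ip_sumr big_seq big1 // => z ze.
    by rewrite ipZr -/(b g z) ge // mulr0.
  rewrite /b B0_sym Bsy /pp !ipBr (Hp_perp0 hg (p0_in y)) (Hp_perpm hg (pm_in y)).
  by rewrite !subr0.
have Bf : `|B x f - B0 f| <= k1 * eta * `|u|.
  have -> : B x f - B0 f = \sum_(z <- e) b u z *: (B x z - B0 z).
    have e1 (T : {linear H -> H}) : T f = \sum_(z <- e) b u z *: T z.
      by rewrite linear_sum; apply: eq_bigr => z _; rewrite linearZ.
    by rewrite !e1 -sumrB; apply: eq_bigr => z _; rewrite scalerBr.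
  rewrite (le_trans (ler_norm_sum _ _ _)) // /k1 mulr_sumr !mulr_suml.
  rewrite big_seq [leRHS]big_seq; apply: ler_sum => z ze; rewrite normrZ.
  have -> : M * `|z| * eta * `|u| = M * `|u| * `|z| * eta by ring.
  by rewrite ler_pM // hd3.
have nf : `|f| <= k2 * `|u|.
  rewrite (le_trans (ler_norm_sum _ _ _)) // /k2 mulr_sumr !mulr_suml.
  apply: ler_sum => z _; rewrite normrZ.
  have -> : M * `|z| ^+ 2 * `|u| = M * `|u| * `|z| * `|z| by ring.
  by rewrite ler_wpM2r.
have ng : `|g| <= (1 + k2) * `|u|.
  by rewrite (le_trans (ler_normB _ _)) // mulrDl mul1r lerD.
have [_ symx] := wa_F3_sa wa Vx.
have uE : u = f + g by rewrite /g addrC subrK.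
clearbody g; clearbody f.
have BE : ip (B x u) u = b f f + ip (B x f - B0 f) f + 2 * ip (B x f - B0 f) g
    + (ip (P x g) g + ip (Q 0 g) g + ip (Q x g - Q 0 g) g).
  have gf : ip (B x g) f = ip (B x f) g by rewrite symx ipC.
  have Bg : ip (B x g) g = ip (P x g) g + ip (Q x g) g by rewrite (wa_D wa _ Vx) ipDl.
  have bfg' : ip (B0 f) g = 0 by exact: bfg.
  have e1 : B x u = B x f + B x g by rewrite {1}uE linearD.
  have e2 : ip (B x u) u = ip (B x f + B x g) (f + g) by rewrite e1 {1}uE.
  rewrite e2 !(ipDl, ipDr, ipNl) gf Bg bfg' /b; ring.
have h1 : a * `|f| ^+ 2 <= b f f by exact: ha.
have h2 : `|ip (B x f - B0 f) f| <= k1 * eta * `|u| * (k2 * `|u|).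
  by rewrite (le_trans (cauchy_schwarz nrm _ _)) // ler_pM.
have h3 : `|ip (B x f - B0 f) g| <= k1 * eta * `|u| * ((1 + k2) * `|u|).
  by rewrite (le_trans (cauchy_schwarz nrm _ _)) // ler_pM.
have h4 := hP x Vx xd1 g.
have h5 := net_small nrm net gys.
have h6 : `|ip (Q x g - Q 0 g) g| <= C0 / 4 * `|g| ^+ 2.
  rewrite (le_trans (cauchy_schwarz nrm _ _)) // expr2 mulrA ler_wpM2r //.
  exact: hd2.
have h7 : `|u| ^+ 2 <= 2 * (`|f| ^+ 2 + `|g| ^+ 2).
  have : `|u| <= `|f| + `|g| by rewrite {1}uE ler_normD.
  have := normr_ge0 u; move: (`|u|) (`|f|) (`|g|) => r s' t r0 rst.
  have : r ^+ 2 <= (s' + t) ^+ 2 by rewrite ler_pXn2r ?nnegrE // (le_trans r0).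
  have : 0 <= (s' - t) ^+ 2 by rewrite sqr_ge0.
  by nra.
have h8 : eta * (k1 * (3 * k2 + 2)) * `|u| ^+ 2 <= m / 4 * `|u| ^+ 2.
  by rewrite ler_wpM2r // exprn_ge0.
have h9 : m * `|f| ^+ 2 <= a * `|f| ^+ 2 by rewrite ler_wpM2r // exprn_ge0.
have h10 : m * `|g| ^+ 2 <= C0 / 2 * `|g| ^+ 2 by rewrite ler_wpM2r // exprn_ge0.
have h11 : m * `|u| ^+ 2 <= m * (2 * (`|f| ^+ 2 + `|g| ^+ 2)).
  by rewrite ler_wpM2l // ltW.
rewrite BE.
move: h2 h3 h5 h6; rewrite !ler_norml => /andP[h2 _] /andP[h3 _] /andP[h5 _] /andP[h6 _].
move: h2 h3 h8.
have -> : k1 * eta * `|u| * (k2 * `|u|) = eta * k1 * k2 * `|u| ^+ 2 by ring.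
have -> : k1 * eta * `|u| * ((1 + k2) * `|u|) = eta * k1 * `|u| ^+ 2 + eta * k1 * k2 * `|u| ^+ 2 by ring.
have -> : eta * (k1 * (3 * k2 + 2)) * `|u| ^+ 2 =
  3 * (eta * k1 * k2 * `|u| ^+ 2) + 2 * (eta * k1 * `|u| ^+ 2) by ring.
move: (eta * k1 * k2 * `|u| ^+ 2) (eta * k1 * `|u| ^+ 2) => s1 s2.
lra.
Qed.

(** * Energy estimates for L on a ball of H *)

(** (F2w) covers directions in X; the others follow by density, as the derivative of L is continuous
    in the direction. *)
Lemma DL_grad x v : V (i x) -> 'D_v L (i x) = ip (i (A x)) v.
Proof.
move=> Vx; apply/eqP; rewrite -subr_eq0 -normr_eq0 eq_le normr_ge0 andbT.
apply/ler_addgt0Pr => e ep; rewrite add0r.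
have e2 : 0 < e / 2 by rewrite divr_gt0.
have [d d0 hd] := cont_dir_diff_dist v (wa_F1 wa) Vx e2.
have n1 : 0 < `|i (A x)| + 1 by rewrite ltr_wpDl.
have [|u hu] := @near_range v (Num.min d (e / 2 / (`|i (A x)| + 1))).
  by rewrite lt_min d0 divr_gt0.
move: hu; rewrite lt_min => /andP[ud]; rewrite ltr_pdivlMr // => ue.
have := hd (i x) (i u); rewrite subrr normr0 d0 ud => /(_ isT isT).
rewrite (wa_F2_grad wa) // => h1.
have -> : 'D_v L (i x) - ip (i (A x)) v =
    ip (i (A x)) (i u - v) - (ip (i (A x)) (i u) - 'D_v L (i x)).
  by rewrite ipBr; ring.
rewrite (le_trans (ler_normB _ _)) //.
have := cauchy_schwarz nrm (i (A x)) (i u - v).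
have : `|i (A x)| * `|i u - v| <= `|i u - v| * (`|i (A x)| + 1).
  by rewrite mulrC ler_wpM2l // lerDl.
lra.
Qed.

Lemma is_derive_ip (f : R -> X) (t : R) (l : X) w : is_derive t 1 f l ->
  is_derive t 1 (fun s => ip (i (f s)) w) (ip (i l) w).
Proof.
move=> /is_derive_distP df; apply/is_derive_distP => e ep.
have n1 : 0 < `|w| + 1 by rewrite ltr_wpDl.
have [d d0 hd] := df _ (divr_gt0 ep n1).
exists d => // h h0 hlt; have := hd h h0 hlt; rewrite ltr_pdivlMr // => hh.
have -> : h^-1 *: (ip (i (f (h *: 1 + t))) w - ip (i (f t)) w) - ip (i l) w =
    ip (i (h^-1 *: (f (h *: 1 + t) - f t) - l)) w.
  by rewrite iB iZ iB ipBl ipZl ipBl.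
rewrite (le_lt_trans (cauchy_schwarz nrm _ _)) //.
apply: le_lt_trans hh; apply: ler_pM => //; last by rewrite lerDl.
exact: wa_norm_le wa _.
Qed.

(** The substitute for a second derivative of L: along a segment of X the derivative of L is (A(.),
    w)_H, which is differentiable with derivative (B(.)w, w)_H. *)
Lemma DL_increment x w : (forall t : R, 0 <= t <= 1 -> V (i (x + t *: w))) ->
  exists2 c : R, 0 <= c <= 1 &
  'D_(i w) L (i (x + w)) - 'D_(i w) L (i x) = ip (B (x + c *: w) (i w)) (i w).
Proof.
move=> hV.
have V0 : V (i x) by have := hV 0; rewrite lexx ler01 scale0r addr0; apply.
have V1 : V (i (x + w)) by have := hV 1; rewrite lexx ler01 scale1r; apply.
have [|c c01 hc] := @MVT01 R (fun t => ip (i (A (x + t *: w))) (i w))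
    (fun t => ip (i ('D_w A (x + t *: w))) (i w)).
  move=> t t01; apply: is_derive_ip; apply: is_derive_line.
  by apply: (wa_F2_diff wa).1; exact: hV.
exists c => //; rewrite !DL_grad //.
move: hc; rewrite scale0r addr0 scale1r => ->.
by rewrite i_derive //; exact: hV.
Qed.

(** The projection onto H^+ is continuous and maps X into X, because H^0 and H^- lie in X; it is
    applied to approximants from X. *)
Lemma dense_Hp w (e : R) : Hp w -> 0 < e -> exists x, Hp (i x) /\ `|i x - w| < e.
Proof.
move=> hw ep.
have /continuous_at_distP/(_ e ep)[d d0 hd] : {for w, continuous pp} by exact: pp_cont.
have [x hx] := near_range w d0.
have iE : i (x - p0X (i x) - pmX (i x)) = pp (i x).
  by rewrite !(linearB i) /= i_p0X i_pmX.
exists (x - p0X (i x) - pmX (i x)); rewrite iE; split; first exact: pp_in.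
by have := hd _ hx; rewrite (pp_id hw).
Qed.

Lemma dense_Hm w (e : R) : Hm w -> 0 < e -> exists x, Hm (i x) /\ `|i x - w| < e.
Proof.
move=> hw ep; have [x _ hx] := Hm_range hw.
by exists x; rewrite hx subrr normr0.
Qed.

(** Both sides are continuous in the point and in the direction for the norm of H, so the inequality
    passes from X to H. The sign [s] is 1 on H^+ and -1 on H^-. *)
Lemma DL_mono_dense (S : set H) (s a rho : R) : `|s| <= 1 -> 0 <= a ->
  (forall y, `|y| < rho -> V y) ->
  (forall w (e : R), S w -> 0 < e -> exists x, S (i x) /\ `|i x - w| < e) ->
  (forall x w, S (i w) -> `|i x| < rho -> `|i (x + w)| < rho ->
    a * `|i w| ^+ 2 <= s * ('D_(i w) L (i (x + w)) - 'D_(i w) L (i x))) ->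
  forall p w, S w -> `|p| < rho -> `|p + w| < rho ->
    a * `|w| ^+ 2 <= s * ('D_w L (p + w) - 'D_w L p).
Proof.
move=> s1 a0 rV dS hX p w Sw pr pwr; apply/ler_addgt0Pr => e ep.
have e4 : 0 < e / 4 by rewrite divr_gt0.
have [d1 d10 hd1] := cont_dir_diff_dist w (wa_F1 wa) (rV _ pr) e4.
have [d2 d20 hd2] := cont_dir_diff_dist w (wa_F1 wa) (rV _ pwr) e4.
pose k := a * (2 * `|w| + 1) + 1.
have k0 : 0 < k by rewrite ltr_wpDl // mulr_ge0 // addr_ge0 // mulr_ge0.
pose d := Num.min 1 (Num.min (e / 4 / k) (Num.min (Num.min d1 d2)
  (Num.min (rho - `|p|) (rho - `|p + w|)))).
have d0 : 0 < d by rewrite /d !lt_min ltr01 d10 d20 !subr_gt0 pr pwr divr_gt0.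
have dle : [/\ d <= 1, d <= e / 4 / k, d <= d1, d <= d2 &
    (d <= rho - `|p|) && (d <= rho - `|p + w|)].
  by split; rewrite /d ?ge_min ?lexx ?orbT // !ge_min !lexx !orbT.
clearbody d; case: dle => dle1 dlek dle2 dle3 /andP[dle4 dle5].
have h2 : 0 < d / 2 by rewrite divr_gt0.
have [x hx] := near_range p h2.
have [u [Su hu]] := dS w _ Sw h2.
have hxu : `|i (x + u) - (p + w)| < d.
  have -> : i (x + u) - (p + w) = (i x - p) + (i u - w) by rewrite iD; zmod.
  by rewrite (le_lt_trans (ler_normD _ _)) //; lra.
have nx : `|i x| < rho.
  have := ler_normD (i x - p) p; rewrite subrK; lra.
have nxu : `|i (x + u)| < rho.
  have := ler_normD (i (x + u) - (p + w)) (p + w); rewrite subrK; lra.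
have h := hX x u Su nx nxu.
have k1 := hd1 (i x) (i u) ltac:(lra) ltac:(lra).
have k2 := hd2 (i (x + u)) (i u) ltac:(lra) ltac:(lra).
set D1 := 'D_(i u) L (i (x + u)) in h k2; set D2 := 'D_(i u) L (i x) in h k1.
set E1 := 'D_w L (p + w) in k2 *; set E2 := 'D_w L p in k1 *.
have hs : s * (D1 - D2) - s * (E1 - E2) <= e / 2.
  have -> : s * (D1 - D2) - s * (E1 - E2) = s * ((D1 - E1) - (D2 - E2)) by ring.
  rewrite (le_trans (ler_norm _)) // normrM.
  have := ler_normB (D1 - E1) (D2 - E2).
  have : `|s| * `|D1 - E1 - (D2 - E2)| <= `|D1 - E1 - (D2 - E2)| by rewrite ler_piMl.
  lra.
have hw : a * `|w| ^+ 2 - a * `|i u| ^+ 2 <= e / 4.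
  have wu : `|w| - `|i u| <= d.
    have := ler_dist_dist w (i u); rewrite ler_norml distrC => /andP[_ ]; lra.
  have n1 : `|i u| <= `|w| + 1.
    have := ler_normD (i u - w) w; rewrite subrK; lra.
  have -> : a * `|w| ^+ 2 - a * `|i u| ^+ 2 = a * (`|w| + `|i u|) * (`|w| - `|i u|) by ring.
  have a1 : a * (`|w| + `|i u|) * (`|w| - `|i u|) <= a * (`|w| + `|i u|) * d.
    by rewrite ler_wpM2l // mulr_ge0 // addr_ge0.
  have a2 : a * (`|w| + `|i u|) * d <= a * (2 * `|w| + 1) * d.
    by rewrite ler_wpM2r ?(ltW d0) // ler_wpM2l //; lra.
  move: dlek; rewrite ler_pdivlMr // /k; lra.
lra.
Qed.

Lemma energy_estimates : exists a rho K, energy_bounds Hp Hm V L a rho K.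
Proof.
have [K K0 [r [r0 [rV rL]]]] := cont_dir_diff_lip (wa_F1 wa) (wa_openV wa) (wa_V0 wa).
have [a1 [d1 [a10 d10 hp]]] := B_plus.
have [a2 [d2 [a20 d20 hm]]] := B_minus.
pose a := Num.min a1 a2; pose rho := Num.min r (Num.min d1 d2).
have a0 : 0 < a by rewrite lt_min a10.
have rho0 : 0 < rho by rewrite !lt_min r0 d10.
have aa : a <= a1 /\ a <= a2 by rewrite !ge_min !lexx orbT.
have rr (y : H) : `|y| < rho -> [/\ `|y| < r, `|y| < d1 & `|y| < d2].
  by rewrite !lt_min => /and3P[].
have rhoV y : `|y| < rho -> V y.
  by move=> /rr[yr _ _]; apply: rV; rewrite subr0.
have seg x w t : `|i x| < rho -> `|i (x + w)| < rho -> 0 <= t <= 1 ->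
    `|i (x + t *: w)| < rho.
  move=> xr xwr t01; have := @norm_segment R H 0 (i x) (i (x + w)) t rho t01.
  rewrite !subr0 => h; have := h xr xwr; congr (`| _ | < _).
  by rewrite -linearB -linearZ -linearD /= addrAC subrr add0r.
have mp p w : Hp w -> `|p| < rho -> `|p + w| < rho ->
    a * `|w| ^+ 2 <= 'D_w L (p + w) - 'D_w L p.
  have -> : 'D_w L (p + w) - 'D_w L p = 1 * ('D_w L (p + w) - 'D_w L p) by rewrite mul1r.
  apply: (DL_mono_dense (S := Hp)); rewrite ?normr1 ?(ltW a0) //; first exact: dense_Hp.
  move=> {p}x {}w hw xr xwr; rewrite mul1r.
  have [|c c01 ->] := @DL_increment x w.
    by move=> t t01; apply: rhoV; exact: seg.
  have h := seg x w c xr xwr c01; have [_ hd _] := rr _ h.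
  apply: le_trans (hp _ (rhoV _ h) hd _ hw).
  by rewrite ler_wpM2r ?exprn_ge0 //; case: aa.
have mm p w : Hm w -> `|p| < rho -> `|p + w| < rho ->
    a * `|w| ^+ 2 <= -1 * ('D_w L (p + w) - 'D_w L p).
  apply: (DL_mono_dense (S := Hm)); rewrite ?normrN1 ?(ltW a0) //; first exact: dense_Hm.
  move=> {p}x {}w hw xr xwr; rewrite mulN1r.
  have [|c c01 ->] := @DL_increment x w.
    by move=> t t01; apply: rhoV; exact: seg.
  have h := seg x w c xr xwr c01; have [_ _ hd] := rr _ h.
  apply: le_trans (hm _ (rhoV _ h) hd _ hw).
  by rewrite ler_wpM2r ?exprn_ge0 //; case: aa.
have derL p w : `|p| < rho -> derivable L p w by move=> pr; apply: (wa_F1 wa).1; exact: rhoV.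
pose N := fun y => - L y.
have dN p w : `|p| < rho -> is_derive p w N (- 'D_w L p).
  by move=> pr; apply: is_deriveN; exact/derivableP/derL.
have derN p w : `|p| < rho -> derivable N p w by move=> pr; have [] := dN p w pr.
have mN p w : Hm w -> `|p| < rho -> `|p + w| < rho ->
    a * `|w| ^+ 2 <= 'D_w N (p + w) - 'D_w N p.
  move=> hw pr pwr; have [_ ->] := dN p w pr; have [_ ->] := dN (p + w) w pwr.
  by have := mm p w hw pr pwr; lra.
(* Growth of the derivative at rate a gives a quadratic term with coefficient a/2. *)
exists (a / 2), rho, K; split => //; first by rewrite divr_gt0.
- move=> y z /rr[yr _ _] /rr[zr _ _]; by apply: rL; rewrite subr0.
- move=> p w t hw pr pwr t01.
  have := strong_convex_along (ds_subp spl) derL mp hw pr pwr t01.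
  have : 0 <= a / 2 * `|w| ^+ 2 * (t * (1 - t)).
    case/andP: t01 => t0 t1.
    by rewrite mulr_ge0 ?mulr_ge0 ?exprn_ge0 ?subr_ge0 ?divr_ge0 // ltW.
  lra.
- by move=> p w hw pr pwr; exact: strong_tangent_along (ds_subp spl) derL mp _ _ hw pr pwr.
- move=> p w t hw pr pwr t01.
  have := strong_convex_along (ds_subm spl) derN mN hw pr pwr t01; rewrite /N; lra.
- move=> p w hw pr pwr.
  have := strong_tangent_along (ds_subm spl) derN mN hw pr pwr.
  have [_ ->] := dN p w pr; rewrite /N; lra.
Qed.

(** * The reduction map h by contraction *)

Section reduction.
Let IP0 (u : H) : H := u - oproj ip H0 u.
Let C1 : R := C1const ip i B0.

Variables (kappa r1 : R).
Hypotheses (kappa1 : 1 < kappa) (r10 : 0 < r1)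
  (contr : forall z x1 x2 : X, ball_in H0 r1 (i z) ->
     Xpm ip i B0 x1 -> `|x1| < r1 -> Xpm ip i B0 x2 -> `|x2| < r1 ->
     V (i (z + x1)) -> V (i (z + x2)) ->
     normX i (IP0 (i (A (z + x1))) - B0 (i x1)
              - IP0 (i (A (z + x2))) + B0 (i x2))
       <= (kappa * C1)^-1 * `|x1 - x2|).

Let IA (y : X) : X := A y - p0X (i (A y)).
(** The nonlinear remainder as an element of X, with DA(0)x in place of B(0)x. On X^pm the map x |->
    -B(0)^-1 N(z, x) is the contraction of the overview. *)
Let N (z x : X) : X := IA (z + x) - 'D_x A 0.

Let iN z x : i (N z x) = IP0 (i (A (z + x))) - B0 (i x).
Proof.
by rewrite /N /IA !iB i_p0X (i_derive x V_i0) /IP0 oproj_p0.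
Qed.

Let N_Xpm z x : Xpm ip i B0 (N z x).
Proof.
rewrite /Xpm /= iN; apply: (subspaceB (orth_subspace _ _)); last exact: B0_orth.
by rewrite /IP0 oproj_p0; exact: p0_residual.
Qed.

Let inv := Xpm_inv ip i B0.

Let inv_lip y y' : Xpm ip i B0 y -> Xpm ip i B0 y' ->
  `|inv y - inv y'| <= C1 * `|y - y'|.
Proof.
move=> hy hy'.
have [a1 b1 _] := Xpm_invP hy; have [a2 b2 _] := Xpm_invP hy'.
have [a3 b3 c3] := Xpm_invP (subspaceB subX hy hy').
suff -> : inv y - inv y' = inv (y - y') by [].
apply: (wa_inj wa); apply: B0_inj; [exact: (subspaceB subX)|exact: a3|].
by rewrite -/B0 iB (linearB B0) /= b1 b2 b3 iB.
Qed.

Let fix_iff z x : Xpm ip i B0 x ->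
  x = - inv (N z x) <-> (let y := i (A (z + x)) in p0 y = y).
Proof.
move=> hx; have [a1 b1 _] := Xpm_invP (N_Xpm z x).
have e1 : B0 (i (- inv (N z x))) = - (IP0 (i (A (z + x))) - B0 (i x)).
  by rewrite (linearN i) (linearN B0) /= b1 iN.
split=> [xE|h].
  have e2 : B0 (i x) = - (IP0 (i (A (z + x))) - B0 (i x)) by rewrite {1}xE.
  have : IP0 (i (A (z + x))) = 0.
    by rewrite -(subrK (B0 (i x)) (IP0 _)) {2}e2 subrr.
  by rewrite /IP0 oproj_p0 => /eqP; rewrite subr_eq0 => /eqP.
have hN : Xpm ip i B0 (- inv (N z x)).
  by rewrite -scaleN1r; exact: (subspaceZ _ subX).
apply: (wa_inj wa); apply: B0_inj => //; rewrite -/B0 e1.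
have -> : IP0 (i (A (z + x))) = 0.
  by rewrite /IP0 oproj_p0; apply/eqP; rewrite subr_eq0 eq_sym; exact/eqP.
by rewrite sub0r opprK.
Qed.

Let contrN z x1 x2 : ball_in H0 r1 (i z) ->
  Xpm ip i B0 x1 -> `|x1| < r1 -> Xpm ip i B0 x2 -> `|x2| < r1 ->
  V (i (z + x1)) -> V (i (z + x2)) ->
  `|inv (N z x1) - inv (N z x2)| <= kappa^-1 * `|x1 - x2|.
Proof.
move=> hz h1 l1 h2 l2 V1 V2.
rewrite (le_trans (inv_lip (N_Xpm _ _) (N_Xpm _ _))) //.
have := contr hz h1 l1 h2 l2 V1 V2.
have -> : IP0 (i (A (z + x1))) - B0 (i x1) - IP0 (i (A (z + x2))) + B0 (i x2) =
    i (N z x1 - N z x2) by rewrite iB !iN; zmod.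
rewrite (normX_i (wa_inj wa)) => h.
have C10 : 0 <= C1 by exact: opnorm_ge0.
rewrite (le_trans (ler_wpM2l C10 h)) // mulrA ler_wpM2r //.
(* If C1 = 0 the product vanishes, as the inverse of 0 is 0; otherwise C1 cancels. *)
have [->|C1n0] := eqVneq C1 0.
  by rewrite mul0r invr_ge0 ltW // (lt_trans ltr01).
by rewrite invfM mulrCA mulfV // mulr1.
Qed.

(** (1) controls the variation in x for fixed z. The variation in z comes from A being Lipschitz
    near the origin of X; combined, they make h Lipschitz with constant M / (1 - 1/kappa). *)
Lemma reduction_exists (rho : R) : 0 < rho -> (forall y : H, `|y| < rho -> V y) ->
  exists r0 R1 Kh h, reduction_data ip i A B0 e0 rho r0 R1 Kh h.
Proof.
move=> rho0 rV.
have kappa0 : 0 < kappa by exact: lt_trans kappa1.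
have q0 : 0 <= kappa^-1 by rewrite invr_ge0 ltW.
have q1 : kappa^-1 < 1 by rewrite invf_lt1.
have C10 : 0 <= C1 by exact: opnorm_ge0.
have oVX : open (i @^-1` V).
  by apply: open_comp (wa_openV wa) => ? _; exact: i_continuous.
have [KA KA0 [rA [rA0 [_ lipA]]]] := cont_dir_diff_lip (wa_F2_diff wa) oVX V_i0.
pose Kp : R := \sum_(y <- e0) `|y| * `|toX i y|.
have Kp0 : 0 <= Kp by apply: sumr_ge0 => y _; rewrite mulr_ge0.
have hKp w : `|p0X w| <= Kp * `|w| by exact: expand_bound.
have p0p0 w : p0 (p0 w) = p0 w by exact: (p0_id (p0_in w)).
have p0Xp0 w : p0X (p0 w) = p0X w by apply: (wa_inj wa); rewrite !i_p0X p0p0.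
have IAlip y y' : `|y| < rA -> `|y'| < rA -> `|IA y - IA y'| <= (1 + Kp) * KA * `|y - y'|.
  move=> yr yr'; have -> : IA y - IA y' = (A y - A y') - p0X (i (A y - A y')).
    by rewrite iB (linearB p0X) /= /IA; zmod.
  rewrite (le_trans (ler_normB _ _)) //.
  have h1 : `|A y - A y'| <= KA * `|y - y'| by apply: lipA; rewrite subr0.
  have h2 : `|p0X (i (A y - A y'))| <= Kp * `|A y - A y'|.
    by rewrite (le_trans (hKp _)) // ler_wpM2l //; exact: (wa_norm_le wa).
  have h3 : Kp * `|A y - A y'| <= Kp * (KA * `|y - y'|) by rewrite ler_wpM2l.
  lra.
pose R1 := Num.min (r1 / 2) (Num.min (rho / 4) (rA / 2)).
have R10 : 0 < R1 by rewrite !lt_min !divr_gt0.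
have [R1r [R1rho R1A]] : R1 <= r1 / 2 /\ R1 <= rho / 4 /\ R1 <= rA / 2.
  by rewrite /R1 !ge_min !lexx !orbT.
(* Lipschitz constant in z at fixed x: C1 for the inverse, (1 + Kp) KA for (I - P^0)A, and Kp for
   passing from the norm of H to that of X on H^0. *)
pose M := C1 * ((1 + Kp) * KA * Kp).
have M0 : 0 <= M by rewrite !mulr_ge0 // addr_ge0.
have k1 : 0 < 1 - kappa^-1 by rewrite subr_gt0.
(* The last entry bounds the image of 0 by (1 - 1/kappa) R1/2, so the ball of radius R1/2 is mapped
   into itself. *)
pose r0 := Num.min (Num.min r1 (rho / 4)) (Num.min (rA / 2 / (Kp + 1))
  ((1 - kappa^-1) * (R1 / 2) / (M + 1))).
have Kp1 : 0 < Kp + 1 by rewrite ltr_wpDl.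
have M1 : 0 < M + 1 by rewrite ltr_wpDl.
have r00 : 0 < r0 by rewrite !lt_min r10 !divr_gt0 // mulr_gt0 // divr_gt0.
have [r0r [r0rho [r0A r0M]]] : r0 <= r1 /\ r0 <= rho / 4 /\
    r0 <= rA / 2 / (Kp + 1) /\ r0 <= (1 - kappa^-1) * (R1 / 2) / (M + 1).
  by rewrite /r0 !ge_min !lexx !orbT.
clearbody R1 r0.
have small w : `|p0 w| < r0 -> `|p0X w| < rA / 2.
  move=> hw; rewrite -p0Xp0 (le_lt_trans (hKp _)) //.
  have : Kp * `|p0 w| <= Kp * r0 by rewrite ler_wpM2l // ltW.
  move: r0A; rewrite ler_pdivlMr //; lra.
have inA w x : `|p0 w| < r0 -> `|x| < R1 -> `|p0X w + x| < rA.
  move=> hw hx; rewrite (le_lt_trans (ler_normD _ _)) //.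
  by have := small w hw; lra.
have inV w x : `|p0 w| < r0 -> `|x| < R1 -> V (i (p0X w + x)).
  move=> hw hx; apply: rV; rewrite iD i_p0X (le_lt_trans (ler_normD _ _)) //.
  by have := wa_norm_le wa x; lra.
have inB w : `|p0 w| < r0 -> ball_in H0 r1 (i (p0X w)).
  move=> hw; rewrite i_p0X; split; first exact: p0_in.
  exact: lt_le_trans r0r.
have shift w w' x : `|p0 w| < r0 -> `|p0 w'| < r0 -> `|x| < R1 ->
    `|inv (N (p0X w) x) - inv (N (p0X w') x)| <= M * `|p0 w - p0 w'|.
  move=> hw hw' hx; rewrite (le_trans (inv_lip (N_Xpm _ _) (N_Xpm _ _))) //.
  rewrite /M -mulrA ler_wpM2l //.
  have -> : N (p0X w) x - N (p0X w') x = IA (p0X w + x) - IA (p0X w' + x).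
    by rewrite /N; zmod.
  rewrite (le_trans (IAlip _ _ (inA _ _ hw hx) (inA _ _ hw' hx))) //.
  rewrite -[leRHS]mulrA ler_wpM2l //; first by rewrite mulr_ge0 // addr_ge0.
  have -> : p0X w + x - (p0X w' + x) = p0X (p0 w - p0 w').
    by rewrite (linearB p0X) /= !p0Xp0; zmod.
  exact: hKp.
have N00 x : Xpm ip i B0 0 by exact: subX.1.
have ex w : exists x, `|p0 w| < r0 ->
    [/\ Xpm ip i B0 x, `|x| <= R1 / 2 & x = - inv (N (p0X w) x)].
  have [hw|hw] := pselect (`|p0 w| < r0); last by exists 0.
  pose f x := - inv (N (p0X w) x).
  pose U := Xpm ip i B0 `&` [set x : X | `|x| <= R1 / 2].
  have R12 : R1 / 2 < R1 by lra.
  have UR x : U x -> `|x| < R1 by move=> [_ /= h]; exact: le_lt_trans R12.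
  have fq x y : U x -> U y -> `|f x - f y| <= kappa^-1 * `|x - y|.
    move=> Ux Uy; have xR := UR _ Ux; have yR := UR _ Uy.
    rewrite /f -opprD normrN.
    apply: contrN; [exact: inB|by case: Ux|lra|by case: Uy|lra|exact: inV|exact: inV].
  have U0 : U 0 by split; [exact: subX.1|rewrite /= normr0 divr_ge0 // ltW].
  have inv0 : inv (N (p0X 0) 0) = 0.
    have : 0 = - inv (N (p0X 0) 0).
      apply/fix_iff; first exact: subX.1.
      by rewrite /= (linear0 p0X) addr0 A0_eq0 (linear0 i) (linear0 p0).
    by move=> /eqP; rewrite eq_sym oppr_eq0 => /eqP.
  have f0 : `|f 0| <= (1 - kappa^-1) * (R1 / 2).
    have p00 : `|p0 0| < r0 by rewrite (linear0 p0) normr0.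
    have := shift w 0 0 hw p00; rewrite normr0 inv0 subr0 /f normrN.
    move=> /(_ R10) /le_trans; apply; rewrite (linear0 p0) subr0.
    have : M * `|p0 w| <= M * r0 by rewrite ler_wpM2l // ltW.
    by move: r0M; rewrite ler_pdivlMr //; lra.
  have [||||||x [[hx1 hx2] fx]] := @contraction_fixpoint R X U f kappa^-1; last first.
  - by exists x => _; split => //; rewrite -[LHS]fx.
  - exact: fq.
  - move=> x Ux; split.
      have [a1 _ _] := Xpm_invP (N_Xpm (p0X w) x).
      by rewrite /f -scaleN1r; exact: (subspaceZ _ subX).
    have := fq x 0 Ux U0; rewrite subr0 => h.
    have -> : f x = (f x - f 0) + f 0 by rewrite subrK.
    rewrite /= (le_trans (ler_normD _ _)) //.
    have [_ /= xR] := Ux.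
    have : kappa^-1 * `|x| <= kappa^-1 * (R1 / 2) by rewrite ler_wpM2l.
    lra.
  - exact: q1.
  - exact: q0.
  - by exists 0.
  apply: closedI; last exact: closed_norm_le.
  apply: (@closed_comp _ _ i); last exact: (closed_orth nrm).
  by move=> ? _; exact: i_continuous.
have /choice[h hh] := ex.
exists r0, R1, (M / (1 - kappa^-1)), h; split => //.
- by rewrite divr_ge0 // ltW.
- lra.
- by move=> w /hh[].
- by move=> w /hh[].
- by move=> w /hh[hp hl /fix_iff]; apply.
- move=> w x hw hx xR /(fix_iff _ hx) xE.
  have [hp hl hE] := hh w hw.
  have hl' : `|h w| < R1 by lra.
  have : `|x - h w| <= kappa^-1 * `|x - h w|.
    rewrite {1}xE {1}hE -opprD normrN.
    apply: contrN => //; [exact: inB|lra|lra|exact: inV|exact: inV].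
  have [/eqP|xh] := eqVneq (x - h w) 0; first by rewrite subr_eq0 => /eqP.
  by rewrite leNgt gtr_pMl ?normr_gt0 // q1.
- move=> w w' hw hw'.
  have [hp hl hE] := hh w hw; have [hp' hl' hE'] := hh w' hw'.
  have hR : `|h w| < R1 by lra.
  have hR' : `|h w'| < R1 by lra.
  rewrite mulrAC ler_pdivlMr //.
  have e1 : h w - h w' = - (inv (N (p0X w) (h w)) - inv (N (p0X w) (h w')))
      - (inv (N (p0X w) (h w')) - inv (N (p0X w') (h w'))).
    by rewrite {1}hE {1}hE'; zmod.
  have := ler_normB (- (inv (N (p0X w) (h w)) - inv (N (p0X w) (h w'))))
    (inv (N (p0X w) (h w')) - inv (N (p0X w') (h w'))).
  rewrite -e1 normrN.
  have := shift w w' (h w') hw hw' hR'.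
  have : `|inv (N (p0X w) (h w)) - inv (N (p0X w) (h w'))| <= kappa^-1 * `|h w - h w'|.
    apply: contrN => //; [exact: inB|lra|lra|exact: inV|exact: inV].
  lra.
Qed.

End reduction.

(** * The homeomorphism Phi and its inverse *)

Section splitting_map.
Variables (a rho K : R).
Hypothesis eb : energy_bounds Hp Hm V L a rho K.

Let a0 := eb_a0 eb.
Let rho0 := eb_rho0 eb.
Let rV := eb_V eb.

Variables (r0 R1 Kh : R) (h : H -> X).
Hypothesis hred : reduction_data ip i A B0 e0 rho r0 R1 Kh h.

Let R10 := rd_R1 hred.

Let subp := ds_subp spl.
Let subm := ds_subm spl.

Let p0p u : Hp u -> p0 u = 0.
Proof. by move=> hu; apply: p0_perp; exact: Hp_perp0. Qed.
Let p0m u : Hm u -> p0 u = 0.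
Proof. by move=> hu; apply: p0_perp; exact: Hm_perp0. Qed.
Let pmp u : Hp u -> pm u = 0.
Proof. by move=> hu; apply: pm_perp; exact: Hp_perpm. Qed.
Let ppm u : Hm u -> pp u = 0.
Proof. by move=> hu; rewrite /pp p0m // pm_id // subr0 subrr. Qed.
Let ppD u v : pp (u + v) = pp u + pp v.
Proof. by rewrite /pp (linearD p0) (linearD pm) /=; zmod. Qed.
Let pmD u v : pm (u + v) = pm u + pm v. Proof. exact: linearD. Qed.
Let p0D u v : p0 (u + v) = p0 u + p0 v. Proof. exact: linearD. Qed.
Let p0B u v : p0 (u - v) = p0 u - p0 v. Proof. exact: linearB. Qed.
Let p0p0 u : p0 (p0 u) = p0 u. Proof. by rewrite p0_id //; exact: p0_in. Qed.

(** Defined on all of H through P^0. Since z + h(z) + phi_z(.) has H^0-component z, the base of a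
    point of the image is the base of its fibre, which makes the inverse explicit. *)
Definition base (w : H) : H := expand ip e0 id w + i (h w).
Let b := base.
Definition bases : set H := [set q | exists2 w, `|expand ip e0 id w| < r0 & q = base w].
Let Bs := bases.

Let Bb w : `|p0 w| < r0 -> Bs (b w). Proof. by move=> hw; exists w. Qed.

Let bE w : b w = i (p0X w + h w). Proof. by rewrite iD i_p0X. Qed.

Let p0h w : `|p0 w| < r0 -> p0 (i (h w)) = 0.
Proof. by move=> hw; apply: p0_perp; exact: (rd_pm hred hw). Qed.

Let p0b w : `|p0 w| < r0 -> p0 (b w) = p0 w.
Proof. by move=> hw; rewrite /b /base p0D p0h // addr0 p0p0. Qed.

Let h_eq w w' : `|p0 w| < r0 -> p0 w' = p0 w -> h w' = h w.
Proof.
move=> hw e; have hw' : `|p0 w'| < r0 by rewrite e.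
have := rd_lip hred hw' hw; rewrite -/p0 e subrr normr0 mulr0 normr_le0 subr_eq0.
by move=> /eqP.
Qed.

Let b_eq w w' : `|p0 w| < r0 -> p0 w' = p0 w -> b w' = b w.
Proof. by move=> hw e; rewrite /b /base (h_eq hw e) -!/(p0 _) e. Qed.

Let Bsmall q : Bs q -> `|q| < rho / 2.
Proof.
move=> [w hw ->]; apply: lt_le_trans (rd_size hred).
rewrite /base (le_lt_trans (ler_normD _ _)) //.
by have := le_trans (wa_norm_le wa _) (rd_le hred hw); have := R10; lra.
Qed.

(** The equation for h says that A(z + h(z)) lies in H^0, hence is orthogonal to v. *)
Let Dcrit q v : Bs q -> orth ip H0 v -> 'D_v L q = 0.
Proof.
move=> Bq hv; have qr := Bsmall Bq; case: Bq => w hw qE; move: qr; rewrite qE => qr.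
have Vq : V (i (p0X w + h w)).
  by rewrite -bE; apply: rV; have := normr_ge0 (b w); move: qr; rewrite -/b; lra.
rewrite -/b bE DL_grad // -(rd_sol hred hw) ipC.
by apply: hv; exact: p0_in.
Qed.

Let critp q v : Bs q -> Hp v -> 'D_v L q = 0.
Proof. by move=> Bq hv; apply: Dcrit => //; exact: Hp_perp0. Qed.
Let critm q v : Bs q -> Hm v -> 'D_v L q = 0.
Proof. by move=> Bq hv; apply: Dcrit => //; exact: Hm_perp0. Qed.

Let compm r : compact (Hm `&` [set y | `|y| <= r]).
Proof.
have [oe _ es] := hem.
apply: (compact_in_span nrm oe (r := r)) => [|u [/es]] //.
by apply: closedI; [exact: closed_Hm|exact: closed_norm_le].
Qed.

Let fd : fiber_data Hp Hm V L a rho K Bs. Proof. by split. Qed.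

Let s : R := fib_rad rho.
Let s1 : R := fib_radp a rho K.
Let am := amax Hm L rho.
Let jv := jval Hm L rho.
Let gv := gval Hm L rho.
Let fp := fibp Hp Hm L a rho K.
Let fm := fibm Hm L rho.

Variable eps : R.
Hypotheses (eps0 : 0 < eps) (eps_r0 : eps <= r0) (epsp : eps ^+ 2 <= a * s1 ^+ 2)
  (epsm : eps ^+ 2 <= a * (s / 2) ^+ 2).

Let s10 : 0 < s1. Proof. exact: fib_radp_gt0 a0 rho0 (eb_K0 eb). Qed.
Let s1s : s1 <= s. Proof. by rewrite /s1 /fib_radp ge_min lexx. Qed.
Let in_r0 w : `|p0 w| < eps -> `|p0 w| < r0. Proof. by move=> hw; exact: lt_le_trans eps_r0. Qed.

Let fpP q v (Bq : Bs q) (Hv : Hp v) (ve : `|v| < eps) :=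
  fibpP fd eps0 epsp Bq Hv ve.
Let fmP q x v (Bq : Bs q) (Hx : Hp x) (xs : `|x| <= s1) (Hv : Hm v) (ve : `|v| < eps) :=
  fibmP fd eps0 epsm Bq Hx xs Hv ve.
Let amP q x (Bq : Bs q) (xs : `|x| <= s) :=
  amaxP fd Bq xs.
Let am0 q (Bq : Bs q) : am q 0 = 0.
Proof. exact: (amax0 fd Bq). Qed.

Definition fiber_map (z v : H) : H :=
  let q := base z in
  let x := fibp Hp Hm L a rho K q (v - expand ip e0 id v - expand ip em id v) in
  x + amax Hm L rho q x + fibm Hm L rho q x (expand ip em id v).

Definition split_map (p : H * H) : H := base p.1 + fiber_map p.1 p.2.

(** For w in the image, the H^+ component of w - q is x, and the H^- component is m(x) + v; the two
    radial maps return u^+ and u^-. *)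
Definition split_inv (w : H) : H * H :=
  let q := base w in
  let x := (w - q) - expand ip e0 id (w - q) - expand ip em id (w - q) in
  (expand ip e0 id w, radmap (jval Hm L rho q) x +
     radmap (gval Hm L rho q x) (expand ip em id (w - q) - amax Hm L rho q x)).

Let phi := fiber_map.
Let Phi := split_map.
Let Psi := split_inv.

(** An open condition on H * H that contains the product of balls, so that continuity can be proved
    at points of the full space and then restricted. *)
Let dom (p : H * H) := [/\ `|p0 p.1| < eps, `|pp p.2| < eps & `|pm p.2| < eps].
Let domE z v : dom (z, v) -> [/\ `|p0 z| < eps, `|pp v| < eps & `|pm v| < eps].
Proof. by []. Qed.
Let xw (w : H) := pp (w - b w).
Let yw (w : H) := pm (w - b w) - am (b w) (xw w).
Let U (w : H) := [/\ `|p0 w| < eps, `|xw w| < s1 & `|yw w| < s / 2].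
(** The set W given by strict inequalities in maps that are continuous there, which makes it open;
    [imgE] identifies it with the image of Phi. *)
Let Phi_img : set H := [set w | [/\ U w, `|pp (Psi w).2| < eps & `|pm (Psi w).2| < eps]].

Let phi_parts z v : dom (z, v) ->
  let q := b z in let x := fp q (pp v) in let y := fm q x (pm v) in
  [/\ phi z v = x + (am q x + y), [/\ Hp x, `|x| < s1, x = `|x| *: dir (pp v) &
      jv q x = `|pp v| ^+ 2],
    [/\ Hm (am q x), Hm y, `|y| < s / 2 & gv q x y = `|pm v| ^+ 2],
    radmap (jv q) x = pp v & radmap (gv q x) y = pm v].
Proof.
move=> /domE[hz hp hm] q x y; have Bq : Bs q by apply: Bb; exact: in_r0.
have [x1 x2 x5 x3 x4] := fpP Bq (pp_in v) hp.
have [y1 y2 y3 y4] := fmP Bq x1 (ltW x2) (pm_in v) hm.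
have [a1 _ _] := amP Bq (le_trans (ltW x2) s1s).
by split => //; rewrite /phi /fiber_map addrA.
Qed.

Let phi_proj z v : dom (z, v) ->
  let q := b z in let x := fp q (pp v) in let y := fm q x (pm v) in
  [/\ p0 (phi z v) = 0, pp (phi z v) = x & pm (phi z v) = am q x + y].
Proof.
move=> hd q x y; have [-> [Hx _ _ _] [Ha Hy _ _] _ _] := phi_parts hd.
have Hay : Hm (am q x + y) by exact: subspaceD.
split.
- by rewrite p0D (p0p Hx) (p0m Hay) addr0.
- by rewrite ppD (pp_id Hx) (ppm Hay) addr0.
- by rewrite pmD (pmp Hx) (pm_id Hay) add0r.
Qed.

Let p0Phi z v : dom (z, v) -> p0 (Phi (z, v)) = p0 z.
Proof.
move=> hd; have [e1 _ _] := phi_proj hd; case: (domE hd) => hz _ _.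
by rewrite /Phi /split_map /= p0D (e1 : p0 (fiber_map z v) = 0) addr0 p0b // in_r0.
Qed.

Let bPhi z v : dom (z, v) -> b (Phi (z, v)) = b z.
Proof.
by move=> hd; apply: b_eq; [case: (domE hd) => hz _ _; exact: in_r0|exact: p0Phi].
Qed.

Let Phi_sub z v : dom (z, v) -> Phi (z, v) - b (Phi (z, v)) = phi z v.
Proof. by move=> hd; rewrite bPhi // /Phi /split_map /= addrC addKr. Qed.

Let PsiE w : Psi w = (p0 w, radmap (jv (b w)) (xw w) + radmap (gv (b w) (xw w)) (yw w)).
Proof. by []. Qed.

Let PsiPhi z v : dom (z, v) -> Psi (Phi (z, v)) = (p0 z, pp v + pm v).
Proof.
move=> hd; have [_ _ _ rx ry] := phi_parts hd; have [_ e2 e3] := phi_proj hd.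
rewrite PsiE p0Phi // bPhi //.
have -> : xw (Phi (z, v)) = fp (b z) (pp v) by rewrite /xw Phi_sub // e2.
have -> : yw (Phi (z, v)) = fm (b z) (fp (b z) (pp v)) (pm v).
  rewrite /yw Phi_sub // e3 bPhi // /xw Phi_sub // e2.
  by rewrite (addrC (am _ _)) addrK.
by rewrite rx ry.
Qed.

Let pp_sum v : pp (pp v + pm v) = pp v.
Proof. by rewrite ppD (pp_id (pp_in v)) (ppm (pm_in v)) addr0. Qed.
Let pm_sum v : pm (pp v + pm v) = pm v.
Proof. by rewrite pmD (pmp (pp_in v)) (pm_id (pm_in v)) add0r. Qed.

Let Phi_in z v : dom (z, v) -> Phi_img (Phi (z, v)).
Proof.
move=> hd; have [_ [x1 x2 _ _] [_ _ y2 _] _ _] := phi_parts hd.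
have [_ e2 e3] := phi_proj hd; have hd' := hd; case: (domE hd') => hz hp hm.
split; rewrite ?PsiPhi //= ?pp_sum ?pm_sum //; split.
- by rewrite p0Phi.
- by rewrite /xw Phi_sub // e2.
- rewrite /yw Phi_sub // e3 bPhi // /xw Phi_sub // e2.
  by rewrite (addrC (am _ _)) addrK.
Qed.

Let rad_parts w : U w -> [/\ Hp (radmap (jv (b w)) (xw w)),
  Hm (radmap (gv (b w) (xw w)) (yw w)), Hp (xw w), Hm (yw w) & Bs (b w)].
Proof.
move=> [hw xs ys]; have Bq : Bs (b w) by apply: Bb; exact: in_r0.
have Hx : Hp (xw w) by exact: pp_in.
have [a1 _ _] := amP Bq (le_trans (ltW xs) s1s).
have Hy : Hm (yw w) by apply: (subspaceB subm) => //; exact: pm_in.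
split => //; apply: subspaceZ => //; exact: subspaceZ.
Qed.

Let Psi_dom w : Phi_img w -> dom (Psi w) /\ Phi (Psi w) = w.
Proof.
move=> [Uw hp hm]; have [Hrx Hry Hx Hy Bq] := rad_parts Uw.
have [hw xs ys] := Uw.
have hpE : pp (Psi w).2 = radmap (jv (b w)) (xw w).
  by rewrite PsiE /= ppD (pp_id Hrx) (ppm Hry) addr0.
have hmE : pm (Psi w).2 = radmap (gv (b w) (xw w)) (yw w).
  by rewrite PsiE /= pmD (pmp Hrx) (pm_id Hry) add0r.
have hd : dom (Psi w) by split => //; rewrite PsiE /= p0p0.
split => //.
have bq : base (p0 w) = b w by apply: b_eq; [exact: in_r0|exact: p0p0].
rewrite /Phi /split_map /fiber_map [(Psi w).1]/= -!/p0 bq.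
rewrite -/pm -/(pp _) hpE hmE.
rewrite (fibpK fd eps0 epsp Bq Hx (ltW xs)); last first.
  by rewrite -hpE.
rewrite (fibmK fd eps0 epsm Bq Hx (ltW xs) Hy (ltW ys)); last first.
  by rewrite -hmE.
have u0 : p0 (w - b w) = 0 by rewrite p0B p0b ?in_r0 // subrr.
have uE : w - b w = xw w + pm (w - b w) by rewrite /xw /pp u0 subr0 subrK.
rewrite -/(am (b w) (xw w)) /yw.
have -> : xw w + am (b w) (xw w) + (pm (w - b w) - am (b w) (xw w)) = w - b w.
  by rewrite [RHS]uE; zmod.
by rewrite addrC subrK.
Qed.

Let nlt (T : Type) (F : set_system T) (FF : Filter F) (f : T -> H) l (u : R) :
  f @ F --> l -> `|l| < u -> \forall t \near F, `|f t| < u.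
Proof. by move=> cf lu; exact: (cvgr_norm_lt _ cf). Qed.

Let p0_cvg (T : Type) (F : set_system T) (FF : Filter F) (f : T -> H) l :
  f @ F --> l -> p0 (f t) @[t --> F] --> p0 l.
Proof. by move=> cf; apply: (cvg_comp f p0 cf); exact: p0_cont. Qed.
Let pm_cvg (T : Type) (F : set_system T) (FF : Filter F) (f : T -> H) l :
  f @ F --> l -> pm (f t) @[t --> F] --> pm l.
Proof. by move=> cf; apply: (cvg_comp f pm cf); exact: pm_cont. Qed.
Let pp_cvg (T : Type) (F : set_system T) (FF : Filter F) (f : T -> H) l :
  f @ F --> l -> pp (f t) @[t --> F] --> pp l.
Proof. by move=> cf; apply: cvgB; [apply: cvgB => //; exact: p0_cvg|exact: pm_cvg]. Qed.

Lemma h_continuous w : `|p0 w| < r0 -> {for w, continuous h}.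
Proof.
move=> hw; apply/cvgrPdist_lt => e ep.
have d0 : 0 < e / (Kh + 1) by rewrite divr_gt0 // ltr_wpDl // (rd_Kh hred).
have c1 : p0 w' @[w' --> w] --> p0 w by exact: p0_cont.
have c2 : \forall w' \near w, `|p0 w'| < r0 by exact: (cvgr_norm_lt _ c1).
have /cvgrPdist_lt/(_ _ d0) c3 := c1.
near=> w'.
have b2 : `|p0 w'| < r0 by near: w'.
have b3 : `|p0 w - p0 w'| < e / (Kh + 1) by near: w'.
rewrite (le_lt_trans (rd_lip hred hw b2)) //.
move: b3; rewrite ltr_pdivlMr ?ltr_wpDl ?(rd_Kh hred) //; apply: le_lt_trans.
by rewrite mulrC ler_wpM2l // lerDl.
Unshelve. all: by end_near. Qed.

Let b_cvg (T : Type) (F : set_system T) (FF : Filter F) (f : T -> H) l :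
  `|p0 l| < r0 -> f @ F --> l -> b (f t) @[t --> F] --> b l.
Proof.
move=> lr cf; apply: cvgD; first exact: p0_cvg.
have ch : h (f t) @[t --> F] --> h l by apply: (cvg_comp f h cf); exact: h_continuous.
by apply: (cvg_comp (fun t => h (f t)) i ch); exact: i_continuous.
Qed.

Let Bs_near (T : Type) (F : set_system T) (FF : Filter F) (f : T -> H) l :
  `|p0 l| < r0 -> f @ F --> l -> \forall t \near F, Bs (b (f t)).
Proof.
move=> lr cf; have c2 := nlt FF (p0_cvg FF cf) lr.
by apply: filterS c2 => t; exact: Bb.
Qed.

Let b_cvgw w : `|p0 w| < r0 -> b w' @[w' --> w] --> b w.
Proof. by move=> hw; apply: b_cvg => //; exact: cvg_id. Qed.

Let Bs_nearw w : `|p0 w| < r0 -> \forall w' \near w, Bs (b w').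
Proof. by move=> hw; apply: (Bs_near (nbhs_filter w) (f := id) hw); exact: cvg_id. Qed.

Let phi_cvg (T : Type) (F : set_system T) (PF : ProperFilter F) (z_ v_ : T -> H) z v :
  dom (z, v) -> z_ @ F --> z -> v_ @ F --> v ->
  phi (z_ t) (v_ t) @[t --> F] --> phi z v.
Proof.
move=> hd cz cv; have FF : Filter F by apply: filter_filter.
have [_ [Hx x1 _ _] _ _ _] := phi_parts hd; case: (domE hd) => hz hp hm.
have hzr := in_r0 hz; have Bq : Bs (b z) by exact: Bb.
have Bq_ := Bs_near FF hzr cz; have cb := b_cvg FF hzr cz.
have cvp := pp_cvg FF cv; have cvm := pm_cvg FF cv.
have np : \forall t \near F, Hp (pp (v_ t)) /\ `|pp (v_ t)| < eps.
  by have := nlt FF cvp hp; apply: filterS => t; split => //; exact: pp_in.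
have nm : \forall t \near F, Hm (pm (v_ t)) /\ `|pm (v_ t)| < eps.
  by have := nlt FF cvm hm; apply: filterS => t; split => //; exact: pm_in.
have cx := fibp_cvg fd eps0 epsp PF Bq Bq_ cb (pp_in v) hp np cvp.
have nx : \forall t \near F, Hp (fp (b (z_ t)) (pp (v_ t))) /\ `|fp (b (z_ t)) (pp (v_ t))| <= s1.
  apply: filterS2 Bq_ np => t Bt [hpt het].
  by have [k1 k2 _ _ _] := fpP Bt hpt het; split => //; exact: ltW.
have nxs : \forall t \near F, `|fp (b (z_ t)) (pp (v_ t))| <= s.
  by apply: filterS nx => t [_ k]; exact: le_trans s1s.
have ca := amax_cvg fd PF Bq Bq_ cb
  (le_trans (ltW x1) s1s) nxs cx.
have cy := fibm_cvg fd eps0 epsm PF Bq Bq_ cb Hx (ltW x1) nx cx (pm_in v) hm nm cvm.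
by apply: cvgD cy; exact: cvgD cx ca.
Qed.

Let Phi_cont p : dom p -> {for p, continuous Phi}.
Proof.
case: p => z v hd; have hz : `|p0 z| < r0 by case: (domE hd) => hz _ _; exact: in_r0.
apply: cvgD; first by apply: b_cvg => //; exact: cvg_fst.
by apply: phi_cvg => //; [exact: cvg_fst|exact: cvg_snd].
Qed.

Let sub_cvg w : `|p0 w| < r0 -> w' - b w' @[w' --> w] --> w - b w.
Proof. by move=> hw; apply: cvgB; [exact: cvg_id|apply: b_cvg => //; exact: cvg_id]. Qed.

Let xw_cvg w : `|p0 w| < r0 -> xw w' @[w' --> w] --> xw w.
Proof. by move=> hw; apply: pp_cvg; exact: sub_cvg. Qed.

Let xw_near w : `|p0 w| < r0 -> `|xw w| < s1 ->
  \forall w' \near w, Hp (xw w') /\ `|xw w'| <= s1.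
Proof.
move=> hw xs; have := nlt (nbhs_filter w) (xw_cvg hw) xs; apply: filterS => w' k.
by split; [exact: pp_in|exact: ltW].
Qed.

Let yw_cvg w : `|p0 w| < r0 -> `|xw w| < s1 -> yw w' @[w' --> w] --> yw w.
Proof.
move=> hw xs; have Bq : Bs (b w) by exact: Bb.
apply: cvgB; first by apply: pm_cvg; exact: sub_cvg.
have Bq_ := Bs_nearw hw; have cb := b_cvgw hw.
apply: (amax_cvg fd (nbhs_pfilter w) Bq Bq_ cb).
- by apply: le_trans s1s; exact: ltW.
- by apply: filterS (xw_near hw xs) => w' [_ k]; exact: le_trans s1s.
exact: xw_cvg.
Qed.

Let U_near w : U w -> \forall w' \near w, U w'.
Proof.
move=> [hw xs ys]; have hr := in_r0 hw.
have c1 : p0 w' @[w' --> w] --> p0 w by exact: p0_cont.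
have n1 := nlt (nbhs_filter w) c1 hw.
have n2 := nlt (nbhs_filter w) (xw_cvg hr) xs.
have n3 := nlt (nbhs_filter w) (yw_cvg hr xs) ys.
by apply: filterS3 n1 n2 n3 => w' k1 k2 k3; split.
Qed.

Let Psi_cont w : U w -> {for w, continuous Psi}.
Proof.
move=> Uw; have [_ _ Hx Hy Bq] := rad_parts Uw; have [hw xs ys] := Uw.
have hr := in_r0 hw.
have Bq_ := Bs_nearw hr; have cb := b_cvgw hr.
have ny : \forall w' \near w, Hm (yw w') /\ `|yw w'| <= s / 2.
  apply: filterS (U_near Uw) => w' Uw'; have [_ _ _ Hy' _] := rad_parts Uw'.
  by split => //; case: Uw' => _ _ /ltW.
have nx := xw_near hr xs.
apply: cvg_pair; first by apply: p0_cvg; exact: cvg_id.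
apply: cvgD.
  exact: (radp_cvg fd (nbhs_pfilter w) Bq Bq_ cb Hx (ltW xs) nx (xw_cvg hr)).
exact: (radm_cvg fd (nbhs_pfilter w) Bq Bq_ cb Hx (ltW xs) nx (xw_cvg hr) Hy (ltW ys) ny (yw_cvg hr xs)).
Qed.

Let open_img : open Phi_img.
Proof.
rewrite openE => w [Uw hp hm].
have c2 : (Psi w').2 @[w' --> w] --> (Psi w).2.
  by apply: (cvg_comp Psi snd (Psi_cont Uw)); exact: cvg_snd.
have n2 := nlt (nbhs_filter w) (pp_cvg (nbhs_filter w) c2) hp.
have n3 := nlt (nbhs_filter w) (pm_cvg (nbhs_filter w) c2) hm.
by apply: filterS3 (U_near Uw) n2 n3 => w' k1 k2 k3; split.
Qed.

Let Dom : set (H * H) := ball_in H0 eps `*`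
  [set up + um | up in ball_in Hp eps & um in ball_in Hm eps].

Let dom_of z up um : ball_in H0 eps z -> ball_in Hp eps up -> ball_in Hm eps um ->
  [/\ dom (z, up + um), pp (up + um) = up & pm (up + um) = um].
Proof.
move=> [hz zr] [hp pr] [hm mr].
have e1 : pp (up + um) = up by rewrite ppD (pp_id hp) (ppm hm) addr0.
have e2 : pm (up + um) = um by rewrite pmD (pmp hp) (pm_id hm) add0r.
by split => //; split; rewrite /= ?e1 ?e2 // p0_id.
Qed.

Let Dom_dom p : Dom p -> dom p /\ Psi (Phi p) = p.
Proof.
case: p => z v [/= hz [up hp [um hm vE]]].
have [hd e1 e2] := dom_of hz hp hm; rewrite -vE; split => //.
by rewrite PsiPhi // e1 e2 p0_id //; case: hz.
Qed.

Let imgE : Phi @` Dom = Phi_img.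
Proof.
apply/seteqP; split => [_ [[z v] /Dom_dom[hd _] <-]|w hw]; first exact: Phi_in.
have [[d1 d2 d3] e] := Psi_dom hw; exists (Psi w) => //; split.
  by split; [exact: p0_in|rewrite -[_.1]/(p0 w) -p0p0].
exists (pp (Psi w).2); first by split => //; exact: pp_in.
exists (pm (Psi w).2); first by split => //; exact: pm_in.
have [Uw _ _] := hw; have [Hrx Hry _ _ _] := rad_parts Uw.
rewrite PsiE /= ppD pmD (pp_id Hrx) (ppm Hry) (pmp Hrx) (pm_id Hry).
by rewrite addr0 add0r.
Qed.

Let homeo_sub D : D `<=` Dom -> homeo_on D (Phi @` D) Phi.
Proof.
move=> sD; apply: (@homeo_on_image _ _ D Phi Psi).
- by move=> p /sD /Dom_dom[].
- by apply: continuous_in_subspaceT => p; rewrite inE => /sD /Dom_dom[hd _]; exact: Phi_cont.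
- move=> p /sD /Dom_dom[hd _]; apply: Psi_cont.
  by case: p hd => z v /Phi_in[].
Qed.

Let h0_eq0 : h 0 = 0.
Proof.
have p00 : `|p0 0| < r0 by rewrite (linear0 p0) normr0 (rd_r0 hred).
apply/esym/(rd_uniq hred p00).
- by rewrite /Xpm /= linear0; exact: (orth_subspace _ _).1.
- by rewrite normr0.
by rewrite /= (linear0 p0X) addr0 A0_eq0 (linear0 i) (linear0 p0).
Qed.

Let p0X_i z : H0 (i z) -> p0X (i z) = z.
Proof. by move=> hz; apply: (wa_inj wa); rewrite i_p0X p0_id. Qed.

Let sol_iff (y : H) : y - oproj ip H0 y = 0 <-> p0 y = y.
Proof.
rewrite oproj_p0; split => [/eqP|/eqP].
  by rewrite subr_eq0 eq_sym => /eqP.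
by rewrite eq_sym -subr_eq0 => /eqP.
Qed.

Let hmap : reduction_map ip i V A B0 eps h.
Proof.
split; [|split; [|split]].
- apply: continuous_in_subspaceT => z; rewrite inE => -[hz zr].
  by apply: h_continuous; apply: in_r0; rewrite p0_id.
- by move=> z [hz zr]; apply: (rd_pm hred); apply: in_r0; rewrite -/p0 p0_id.
- exact: h0_eq0.
move=> z [hz zr]; have hzr : `|p0 (i z)| < r0 by apply: in_r0; rewrite p0_id.
have e1 : i (z + h (i z)) = b (i z) by rewrite bE p0X_i.
split.
  rewrite e1; apply: rV; have := Bsmall (Bb hzr); have := normr_ge0 (b (i z)); lra.
by apply/sol_iff; have := rd_sol hred hzr; rewrite -/p0X p0X_i.
Qed.

(* By the intermediate value theorem, |h'(t z)| cannot pass from [0, R1/2] to [R1, +oo). *)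
Let huniq h' : reduction_map ip i V A B0 eps h' ->
  forall z, ball_in H0 eps z -> h' z = h z.
Proof.
move=> [/within_continuous_distP ch' [hX [h'0 hsol]]].
have key z : ball_in H0 eps z -> `|h' z| < R1 -> h' z = h z.
  move=> [hz zr] hR; have zE := p0_id hz.
  apply: (rd_uniq hred _ _ hR); first by apply: in_r0; rewrite -/p0 zE.
    by apply: hX.
  rewrite -/p0X; apply/sol_iff.
  have := hsol (p0X z); rewrite i_p0X zE => k.
  by have [] := k (conj hz zr).
move=> z zb; apply: (key z zb); rewrite ltNge; apply/negP => hR.
have [hz zr] := zb.
have zt t : 0 <= t <= 1 -> ball_in H0 eps (t *: z).
  move=> /andP[t0 t1]; split; first exact: (subspaceZ _ sub0).
  by rewrite normrZ ger0_norm // (le_lt_trans _ zr) // ler_piMl.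
have [||t] := @IVT R (fun t => `|h' (t *: z)|) 0 1 (R1 * (3 / 4)) ler01.
- apply/(@within_continuous_distP R R R) => t /=; rewrite in_itv /= => t01 e ep.
  have [d d0 hd] := ch' _ (zt t t01) e ep.
  exists (d / (`|z| + 1)); first by rewrite divr_gt0 // ltr_wpDl.
  move=> t' /=; rewrite in_itv /= => t01' tt.
  rewrite (le_lt_trans (ler_dist_dist _ _)) //; apply: hd; first exact: zt.
  rewrite -scalerBl normrZ; move: tt; rewrite ltr_pdivlMr ?ltr_wpDl //.
  by apply: le_lt_trans; rewrite ler_wpM2l // lerDl.
- rewrite scale0r scale1r h'0 normr0 (min_idPl (normr_ge0 _)) (max_idPr (normr_ge0 _)).
  by have := R10; move=> ?; apply/andP; split; lra.
rewrite in_itv /= => t01 ht; have tb := zt t t01.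
have hlt : `|h' (t *: z)| < R1 by rewrite ht; have := R10; lra.
have [hz' zr'] := tb.
have : `|h (t *: z)| <= R1 / 2 by apply: (rd_le hred); apply: in_r0; rewrite -/p0 p0_id.
by rewrite -(key _ tb hlt) ht; have := R10; lra.
Qed.

Let X_dom (p : X * X) := ball_in H0 eps (i p.1) /\ ball_in Hm eps (i p.2).

Let bp0 : ball_in Hp eps 0. Proof. by split; [exact: subp.1|rewrite normr0]. Qed.

Let fib0 z um : ball_in H0 eps z -> ball_in Hm eps um ->
  [/\ fp (b z) 0 = 0, am (b z) 0 = 0, Hm (fm (b z) 0 um) &
      Phi (z, um) = b z + fm (b z) 0 um].
Proof.
move=> hz hm; have [hd e1 e2] := dom_of hz bp0 hm; rewrite add0r in hd e1 e2.
have [phE [_ _ xE _] [_ Hy _ _] _ _] := phi_parts hd.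
have x0 : fp (b z) 0 = 0 by rewrite -e1 xE e1 /dir !scaler0.
have Bq : Bs (b z) by apply: Bb; apply: in_r0; case: hd.
have a00 := am0 Bq; move: phE Hy; rewrite e1 e2 x0 a00 !add0r => phE Hy.
by split => //; rewrite /Phi /split_map /= -/(phi z um) phE.
Qed.

(** On H^0 x H^- both x and m(x) vanish. What remains is composed of [p0X], [h] and [pmX], which are
    continuous from H (near the point, for [h]) to X; this transfers continuity to the topology of
    X. *)
Let XPhi (p : X * X) : X :=
  p0X (i p.1) + h (i p.1) + pmX (fm (b (i p.1)) 0 (pm (i p.2))).

Let XPhiE p : X_dom p -> toX i (Phi (i p.1, i p.2)) = XPhi p /\ i (XPhi p) = Phi (i p.1, i p.2).
Proof.
move=> [hz hm]; have [_ _ Hy e] := fib0 hz hm.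
have iE : i (XPhi p) = Phi (i p.1, i p.2).
  rewrite e /XPhi iD i_pmX -bE pm_id; last by rewrite pm_id //; case: hm.
  by rewrite pm_id //; case: hm.
by split => //; rewrite -iE toX_i //; exact: (wa_inj wa).
Qed.

Let XPhi_cont p : X_dom p -> {for p, continuous XPhi}.
Proof.
move=> [hz hm]; have zr : `|p0 (i p.1)| < r0 by apply: in_r0; rewrite p0_id; case: hz.
have c1 : i p'.1 @[p' --> p] --> i p.1.
  by apply: (cvg_comp fst i (@cvg_fst _ _ _ _ _)); exact: i_continuous.
have c2 : i p'.2 @[p' --> p] --> i p.2.
  by apply: (cvg_comp snd i (@cvg_snd _ _ _ _ _)); exact: i_continuous.
apply: cvgD; first apply: cvgD.
- by apply: (cvg_comp (fun p' : X * X => i p'.1) p0X c1); exact: (expand_continuous nrm).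
- by apply: (cvg_comp (fun p' : X * X => i p'.1) h c1); exact: h_continuous.
have Bq : Bs (b (i p.1)) by exact: Bb.
have c3 : fm (b (i p'.1)) 0 (pm (i p'.2)) @[p' --> p] --> fm (b (i p.1)) 0 (pm (i p.2)).
  have nz : \forall p' \near p, Hp (0 : H) /\ `|0 : H| <= s1.
    by apply: (@nearW _ (nbhs p) _ (nbhs_filter p)) => _; split; [exact: subp.1|rewrite normr0 ltW].
  have me : `|pm (i p.2)| < eps by rewrite pm_id; case: hm.
  apply: (fibm_cvg fd eps0 epsm (nbhs_pfilter p) Bq (Bs_near (nbhs_filter p) zr c1) (b_cvg (nbhs_filter p) zr c1) subp.1 _ nz (cvg_cst _) (pm_in _) me).
  - by rewrite normr0 ltW.
  - by have := nlt (nbhs_filter p) (pm_cvg (nbhs_filter p) c2) me; apply: filterS => p'; split => //; exact: pm_in.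
  - exact: pm_cvg.
by apply: (cvg_comp _ pmX c3); exact: (expand_continuous nrm).
Qed.

Let Dom_X p : X_dom p -> Dom (i p.1, i p.2).
Proof. by move=> [hz hm]; split => //; exists 0; [exact: bp0|exists (i p.2) => //; rewrite add0r]. Qed.

Theorem splitting_holds :
  splitting ip i V L A B0 Hp Hm eps h Phi_img split_map fiber_map.
Proof.
have z0 : ball_in H0 eps 0 by split; [exact: sub0.1|rewrite normr0].
have m0 : ball_in Hm eps 0 by split; [exact: subm.1|rewrite normr0].
have bz z : ball_in H0 eps z -> b z = z + i (h z).
  by move=> [hz _]; rewrite /b /base -/p0 p0_id.
have fm0 z : ball_in H0 eps z -> fm (b z) 0 0 = 0.
  move=> hz; have [hd e1 e2] := dom_of hz bp0 m0; rewrite addr0 in hd e1 e2.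
  have Bq : Bs (b z) by apply: Bb; apply: in_r0; case: hd.
  have s1le : `|0 : H| <= s1 by rewrite normr0 ltW.
  have m00 : `|0 : H| < eps by rewrite normr0.
  have [Hy ys gy _] := fmP Bq subp.1 s1le subm.1 m00.
  have rg := gval_radial fd Bq subp.1 s1le.
  have := rad_ge rg Hy (ltW ys); rewrite gy normr0 expr0n /= => k.
  have : `|fm (b z) 0 0| ^+ 2 <= 0 by rewrite -(pmulr_rle0 _ a0).
  by rewrite le_eqVlt ltNge sqr_ge0 orbF sqrf_eq0 normr_eq0 => /eqP.
split.
- exact: eps0.
- exact: hmap.
- exact: huniq.
- exact: open_img.
- rewrite -imgE; exists (0, 0); first by split => //; exists 0 => //; exists 0; rewrite ?addr0.
  have [_ _ _ ->] := fib0 z0 m0.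
  by rewrite fm0 // addr0 bz // h0_eq0 linear0 addr0.
- move=> w hw; have [Uw _ _] := hw; have [hd <-] := Psi_dom hw.
  move: hd; case: (Psi w) => z v hd.
  have [_ [_ x1 _ _] [Ha Hy y1 _] _ _] := phi_parts hd.
  have Bq : Bs (b z) by apply: Bb; apply: in_r0; case: hd.
  have [phE _ _ _ _] := phi_parts hd; have [_ ax _] := amP Bq (le_trans (ltW x1) s1s).
  apply: rV; rewrite /Phi /split_map /= -/(phi z v) phE -/b.
  set x := fp _ _ in x1 ax *; set y := am _ _ in ax *; set y' := fm _ _ _ in y1 *.
  have := Bsmall Bq; have := ler_normD (b z) (x + (y + y')).
  have := ler_normD x (y + y'); have := ler_normD y y'.
  move: (s1s) (ax) y1; rewrite -/s /s /fib_rad; have := rho0; lra.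
- by rewrite -imgE; exact: homeo_sub.
- have [_ _ _ e] := fib0 z0 m0.
  by rewrite -[LHS]/(Phi (0, 0)) e fm0 // addr0 bz // h0_eq0 linear0 addr0.
- move=> z up um hz hp hm; have [hd e1 e2] := dom_of hz hp hm; split.
    by rewrite /split_map /= -/(b z) bz.
  have [e [Hx _ _ _] [Ha Hy _ _] _ _] := phi_parts hd.
  rewrite -[fiber_map _ _]/(phi _ _) e; have subo := orth_subspace ip H0.
  apply: (subspaceD subo); first exact: Hp_perp0.
  by apply: Hm_perp0; exact: subspaceD.
- move=> z up um hz hp hm; have [hd e1 e2] := dom_of hz hp hm.
  have [phE [Hx x1 _ jx] [Ha Hy y1 gy] _ _] := phi_parts hd.
  have Bq : Bs (b z) by apply: Bb; apply: in_r0; case: hd.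
  have fv := fib_value L Bq Hx (ltW x1) Hy.
  rewrite -[split_map _]/(b z + phi z (up + um)) phE (addrA (fp _ _)) [LHS]fv.
  by rewrite -/jv -/gv jx gy e1 e2 /reduced_functional bz.
- move=> _ [[z v] [/= hz [up [hp [x _ xE]] [um hm vE]]] <-].
  have [hd e1 e2] := dom_of hz hp hm; rewrite vE in hd e1 e2.
  have [phE [Hx x1 xdir jx] [Ha Hy y1 gy] _ _] := phi_parts hd.
  have rs := range_subspace i.
  rewrite /split_map /= -/(phi _ _) phE -/b.
  apply: (subspaceD rs); first by rewrite bE; exists (p0X z + h z).
  apply: (subspaceD rs).
    (* The H^+ component is a multiple of u^+, which lies in X here. *)
    rewrite xdir e1 -xE; apply: (subspaceZ _ rs); apply: (subspaceZ _ rs).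
    by exists x.
  by apply: (subspaceD rs); exact: Hm_range.
- move=> z hz; have [_ _ _ e] := fib0 hz m0.
  by rewrite -[LHS]/(Phi (z, 0)) e fm0 // addr0 bz.
- move=> z up um hz hp hm; have [hd e1 e2] := dom_of hz hp hm.
  have [_ ex _] := phi_proj hd; rewrite e1 in ex.
  have [phE [Hx x1 xdir jx] [Ha Hy y1 gy] rx _] := phi_parts hd; rewrite e1 in rx xdir.
  split=> [hph|up0].
    have : pp (phi z (up + um)) = 0 by apply: ppm.
    rewrite ex => x0; rewrite -rx x0 /radmap /dir !scaler0 //.
  rewrite -/(phi _ _) phE; apply: (subspaceD subm); last exact: subspaceD.
  by rewrite e1 xdir up0 /dir !scaler0; exact: subm.1.
- apply: homeo_sub => -[z um] [/= hz hm]; split => //.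
  by exists 0; [exact: bp0|exists um => //; rewrite add0r].
- move=> _ [[z um] [/= hz hm] <-]; have [_ _ Hy e] := fib0 hz hm.
  rewrite -[split_map _]/(Phi (z, um)) e.
  apply: (subspaceD (range_subspace i)); last exact: Hm_range.
  by rewrite bE; exists (p0X z + h z).
move=> D PhiX.
(* The inverse for the topologies of X is [Psi] after [i], followed by the finite-rank maps into
   X. *)
apply: (@homeo_on_image _ _ D PhiX (fun y => (p0X (Psi (i y)).1, pmX (Psi (i y)).2))).
- move=> p Dp; have [e1 e2] := XPhiE Dp; rewrite /PhiX e1 e2.
  have [_ ->] := Dom_dom (Dom_X Dp); case: p Dp {e1 e2} => x y [/= hz hm].
  congr (_, _); apply: (wa_inj wa); rewrite ?i_p0X ?i_pmX ?p0_id ?pm_id //.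
    by case: hz.
  by case: hm.
- apply: (subspace_eq_continuous (f := XPhi)).
    by move=> p; rewrite inE => Dp; have [] := XPhiE Dp.
  by apply: continuous_in_subspaceT => p; rewrite inE => Dp; exact: XPhi_cont.
move=> p Dp; have [e1 e2] := XPhiE Dp; rewrite /PhiX e1.
have Up : U (i (XPhi p)).
  have [hd _] := Dom_dom (Dom_X Dp); rewrite e2.
  by move: hd => /Phi_in[].
have ci : Psi (i y) @[y --> XPhi p] --> Psi (i (XPhi p)).
  by apply: (cvg_comp i Psi); [exact: i_continuous|exact: Psi_cont].
have c1 : (Psi (i y)).1 @[y --> XPhi p] --> (Psi (i (XPhi p))).1.
  by apply: (cvg_comp _ fst ci); exact: cvg_fst.
have c2 : (Psi (i y)).2 @[y --> XPhi p] --> (Psi (i (XPhi p))).2.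
  by apply: (cvg_comp _ snd ci); exact: cvg_snd.
apply: cvg_pair.
  by apply: (cvg_comp _ p0X c1); exact: (expand_continuous nrm).
by apply: (cvg_comp _ pmX c2); exact: (expand_continuous nrm).
Qed.

End splitting_map.

(** * Regularity and critical points of the reduced functional *)

Section reduced.
Variables (rho r0 R1 Kh : R) (h : H -> X).
Hypotheses (rV : forall y, `|y| < rho -> V y)
  (hred : reduction_data ip i A B0 e0 rho r0 R1 Kh h)
  (h00 : h 0 = 0).

Let Lo : H -> R := reduced_functional i L h.
Let Y (z : H) : X := p0X z + h z.
Let G (z : H) : H := i (A (Y z)).

Let r0in z : ball_in H0 r0 z -> `|p0 z| < r0. Proof. by move=> [hz zr]; rewrite p0_id. Qed.

Let iY z : ball_in H0 r0 z -> i (Y z) = z + i (h z).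
Proof. by move=> [hz zr]; rewrite (linearD i) /= i_p0X p0_id. Qed.

Let Ysmall z : ball_in H0 r0 z -> `|i (Y z)| < rho.
Proof.
move=> hz; have hr := r0in hz; rewrite iY //.
have := ler_normD z (i (h z)); have := le_trans (wa_norm_le wa _) (rd_le hred hr).
by have := rd_size hred; have := rd_R1 hred; have := rd_r0 hred; case: hz => _; lra.
Qed.

Let G_in z : ball_in H0 r0 z -> H0 (G z).
Proof.
move=> hz; have e : p0 (G z) = G z := rd_sol hred (r0in hz).
by rewrite -e; exact: p0_in.
Qed.

Let G_orth z z' : ball_in H0 r0 z -> ball_in H0 r0 z' -> ip (G z) (i (h z')) = 0.
Proof. by move=> hz hz'; rewrite ipC; apply: (rd_pm hred (r0in hz')); exact: G_in. Qed.

Let Ky : R := (\sum_(y <- e0) `|y| * `|toX i y|) + Kh.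

Let Ky0 : 0 <= Ky.
Proof. by rewrite addr_ge0 ?(rd_Kh hred) // sumr_ge0 // => y _; rewrite mulr_ge0. Qed.

Let Y_lip z z' : ball_in H0 r0 z -> ball_in H0 r0 z' -> `|Y z - Y z'| <= Ky * `|z - z'|.
Proof.
move=> hz hz'; have lh := rd_lip hred (r0in hz) (r0in hz').
have le := expand_bound nrm e0 (toX i) (z - z').
have -> : Y z - Y z' = p0X (z - z') + (h z - h z').
  have e (f : {linear H -> X}) : f (z - z') = f z - f z' by exact: linearB.
  by rewrite e /Y; zmod.
rewrite (le_trans (ler_normD _ _)) // mulrDl lerD //.
by move: lh; rewrite -/p0 (p0_id hz.1) (p0_id hz'.1).
Qed.

(** The mean value theorem on the segment of X from z0 + h(z0) to z1 + h(z1). As G(z0) lies in H^0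
    and h takes values in its orthogonal complement, h drops out of the linear term, so no
    derivative of h enters. *)
Let increment z0 z1 : ball_in H0 r0 z0 -> ball_in H0 r0 z1 ->
  exists2 c : R, 0 <= c <= 1 & Lo z1 - Lo z0 - ip (G z0) (z1 - z0) =
    ip (i (A (Y z0 + c *: (Y z1 - Y z0)) - A (Y z0))) (i (Y z1 - Y z0)).
Proof.
move=> h0 h1; set w := Y z1 - Y z0.
have iE t : i (Y z0 + t *: w) = i (Y z0) + t *: i w by rewrite iD iZ.
have iw : i w = i (Y z1) - i (Y z0) by exact: iB.
have Vt (t : R) : 0 <= t <= 1 -> V (i (Y z0 + t *: w)).
  move=> t01; apply: rV; have := @norm_segment R H 0 (i (Y z0)) (i (Y z1)) t rho t01.
  rewrite !subr0 iE iw.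
  by apply; exact: Ysmall.
have hder (t : R) : 0 <= t <= 1 -> is_derive t 1 (fun s : R => L (i (Y z0) + s *: i w))
    (ip (i (A (Y z0 + t *: w))) (i w)).
  move=> t01; rewrite -(DL_grad _ (Vt t t01)) iE; apply: is_derive_line.
  by rewrite -iE; apply: (wa_F1 wa).1; exact: Vt.
have [c c01 ce] := MVT01 hder; exists c => //.
move: ce; rewrite scale1r scale0r addr0 iw (addrC (i (Y z0))) subrK !iY // => ce.
have -> : Lo z1 - Lo z0 = ip (i (A (Y z0 + c *: w))) (z1 + i (h z1) - (z0 + i (h z0))).
  exact: ce.
have -> : ip (G z0) (z1 - z0) = ip (G z0) (z1 + i (h z1) - (z0 + i (h z0))).
  by rewrite !ipBr !ipDr !G_orth // !addr0.
by rewrite -ipBl iB.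
Qed.

(** A is Lipschitz near z0 + h(z0) in X, and z |-> z + h(z) is Lipschitz into X. Their composition
    bounds the variation of G, and in [increment] a further Lipschitz factor makes the remainder
    quadratic. *)
Let local_bounds z0 : ball_in H0 r0 z0 -> exists2 K : R, 0 <= K & exists2 r : R, 0 < r &
  forall z1 z2, ball_in H0 r0 z1 -> ball_in H0 r0 z2 -> `|z1 - z0| < r -> `|z2 - z0| < r ->
    `|G z1 - G z2| <= K * `|z1 - z2| /\
    `|Lo z2 - Lo z1 - ip (G z1) (z2 - z1)| <= K * `|z2 - z1| ^+ 2.
Proof.
move=> h0; have oX : open (i @^-1` V).
  by apply: open_comp (wa_openV wa) => x _; exact: i_continuous.
have [KA KA0 [rA rA0 [_ lipA]]] :=
  cont_dir_diff_lip (wa_F2_diff wa) oX (rV (Ysmall h0) : (i @^-1` V) (Y z0)).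
have Ky1 : 0 < Ky + 1 by rewrite ltr_wpDl.
exists (KA * (Ky + 1) ^+ 2); first by rewrite mulr_ge0 // exprn_ge0 // ltW.
exists (rA / (Ky + 1)); first exact: divr_gt0.
move=> z1 z2 h1 h2 d1 d2.
have near z : ball_in H0 r0 z -> `|z - z0| < rA / (Ky + 1) -> `|Y z - Y z0| < rA.
  move=> hz; rewrite ltr_pdivlMr // => dz; apply: le_lt_trans (Y_lip hz h0) _.
  by apply: le_lt_trans dz; rewrite mulrC ler_wpM2l // lerDl.
have n1 := near _ h1 d1; have n2 := near _ h2 d2.
have Yl : `|Y z2 - Y z1| <= (Ky + 1) * `|z2 - z1|.
  by apply: le_trans (Y_lip h2 h1) _; rewrite ler_wpM2r // lerDl.
split.
  rewrite /G -iB.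
  apply: le_trans (wa_norm_le wa _) _; apply: le_trans (lipA _ _ n1 n2) _.
  rewrite -mulrA ler_wpM2l // distrC; apply: le_trans Yl _.
  by rewrite (distrC z2) ler_wpM2r // expr2 ler_peMl ?(ltW Ky1) // lerDr.
have [c c01 ->] := increment h1 h2; have [c0 c1] := andP c01.
apply: le_trans (cauchy_schwarz nrm _ _) _.
have nc := norm_segment c01 n1 n2.
have k1 := lipA _ _ nc n1.
have cE : Y z1 + c *: (Y z2 - Y z1) - Y z1 = c *: (Y z2 - Y z1) by rewrite addrC addKr.
rewrite cE normrZ (ger0_norm c0) in k1.
apply: le_trans (ler_pM (normr_ge0 _) (normr_ge0 _) (wa_norm_le wa _) (wa_norm_le wa _)) _.
apply: (@le_trans _ _ (KA * `|Y z2 - Y z1| * `|Y z2 - Y z1|)).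
  rewrite ler_wpM2r //; apply: le_trans k1 _; rewrite ler_wpM2l // ler_piMl //.
rewrite -!(mulrA KA) ler_wpM2l // -exprMn -expr2 ler_pXn2r ?nnegrE ?normr_ge0 //.
exact: mulr_ge0 (ltW Ky1) (normr_ge0 _).
Qed.

Lemma reduced_fderive z : ball_in H0 r0 z -> is_fderive_in H0 Lo z (ip (G z)).
Proof.
move=> hz; split; [|split].
- by move=> a u v _ _; rewrite ipDr ipZr.
- by exists `|G z| => u _; exact: (cauchy_schwarz nrm).
move=> e ep; have [K K0 [r rp lb]] := local_bounds hz.
have K1 : 0 < K + 1 by rewrite ltr_wpDl.
have rz : 0 < r0 - `|z| by rewrite subr_gt0; exact: hz.2.
exists (Num.min (r0 - `|z|) (Num.min r (e / (K + 1)))).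
  by rewrite !lt_min rz rp divr_gt0.
move=> v hv; rewrite !lt_min => /and3P[v1 v2 v3].
have hzv : ball_in H0 r0 (z + v).
  split; first exact: (subspaceD sub0 hz.1).
  by apply: le_lt_trans (ler_normD _ _) _; move: v1; lra.
have zvz : z + v - z = v by rewrite addrAC subrr add0r.
have [|| _] := lb z (z + v) hz hzv; rewrite ?subrr ?normr0 ?zvz //.
move=> k; apply: le_trans k _; rewrite expr2 mulrA ler_wpM2r //.
move: v3; rewrite ltr_pdivlMr // => /ltW; apply: le_trans.
by rewrite mulrC ler_wpM2l // lerDl.
Qed.

Lemma reduced_fderive_X (z : X) : ball_in H0 r0 (i z) ->
  is_fderive_in H0 Lo (i z) (fun u => ip (i (A (z + h (i z)))) u).
Proof.
move=> hz; have e : p0X (i z) = z.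
  by apply: (wa_inj wa); rewrite i_p0X -/p0 (p0_id hz.1).
by have := reduced_fderive hz; rewrite /G /Y e.
Qed.

Lemma reduced_C2m0 eps : eps <= r0 -> C2m0_in H0 (ball_in H0 eps) Lo.
Proof.
move=> er; have sub z : ball_in H0 eps z -> ball_in H0 r0 z.
  by move=> [hz zr]; split => //; exact: lt_le_trans er.
exists (fun z => ip (G z)); split => [z /sub|z0 /sub hz]; first exact: reduced_fderive.
have [K K0 [r rp lb]] := local_bounds hz; exists K, r; split => //.
move=> z1 z2 /sub h1 /sub h2 d1 d2; have [k _] := lb z1 z2 h1 h2 d1 d2.
apply: opnorm_le; [exact: sub0.1|exact: mulr_ge0|move=> u _].
rewrite -ipBl; apply: le_trans (cauchy_schwarz nrm _ _) _.
by rewrite ler_wpM2r.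
Qed.

Lemma reduction_lipschitz eps : 0 < eps -> eps <= r0 -> [lipschitz h z | z in ball_in H0 eps].
Proof.
move=> ep er; have PF : ProperFilter (globally (ball_in H0 eps `*` ball_in H0 eps)).
  have z0 : ball_in H0 eps 0 by split; [exact: sub0.1|rewrite normr0].
  by apply: (@globally_properfilter _ _ (0, 0)).
apply: (@klipschitzW _ _ _ Kh) => -[z z'] [[hz zr] [hz' zr']].
have := rd_lip hred (w := z) (w' := z'); rewrite -/p0 !p0_id //.
by apply; exact: lt_le_trans er.
Qed.

(** At a critical point z, testing with G(z), itself in H^0, gives G(z) = 0, so z + h(z) is critical
    for L on V^X. It is near 0 in X because h is Lipschitz, hence it is 0, and so is its
    H^0-component z. *)
Lemma reduced_isolated eps : 0 < eps -> eps <= r0 ->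
  isolated (critical_points setT (i @^-1` V) (L \o i)) 0 ->
  isolated (critical_points H0 (ball_in H0 eps) Lo) 0.
Proof.
move=> ep er [_ [N nN NE]].
have sub z : ball_in H0 eps z -> ball_in H0 r0 z.
  by move=> [hz zr]; split => //; exact: lt_le_trans er.
have z0 : ball_in H0 eps 0 by split; [exact: sub0.1|rewrite normr0].
have Y0 : Y 0 = 0 by rewrite /Y (linear0 p0X) h00 addr0.
have crit0 : critical_points H0 (ball_in H0 eps) Lo 0.
  split => // u hu; have := is_fderive_in_is_derive sub0 (reduced_fderive (sub _ z0)) hu.
  by rewrite /G Y0 A0_eq0 (linear0 i) ip0l.
split; first exact: mem_set.
move: nN => /nbhs_normP[d /= d0 hd].
have Ky1 : 0 < Ky + 1 by rewrite ltr_wpDl.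
exists [set z | `|z| < d / (Ky + 1)].
  apply/nbhs_normP; exists (d / (Ky + 1)); first exact: divr_gt0.
  by move=> z /=; rewrite sub0r normrN.
apply/seteqP; split => [z [zd [zb cz]]|_ ->]; last first.
  by split => //=; rewrite normr0 divr_gt0.
have hz := sub _ zb.
have G0 : G z = 0.
  have hG := G_in hz; have d1 := is_fderive_in_is_derive sub0 (reduced_fderive hz) hG.
  have d2 := cz _ hG; apply: (ip_eq0 nrm).
  by rewrite -[LHS](@derive_val _ _ _ _ _ _ _ d1) (@derive_val _ _ _ _ _ _ _ d2).
have AY : A (Y z) = 0 by apply: (wa_inj wa); rewrite (linear0 i).
have Vz : V (i (Y z)) by apply: rV; exact: Ysmall.
have cY : (N `&` critical_points setT (i @^-1` V) (L \o i)) (Y z).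
  split.
    apply: hd => /=; rewrite sub0r normrN.
    have := Y_lip hz (sub _ z0); rewrite Y0 !subr0 => k; apply: le_lt_trans k _.
    move: zd => /=; rewrite ltr_pdivlMr //; apply: le_lt_trans.
    by rewrite mulrC ler_wpM2l // lerDl.
  split => // u _; apply/is_derive_comp_linear.
  apply: DeriveDef; first exact: (wa_F1 wa).1.
  by rewrite DL_grad // AY (linear0 i) ip0l.
move: cY; rewrite NE => /= Yz; have := iY hz; rewrite Yz (linear0 i) => e.
have : p0 (z + i (h z)) = 0 by rewrite -e (linear0 p0).
rewrite (linearD p0) /= -/p0 (p0_id hz.1) (p0_perp (rd_pm hred (r0in hz))) addr0.
by [].
Qed.

End reduced.

End admissible.

(** * Choice of the radius and conclusion *)

Lemma splitting_of_contraction (R : realType) (H X : completeNormedModType R)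
    (ip : {dot H for idfun}) (i : {linear X -> H}) (V : set H) (L : H -> R)
    (A : X -> X) (B P Q : X -> {linear H -> H})
    (wa : weakly_admissible ip i V L A B P Q)
    (Hp Hm : set H) (spl : definite_splitting ip (B 0) Hp Hm)
    (nu : nat) (dimH0 : has_dim (kerop (B 0)) nu) (kappa r1 : R) :
  let B0 : H -> H := B 0 in
  let H0 : set H := kerop B0 in
  let IP0 : H -> H := fun u => u - oproj ip H0 u in
  1 < kappa -> 0 < r1 ->
  (forall z x1 x2 : X, ball_in H0 r1 (i z) ->
     Xpm ip i B0 x1 -> `|x1| < r1 -> Xpm ip i B0 x2 -> `|x2| < r1 ->
     V (i (z + x1)) -> V (i (z + x2)) ->
     normX i (IP0 (i (A (z + x1))) - B0 (i x1) - IP0 (i (A (z + x2))) + B0 (i x2))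
       <= (kappa * C1const ip i B0)^-1 * `|x1 - x2|) ->
  exists e0 rho r0 R1 Kh h eps W Phi phi,
    [/\ hilbert_basis ip H0 e0, forall y, `|y| < rho -> V y,
      reduction_data ip i A B0 e0 rho r0 R1 Kh h, eps <= r0 &
      splitting ip i V L A B0 Hp Hm eps h W Phi phi].
Proof.
move=> B0 H0 IP0 kappa1 r10 contr.
have [e0 he0] := H0_finite wa dimH0; have [em hem] := Hm_finite wa spl.
have [a [rho [K eb]]] := energy_estimates wa spl he0 hem.
have [a0 rho0 K0 rV] := And4 (eb_a0 eb) (eb_rho0 eb) (eb_K0 eb) (eb_V eb).
have [r0 [R1 [Kh [h hred]]]] := reduction_exists wa he0 kappa1 r10 contr rho0 rV.
have s1_gt0 : 0 < fib_radp a rho K by exact: fib_radp_gt0.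
have s2_gt0 : 0 < fib_rad rho / 2 by rewrite /fib_rad !divr_gt0.
have sa : 0 < Num.sqrt a by rewrite sqrtr_gt0.
(* r0 is the domain of h; the other two entries put |u^+|^2 and |u^-|^2 in the ranges where [fibp]
   and [fibm] invert the radial maps. *)
set eps := Num.min r0 (Num.min (Num.sqrt a * fib_radp a rho K) (Num.sqrt a * (fib_rad rho / 2))).
have eps0 : 0 < eps by rewrite !lt_min (rd_r0 hred) !mulr_gt0.
have er : eps <= r0 by rewrite ge_min lexx.
have sq (c : R) : 0 < c -> eps <= Num.sqrt a * c -> eps ^+ 2 <= a * c ^+ 2.
  move=> c0 ec; rewrite -[X in X * _](sqr_sqrtr (ltW a0)) -exprMn ler_pXn2r ?nnegrE ?(ltW eps0) //.
  by rewrite mulr_ge0 ?(ltW sa) ?(ltW c0).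
have e1 := sq _ s1_gt0 _; have e2 := sq _ s2_gt0 _.
have {}e1 : eps ^+ 2 <= a * fib_radp a rho K ^+ 2 by apply: e1; rewrite !ge_min lexx !orbT.
have {}e2 : eps ^+ 2 <= a * (fib_rad rho / 2) ^+ 2 by apply: e2; rewrite !ge_min lexx !orbT.
have sp := splitting_holds wa spl he0 hem eb hred eps0 er e1 e2.
by exists e0, rho, r0, R1, Kh, h, eps; do 3 eexists; split; last exact: sp.
Qed.

Theorem theorem8p1 (R : realType) (H X : completeNormedModType R)
    (ip : {dot H for idfun}) (i : {linear X -> H}) (V : set H) (L : H -> R)
    (A : X -> X) (B P Q : X -> {linear H -> H})
    (wa : weakly_admissible ip i V L A B P Q)
    (Hp Hm : set H) (HpHm : definite_splitting ip (B 0) Hp Hm)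
    (nu : nat) (dimH0 : has_dim (kerop (B 0)) nu) (nu_gt0 : (0 < nu)%N) :
  let B0 : H -> H := B 0 in
  let H0 : set H := kerop B0 in
  let IP0 : H -> H := fun u => u - oproj ip H0 u in
  let C1 : R := C1const ip i B0 in
  ((exists kappa r1 : R, 1 < kappa /\ 0 < r1 /\
      forall z x1 x2 : X, ball_in H0 r1 (i z) ->
        Xpm ip i B0 x1 -> `|x1| < r1 -> Xpm ip i B0 x2 -> `|x2| < r1 ->
        V (i (z + x1)) -> V (i (z + x2)) ->
        normX i (IP0 (i (A (z + x1))) - B0 (i x1)
                 - IP0 (i (A (z + x2))) + B0 (i x2))
          <= (kappa * C1)^-1 * `|x1 - x2|) ->
   exists (eps : R) (h : H -> X) (W : set H) (Phi : H * H -> H)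
     (phi : H -> H -> H),
     splitting ip i V L A B0 Hp Hm eps h W Phi phi) /\
  ((exists kappa r1 : R, 1 < kappa /\ 0 < r1 /\
      forall z1 z2 x1 x2 : X, ball_in H0 r1 (i z1) -> ball_in H0 r1 (i z2) ->
        Xpm ip i B0 x1 -> `|x1| < r1 -> Xpm ip i B0 x2 -> `|x2| < r1 ->
        V (i (z1 + x1)) -> V (i (z2 + x2)) ->
        normX i (IP0 (i (A (z1 + x1))) - B0 (i x1)
                 - IP0 (i (A (z2 + x2))) + B0 (i x2))
          <= (kappa * C1)^-1 * `|z1 + x1 - z2 - x2|) ->
   exists (eps : R) (h : H -> X) (W : set H) (Phi : H * H -> H)
     (phi : H -> H -> H),
     let Lo : H -> R := reduced_functional i L h in
     splitting ip i V L A B0 Hp Hm eps h W Phi phi /\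
     [lipschitz h z | z in ball_in H0 eps] /\
     C2m0_in H0 (ball_in H0 eps) Lo /\
     (forall z0 : X, ball_in H0 eps (i z0) ->
        is_fderive_in H0 Lo (i z0) (fun z => ip (i (A (z0 + h (i z0)))) z)) /\
     (isolated (critical_points setT (i @^-1` V) (L \o i)) 0 ->
      isolated (critical_points H0 (ball_in H0 eps) Lo) 0)).
Proof.
split=> -[kappa [r1 [kappa1 [r10 contr]]]].
  have [e0 [rho [r0 [R1 [Kh [h [eps [W [Phi [phi [_ _ _ _ sp]]]]]]]]]]] :=
    splitting_of_contraction wa HpHm dimH0 kappa1 r10 contr.
  by exists eps, h, W, Phi, phi.
have [|e0 [rho [r0 [R1 [Kh [h [eps [W [Phi [phi [he0 rV hred er sp]]]]]]]]]]] :=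
    splitting_of_contraction wa HpHm dimH0 kappa1 r10 _.
  (* For z1 = z2 the stronger condition reduces to (1). *)
  move=> z x1 x2 hz X1 l1 X2 l2 V1 V2.
  have -> : x1 - x2 = z + x1 - z - x2 by zmod.
  exact: contr.
have eps0 := sp_eps sp; have h00 : h 0 = 0 by have [_ [_ [h0 _]]] := sp_h sp.
exists eps, h, W, Phi, phi; split; first exact: sp.
split; first exact: (reduction_lipschitz he0 hred eps0 er).
split; first exact: (reduced_C2m0 wa he0 rV hred er).
split; last exact: (reduced_isolated wa he0 rV hred h00 eps0 er).
move=> z0 [hz zr].
by apply: (reduced_fderive_X wa he0 rV hred); split => //; exact: lt_le_trans er.
Qed.
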